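(* Let $A:\mathbb{R}_+\times\mathbb{R}\to\mathbb{R}$ be a nonrandom function satisfying the following two conditions. (C1) There exists a constant $p>0$ such that $A(t,x)=px+B(t,x)$, where the function $B(t,x)$ is bounded, i.e. $\sup_{0\le t\le 1}\sup_{x\in\mathbb{R}}|B(t,x)|<\infty$. (C2) The partial derivative $B'_x(t,x)=\partial B(t,x)/\partial x$ satisfies $\sup_{0\le t\le 1}\sup_{x\in\mathbb{R}}|B'_x(t,x)|<p$, and it is uniformly continuous in the sense that $$\lim_{h\to 0}\ \sup_{0\le t\le 1}\ \sup_{|x-y|\le h}\left|B'_x(t,x)-B'_x(t,y)\right|=0 .$$ Then there exists a nonrandom parameter $\varepsilon_0>0$ such that for all $0<\varepsilon\le\varepsilon_0$ the stochastic differential equation $$\mathrm{d}\dot{x}^{\varepsilon}(t)=\varepsilon^2\left(A(t,x^{\varepsilon}(t))+f(t)\right)\mathrm{d}t+\varepsilon^2\,\delta(t)\,\mathrm{d}W_t,\qquad 0\le t\le 1,$$ with one (any one) of the boundary conditions (i) $x(0)=x(1)=0$; (ii) $\dot{x}(0)=\dot{x}(1)=0$; (iii) $x(0)=x(1)$ and $\dot{x}(0)=\dot{x}(1)$; has a unique strong solution that is almost surely continuously differentiable.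
   Context: Here $(W_t)_{0\le t\le 1}$ is an arbitrary standard Brownian motion, $f$ is the real-valued function of $t$ appearing in the equation, and $\delta:\mathbb{R}\to\mathbb{R}$ is a function with $\int_0^1\delta^2(t)\,\mathrm{d}t<\infty$. The dot denotes the derivative in $t$. A strong solution is a process defined on the same probability space as the given Brownian motion $W$ and determined by it, with almost surely continuously differentiable paths, satisfying the boundary condition and, in integrated form, $\dot x^\varepsilon(t)=\dot x^\varepsilon(0)+\varepsilon^2\int_0^t\left(A(s,x^\varepsilon(s))+f(s)\right)\mathrm{d}s+\varepsilon^2\int_0^t\delta(s)\,\mathrm{d}W_s$ for $0\le t\le1$; it is not required to be adapted to the filtration of $W$.
   Formalization: The statement adds that for every x the function s ↦ A(s,x)+f(s) is (Borel measurable and) Lebesgue integrable on [0,1], and that δ is Borel measurable; without integrability, e.g. f(t)=1/t, the equation has no meaning and no solution. *)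

(* Defs.v *)
From HB Require Import structures.
From mathcomp Require Import all_boot all_order all_algebra.
From mathcomp Require Import all_classical all_reals all_analysis.

Set Implicit Arguments.
Unset Strict Implicit.
Unset Printing Implicit Defensive.

Import Order.TTheory GRing.Theory Num.Theory.
Import numFieldNormedType.Exports.

Local Open Scope classical_set_scope.
Local Open Scope ring_scope.

Section coefficients.
Context {R : realType}.
Implicit Types (A B : R -> R -> R) (p : R).

Definition sup_strip (F : R -> R -> R) : \bar R :=
  ereal_sup [set (F t x)%:E | t in `[0, 1] & x in [set: R]].

(* The decomposition is required on the whole domain t >= 0 of A, the bound
   only for t in [0, 1]. *)
Definition cond_C1 A p B : Prop :=
  [/\ 0 < p,
      (forall t x, 0 <= t -> A t x = p * x + B t x) &
      (sup_strip (fun t x => `|B t x|%R) < +oo)%E].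

Definition modulus_x (F : R -> R -> R) (h : R) : \bar R :=
  ereal_sup [set e | exists t x y,
    [/\ t \in `[0, 1], `|x - y| <= h & e = `|F t x - F t y|%:E]].

Definition cond_C2 p B : Prop :=
  [/\ (forall t x, t \in `[0, 1] -> derivable (B t) x 1),
      (sup_strip (fun t x => `|'D_1 (B t) x|%R) < p%:E)%E &
      modulus_x (fun t x => 'D_1 (B t) x) h @[h --> 0^'+] --> 0%E].

End coefficients.

Section paths.
Context {R : realType}.
Implicit Types u : R -> R.

(* Difference quotients are taken inside [0, 1], hence the derivative is
   one-sided at 0 and at 1, and values of u outside [0, 1] are irrelevant. *)
Definition diff_quot u (t s : R) : R := (u s - u t) / (s - t).

Definition dot u (t : R) : R :=
  lim (diff_quot u t s @[s --> within `[0, 1] t^']).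

Definition C1_path u : Prop :=
  (forall t, t \in `[0, 1] ->
     cvg (diff_quot u t s @[s --> within `[0, 1] t^'])) /\
  {within `[0, 1], continuous (dot u)}.

Inductive boundary := Dirichlet | Neumann | Periodic.

Definition satisfies_bc (b : boundary) u : Prop :=
  match b with
  | Dirichlet => u 0 = 0 /\ u 1 = 0
  | Neumann => dot u 0 = 0 /\ dot u 1 = 0
  | Periodic => u 0 = u 1 /\ dot u 0 = dot u 1
  end.

End paths.

Section brownian.
Context {R : realType} {d : measure_display} {Omega : measurableType d}.
Variable P : probability Omega R.
Implicit Types W M x : R -> Omega -> R.

(* The product rule for the full family of increments gives it for every
   subfamily, by taking some of the Borel sets equal to setT. *)
Definition independent_increments W : Prop :=
  forall (n : nat) (tau : nat -> R) (B : nat -> set R),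
    0 <= tau 0%N -> tau n <= 1 ->
    (forall i, (i < n)%N -> tau i <= tau i.+1) ->
    (forall i, measurable (B i)) ->
    P (\bigcap_(i in `I_n) ((W (tau i.+1) \- W (tau i)) @^-1` B i)) =
    (\prod_(i < n) P ((W (tau i.+1) \- W (tau i))%R @^-1` B i))%E.

(* normal_prob takes the standard deviation; it is not a Dirac mass when the
   latter is 0, whence the strict inequality s < t. *)
Definition brownian_motion W : Prop :=
  [/\ (forall t, t \in `[0, 1] -> measurable_fun [set: Omega] (W t)),
      {ae P, forall w, W 0 w = 0},
      independent_increments W,
      (forall s t (B : set R), 0 <= s -> s < t -> t <= 1 -> measurable B ->
         P ((W t \- W s) @^-1` B) = normal_prob 0 (Num.sqrt (t - s)) B) &
      {ae P, forall w, {within `[0, 1], continuous (W ^~ w)}}].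

(* The triple ((a, b), c) stands for the elementary function c 1_(a, b]. *)
Definition step_fun (q : seq (R * R * R)) (s : R) : R :=
  \sum_(e <- q) e.2 * \1_(`]e.1.1, e.1.2]%classic : set R) s.

Definition step_in (t : R) (q : seq (R * R * R)) : bool :=
  all (fun e => (0 <= e.1.1) && (e.1.1 <= e.1.2) && (e.1.2 <= t)) q.

Definition step_integral W (q : seq (R * R * R)) (w : Omega) : R :=
  \sum_(e <- q) e.2 * (W e.1.2 w - W e.1.1 w).

(* Y is the Wiener integral of delta over [0, t]: the L^2(P)-limit of the
   integrals of step functions converging to delta in L^2([0, t]). By the
   isometry property it does not depend, up to a.s. equality, on the chosen
   sequence. *)
Definition wiener_integral W (delta : R -> R) (t : R) (Y : Omega -> R) :
    Prop :=
  measurable_fun [set: Omega] Y /\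
  exists phi : nat -> seq (R * R * R),
    [/\ (forall n, step_in t (phi n)),
        (\int[lebesgue_measure]_(s in `[0%R, t])
           ((step_fun (phi n) s - delta s) ^+ 2)%:E)%E @[n --> \oo] --> 0%E &
        (\int[P]_w ((step_integral W (phi n) w - Y w) ^+ 2)%:E)%E
           @[n --> \oo] --> 0%E].

Definition wiener_integral_process W (delta : R -> R) M : Prop :=
  (forall t, t \in `[0, 1] -> wiener_integral W delta t (M t)) /\
  {ae P, forall w, {within `[0, 1], continuous (M ^~ w)}}.

(* The sigma-algebra of (W_t), 0 <= t <= 1, augmented by the P-null events. *)
Definition brownian_sigma_algebra W : set (set Omega) :=
  <<s [set E | exists t (B : set R),
         [/\ t \in `[0, 1], measurable B & E = W t @^-1` B] ] `|`
      [set N | measurable N /\ P N = 0%E] >>.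

(* The whole path of W may be used at each time t: no adaptedness. *)
Definition determined_by W x : Prop :=
  forall t (B : set R), t \in `[0, 1] -> measurable B ->
    brownian_sigma_algebra W (x t @^-1` B).

Definition strong_solution W (A : R -> R -> R) (f delta : R -> R) (eps : R)
    (b : boundary) x : Prop :=
  [/\ determined_by W x,
      {ae P, forall w, C1_path (x ^~ w)},
      {ae P, forall w, satisfies_bc b (x ^~ w)} &
      exists M, wiener_integral_process W delta M /\
        {ae P, forall w, forall t, t \in `[0, 1] ->
           dot (x ^~ w) t = dot (x ^~ w) 0
             + eps ^+ 2 * (\int[lebesgue_measure]_(s in `[0%R, t])
                             (A s (x s w) + f s))%R
             + eps ^+ 2 * M t w}].

Definition indistinguishable x y : Prop :=
  {ae P, forall w, forall t, t \in `[0, 1] -> x t w = y t w}.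

End brownian.

(* Main.v *)
(* Integrating the equation path by path, x solves, with M_t = int_0^t delta dW,
     x'(t) = x'(0) + eps^2 g(t),  g(t) = int_0^t (A(s, x(s)) + f(s)) ds + M_t.
   In cases (ii) and (iii) the boundary condition forces g(1) = 0, which fixes
   x(0) because A is strictly increasing in x; this is encoded by the update
   x(0) <- x(0) - g(1) / L, L being a Lipschitz constant of A. Together with
   x(t) - x(0) <- eps^2 (int_0^t g - t int_0^1 g) (no second term in case (ii)),
   it is a contraction of C[0, 1] for small eps, in the norm that gives
   x - x(0) a large weight. The contraction gives uniqueness and, since its
   iterates are measurable functions of the path of M, the measurability of the
   solution.

   M is the limit of the integrals of step functions converging to delta in L^2
   fast enough for Kolmogorov's maximal inequality and the Borel-Cantelli lemma
   to make the convergence almost surely uniform on [0, 1]. Set to 0 on the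
   exceptional null event, it is continuous with M_0 = 0 for every outcome. *)

From HB Require Import structures.
Require Import Defs.
From mathcomp Require Import all_boot all_order all_algebra.
From mathcomp Require Import all_classical all_reals all_analysis.
From mathcomp Require Import measurable_realfun.
From mathcomp Require Import ring lra.
Import Order.TTheory GRing.Theory Num.Theory.
Import numFieldNormedType.Exports.
Local Open Scope classical_set_scope.
Local Open Scope ring_scope.

Set Implicit Arguments.
Unset Strict Implicit.
Unset Printing Implicit Defensive.

(** * Paths on the unit interval *)

(** The obstacle is resonance: in cases (ii) and (iii) the constants solve the homogeneous problem
    x'' = 0, so no integral operator carrying a factor eps^2 determines x(0); only the monotonicity
    of the drift can. With k = sup |B'_x| < p, the difference quotients of A in x lie between m = p
    - k and L = p + k, so a correction of x(0) with step 1/L does not overshoot and contracts by 1 -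
    m/L. The variation x - x(0) disturbs this by at most its own size; weighted by 2L/m it costs
    half of the gain and leaves the rate 1 - m/(2L). In exchange the integral operator has to reach
    that rate in the weighted norm, which it does once 12 L^2 eps^2 <= m. As the noise is additive,
    each path of M poses a deterministic problem, and m and L depend only on p and B: hence eps0 is
    nonrandom and common to the three boundary conditions. The values g(1) and int_0^1 g involve the
    whole path of M, which is why adaptedness is lost. *)

Section unit_interval.
Context {R : realType}.
Implicit Types (u v g : R -> R) (t s : R).
Local Notation mu := (@lebesgue_measure R).

Lemma cont01P u : {within `[0, 1], continuous u} <->
  forall t, 0 <= t <= 1 -> forall e : R, 0 < e -> exists2 d : R, 0 < d &
    forall s, 0 <= s <= 1 -> `|s - t| < d -> `|u s - u t| <= e.
Proof.
rewrite subspace_continuousP; split=> [cu t t01 e e0|cu t /=].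
  have /cu/cvgrPdist_le/(_ e e0) : `[0, 1]%classic t by rewrite /= in_itv.
  rewrite near_withinE /= => /nbhs_ballP[d /= d0 dP]; exists d => // s s01 st.
  rewrite distrC; apply: dP; last by rewrite /= in_itv.
  by rewrite /ball/= distrC.
rewrite /= in_itv/= => t01; apply/cvgrPdist_le => e e0.
have [d d0 dP] := cu _ t01 _ e0.
rewrite near_withinE; apply/nbhs_ballP; exists d => // s /= ts.
rewrite in_itv/= => s01; rewrite distrC; apply: dP => //.
by rewrite distrC.
Qed.

Lemma cont01_lim (w : nat -> R -> R) u :
  (forall n, {within `[0, 1], continuous (w n)}) ->
  (forall e : R, 0 < e -> exists n, forall t, 0 <= t <= 1 -> `|w n t - u t| <= e) ->
  {within `[0, 1], continuous u}.
Proof.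
move=> cw wu; apply/cont01P => t t01 e e0.
have e3 : 0 < e / 3 by rewrite divr_gt0.
have [n wn] := wu _ e3.
have /cont01P/(_ _ t01 _ e3)[d d0 dP] := cw n; exists d => // s s01 st.
have := wn s s01; have := wn t t01; have := dP s s01 st.
rewrite !ler_distl => /andP[? ?] /andP[? ?] /andP[? ?]; apply/andP; split; lra.
Qed.

Lemma cont01_bounded u : {within `[0, 1], continuous u} ->
  exists2 K : R, 0 < K & forall t, 0 <= t <= 1 -> `|u t| <= K.
Proof.
move=> cu; have cu' : {within `[0, 1], continuous (fun t => `|u t|)}.
  apply/cont01P => t t01 e e0; have /cont01P/(_ _ t01 _ e0)[d d0 dP] := cu.
  exists d => // s s01 st; apply: le_trans (dP s s01 st).
  exact: ler_dist_dist.
have [c _ cmax] := EVT_max ler01 cu'; exists (`|u c| + 1).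
  by rewrite ltr_wpDl.
by move=> t t01; rewrite (le_trans (cmax t _)) ?lerDl // in_itv.
Qed.

Lemma integrable_subR (D E : set R) (f : R -> \bar R) : measurable E ->
  measurable D -> D `<=` E -> mu.-integrable E f -> mu.-integrable D f.
Proof. by move=> mE mD DE; exact: (@integrableS _ _ _ mu E D f mE mD DE). Qed.

Lemma cont01_integrable u (D : set R) : measurable D -> D `<=` `[0, 1] ->
  {within `[0, 1], continuous u} -> mu.-integrable D (EFin \o u).
Proof.
move=> mD D01 cu; have iu : mu.-integrable `[0, 1] (EFin \o u).
  exact: continuous_compact_integrable (@segment_compact _ _ _) cu.
exact: integrable_subR iu.
Qed.

Lemma integrable_cst_itv (a b c : R) : mu.-integrable `]a, b] (EFin \o cst c).
Proof.
have ic : mu.-integrable `[a, b] (EFin \o cst c).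
  apply: continuous_compact_integrable (@segment_compact _ _ _) _.
  by apply: continuous_subspaceT => ?; exact: cvg_cst.
apply: integrable_subR ic => //; exact: subset_itv_oc_cc.
Qed.

Lemma length_itvoc (a b : R) : a <= b -> fine (mu `]a, b]) = b - a.
Proof.
move=> ab; rewrite lebesgue_measure_itv/= lte_fin; case: ltP => //= ba.
by apply/esym/eqP; rewrite subr_eq0 eq_le ba.
Qed.

Lemma Rintegral_le_bound (a b e : R) g : a <= b ->
  mu.-integrable `]a, b] (EFin \o g) ->
  (forall r, a < r <= b -> `|g r| <= e) ->
  `|\int[mu]_(r in `]a, b]) g r| <= e * (b - a).
Proof.
move=> ab ig ge; apply: le_trans (le_normr_Rintegral _ ig) _ => //.
apply: le_trans (le_Rintegral (f2 := cst e) _ _ _ _) _ => //=.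
- exact: integrable_norm ig.
- exact: integrable_cst_itv.
- by rewrite Rintegral_cst //= length_itvoc.
Qed.

End unit_interval.

(** * One-sided derivatives and primitives on [0, 1] *)

Section one_sided_derivative.
Context {R : realType}.
Implicit Types (u v g : R -> R) (t s l : R).
Local Notation mu := (@lebesgue_measure R).

(** Cleared of the division by [s - t], so that [s = t] need not be excluded and derivatives combine
    as first-order expansions. *)
Definition has_dot u t l := forall e : R, 0 < e -> exists2 d : R, 0 < d &
  forall s, 0 <= s <= 1 -> `|s - t| < d ->
  `|u s - u t - l * (s - t)| <= e * `|s - t|.

Lemma has_dotP u t l : 0 <= t <= 1 ->
  (diff_quot u t s @[s --> within `[0, 1] t^'] --> l) <-> has_dot u t l.
Proof.
move=> t01; split=> [/cvgrPdist_le h e e0|h].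
  have := h e e0; rewrite near_withinE => /nbhs_ballP[d /= d0 dP].
  exists d => // s s01 st; have [->|sDt] := eqVneq s t.
    by rewrite !subrr mulr0 subrr !normr0 mulr0.
  have st0 : s - t != 0 by rewrite subr_eq0.
  rewrite -ler_pdivrMr ?normr_gt0// -normf_div mulrBl mulfK// distrC.
  by apply: dP; rewrite /= ?in_itv // /ball/= distrC.
apply/cvgrPdist_le => e e0; have [d d0 dP] := h e e0.
rewrite near_withinE; apply/nbhs_ballP; exists d => // s /= ts sDt.
rewrite in_itv/= => s01.
have st0 : s - t != 0 by rewrite subr_eq0.
have := dP s s01; rewrite distrC => /(_ ts).
by rewrite distrC -ler_pdivrMr ?normr_gt0// -normf_div mulrBl mulfK// distrC.
Qed.

(** Properness makes limits unique, without which the [lim] in [dot] could not be evaluated. A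
    second point near [t] is taken to the right if [t <= 1 / 2] and to the left otherwise: on that
    side there is room for a step of length at most 1/2. *)
Lemma within01_proper t : 0 <= t <= 1 -> ProperFilter (within `[0, 1] t^').
Proof.
move=> t01; apply: Build_ProperFilter_ex => P.
rewrite /within => /nbhs_ballP[d /= d0 dP].
have [t2|t2] := leP t (1 / 2).
  exists (t + Num.min (d / 2) (1 / 2)); apply: dP; rewrite /= ?in_itv/= /ball/=.
  - rewrite opprD addNKr normrN gtr0_norm.
      by rewrite minElt; case: ifPn => ?; lra.
    by rewrite lt_min; apply/andP; split; lra.
  - rewrite -subr_eq0 addrC addKr gt_eqF// lt_min.
    by apply/andP; split; lra.
  - have : 0 <= Num.min (d / 2) (1 / 2) by rewrite le_min; apply/andP; split; lra.
    have : Num.min (d / 2) (1 / 2) <= 1 / 2 by rewrite ge_min lexx orbT.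
    by move=> ? ?; lra.
exists (t - Num.min (d / 2) (1 / 2)); apply: dP; rewrite /= ?in_itv/= /ball/=.
- rewrite opprB addrC subrK gtr0_norm.
    by rewrite minElt; case: ifPn => ?; lra.
  by rewrite lt_min; apply/andP; split; lra.
- rewrite -subr_eq0 addrC addKr oppr_eq0 gt_eqF// lt_min.
  by apply/andP; split; lra.
- have : 0 <= Num.min (d / 2) (1 / 2) by rewrite le_min; apply/andP; split; lra.
  have : Num.min (d / 2) (1 / 2) <= 1 / 2 by rewrite ge_min lexx orbT.
  by move=> ? ?; lra.
Qed.

Lemma dotE u t l : 0 <= t <= 1 -> has_dot u t l -> dot u t = l.
Proof.
move=> t01 h; have pf := within01_proper t01.
by apply: cvg_lim => //; apply/has_dotP.
Qed.

Lemma C1_path_dot u t : C1_path u -> 0 <= t <= 1 -> has_dot u t (dot u t).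
Proof. by move=> [cu _] t01; apply/has_dotP => //; apply: cu; rewrite in_itv. Qed.

Lemma C1_pathI u v : (forall t, 0 <= t <= 1 -> has_dot u t (v t)) ->
  {within `[0, 1], continuous v} -> C1_path u.
Proof.
move=> uv cv; split=> [t|].
  by rewrite in_itv/= => t01; apply/cvg_ex; exists (v t); apply/has_dotP; auto.
apply/cont01P => t t01 e e0; have /cont01P/(_ _ t01 _ e0)[d d0 dP] := cv.
by exists d => // s s01; rewrite !(dotE _ (uv _ _))//; exact: dP.
Qed.

Lemma has_dot_lin u v t l k a b : has_dot u t l -> has_dot v t k ->
  has_dot (fun s => a * u s + b * v s) t (a * l + b * k).
Proof.
move=> hu hv e e0; pose A : R := `|a| + `|b| + 1.
have A0 : 0 < A by rewrite /A ltr_wpDl// addr_ge0.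
have [d d0 dP] := hu _ (divr_gt0 e0 A0).
have [d' d'0 d'P] := hv _ (divr_gt0 e0 A0).
exists (Num.min d d'); first by rewrite lt_min d0.
move=> s s01; rewrite lt_min => /andP[/(dP _ s01) h /(d'P _ s01) h'].
have -> : a * u s + b * v s - (a * u t + b * v t) - (a * l + b * k) * (s - t) =
  a * (u s - u t - l * (s - t)) + b * (v s - v t - k * (s - t)) by ring.
apply: (le_trans (ler_normD _ _)); rewrite !normrM.
apply: (le_trans (lerD (ler_wpM2l (normr_ge0 _) h) (ler_wpM2l (normr_ge0 _) h'))).
rewrite -mulrDl mulrA; apply: ler_wpM2r => //.
rewrite mulrA ler_pdivrMr// mulrC; apply: ler_wpM2l; first exact: ltW.
by rewrite /A lerDl.
Qed.

Lemma has_dot_id t : has_dot id t 1.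
Proof.
by move=> e e0; exists 1 => // s _ _; rewrite mul1r subrr normr0 mulr_ge0// ltW.
Qed.

Lemma has_dot_cst c t : has_dot (cst c) t 0.
Proof.
by move=> e e0; exists 1 => // s _ _; rewrite mul0r /= !subrr normr0 mulr_ge0// ltW.
Qed.

Lemma has_dot_cont u v : (forall t, 0 <= t <= 1 -> has_dot u t (v t)) ->
  {within `[0, 1], continuous u}.
Proof.
move=> uv; apply/cont01P => t t01 e e0.
have [d d0 dP] := uv t t01 1 ltr01.
pose A : R := `|v t| + 1; have A0 : 0 < A by rewrite ltr_wpDl.
exists (Num.min d (e / A)); first by rewrite lt_min d0 divr_gt0.
move=> s s01; rewrite lt_min => /andP[/(dP _ s01) h]; rewrite ltr_pdivlMr// => h'.
have -> : u s - u t = (u s - u t - v t * (s - t)) + v t * (s - t) by ring.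
apply: (le_trans (ler_normD _ _)); rewrite normrM.
apply: le_trans (ltW h').
have -> : `|s - t| * A = `|s - t| + `|v t| * `|s - t| by rewrite /A; ring.
by rewrite lerD2r; rewrite mul1r in h.
Qed.

Lemma has_dot0_cst u : (forall t, 0 <= t <= 1 -> has_dot u t 0) ->
  forall t, 0 <= t <= 1 -> u t = u 0.
Proof.
move=> hu t /andP[t0 t1].
have cu := has_dot_cont hu.
(* At interior points the derivative within [0, 1] is the ordinary one, so the mean value theorem
   applies on [0, t]. *)
have der (x : R) : x \in `]0, t[ -> is_derive x (1 : R) (u : R -> R^o) (0 : R^o).
  rewrite in_itv/= => /andP[x0 xt].
  have : h^-1 *: (u (h *: (1:R) + x) - u x) @[h --> 0^'] --> (0 : R).
    apply/cvgrPdist_le => /= e e0.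
    have x01 : 0 <= x <= 1 by apply/andP; split; lra.
    have [d d0 dP] := hu x x01 e e0.
    near=> h.
    have h0 : h != 0 by near: h; exact: nbhs_dnbhs_neq.
    have hd : `|h| < Num.min d (Num.min x (t - x)).
      near: h; apply: dnbhs0_lt; rewrite !lt_min d0 x0 /=; lra.
    move: hd; rewrite !lt_min => /and3P[hd /ltr_normlP[hx _] /ltr_normlP[_ hx']].
    have := dP (h + x); rewrite addrK mul0r subr0 => /(_ _ hd) uP.
    rewrite sub0r normrN scaler1 normrZ normfV.
    rewrite mulrC ler_pdivrMr ?normr_gt0//; apply: uP.
    by apply/andP; split; lra.
  move=> ud; split; first by apply/cvg_ex; exists 0.
  exact: cvg_lim ud.
have c0t : {within `[0, t], continuous u}.
  by apply: continuous_subspaceW cu; apply: subset_itvl; rewrite bnd_simp.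
have [c _] := MVT_segment t0 der c0t.
by rewrite mul0r => /eqP; rewrite subr_eq0 => /eqP.
Unshelve. all: by end_near.
Qed.

Definition prim g t := \int[mu]_(s in `[0, t]) g s.

Lemma prim0 g : prim g 0 = 0.
Proof. by rewrite /prim set_itv1 Rintegral_set1. Qed.

Lemma primB g s t : mu.-integrable `[0, 1] (EFin \o g) ->
  0 <= t -> t <= s -> s <= 1 -> prim g s - prim g t = \int[mu]_(r in `]t, s]) g r.
Proof.
move=> ig t0 ts s1; rewrite /prim Rintegral_itvB// ?bnd_simp//.
by apply: integrable_subR ig => //; apply: subset_itvl; rewrite bnd_simp.
Qed.

Lemma integrable01_sub g s t : 0 <= t -> s <= 1 ->
  mu.-integrable `[0, 1] (EFin \o g) -> mu.-integrable `]t, s] (EFin \o g).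
Proof.
move=> t0 s1 ig; apply: integrable_subR ig => //.
by apply: subset_itv; rewrite bnd_simp.
Qed.

Lemma prim_le_bound g t e : mu.-integrable `[0, 1] (EFin \o g) ->
  0 <= t <= 1 -> 0 <= e -> (forall r, 0 <= r <= 1 -> `|g r| <= e) -> `|prim g t| <= e.
Proof.
move=> ig /andP[t0 t1] e0 ge; rewrite -[prim g t]subr0 -[X in _ - X](prim0 g) primB//.
apply: le_trans (Rintegral_le_bound (e := e) t0 _ _) _.
- exact: integrable01_sub ig.
- by move=> r /andP[r0 rt]; apply: ge; rewrite (ltW r0)/= (le_trans rt).
- by rewrite subr0 ler_piMr.
Qed.

Lemma has_dot_prim g t : {within `[0, 1], continuous g} -> 0 <= t <= 1 ->
  has_dot (prim g) t (g t).
Proof.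
move=> cg t01 e e0.
have ig : mu.-integrable `[0, 1] (EFin \o g) by exact: cont01_integrable cg.
have /cont01P/(_ _ t01 _ e0)[d d0 dP] := cg; exists d => //.
(* The estimate for ordered end points is used with [t] as the left end and as the right end. *)
suff H a b : 0 <= a -> a <= b -> b <= 1 ->
    (forall r : R, a < r <= b -> `|g r - g t| <= e) ->
    `|prim g b - prim g a - g t * (b - a)| <= e * (b - a).
  move: t01 => /andP[t0 t1] s /andP[s0 s1] st.
  have [ts|ts] := leP t s.
    rewrite [X in _ <= _ * X]ger0_norm ?subr_ge0//.
    apply: H => // r /andP[tr rs]; apply: dP; first by apply/andP; split; lra.
    by move: st; rewrite !ger0_norm ?subr_ge0 ?(ltW tr)//; lra.
  have -> : prim g s - prim g t - g t * (s - t) =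
    - (prim g t - prim g s - g t * (t - s)) by ring.
  rewrite normrN [`|s - t|]distrC [X in _ <= _ * X]gtr0_norm ?subr_gt0//.
  apply: H => //; first exact: ltW.
  move=> r /andP[sr rt]; apply: dP; first by apply/andP; split; lra.
  move: st; rewrite distrC [X in _ -> X < _]distrC.
  by rewrite gtr0_norm ?subr_gt0// ger0_norm ?subr_ge0//; lra.
move=> a0 ab b1 gd; rewrite primB//.
have -> : g t * (b - a) = \int[mu]_(r in `]a, b]) (cst (g t) r).
  by rewrite Rintegral_cst// length_itvoc.
rewrite -RintegralB//.
- apply: Rintegral_le_bound => //.
  have /= := integrableB _ (integrable01_sub a0 b1 ig) (integrable_cst_itv a b (g t)).
  exact.
- exact: integrable01_sub ig.
- exact: integrable_cst_itv.
Qed.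

End one_sided_derivative.

Lemma Rintegral_sum d (T : measurableType d) {R : realType}
    (mu : {measure set T -> \bar R}) (D : set T) I (r : seq I) (h : I -> T -> R) :
  measurable D -> (forall i, mu.-integrable D (EFin \o h i)) ->
  \int[mu]_(x in D) (\sum_(i <- r) h i x) = \sum_(i <- r) \int[mu]_(x in D) h i x.
Proof.
move=> mD ih; rewrite /Rintegral; under eq_integral do rewrite -sumEFin.
rewrite (integral_sum _ ih)// sum_fine// => i _.
by apply: integrable_fin_num => //; exact: ih.
Qed.

(** * Drift integrals along a continuous path, for Caratheodory integrands *)

Section caratheodory.
Context {R : realType}.
Implicit Types (x : R -> R) (t s : R).
Local Notation mu := (@lebesgue_measure R).

(** Open on the left, so that for N > 0 the first N cells partition ]0, 1]; the point 0 left out is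
    a null set. *)
Definition cell (N i : nat) : set R := `]i%:R / N%:R, i.+1%:R / N%:R].

Lemma cellP (N : nat) s : (0 < N)%N -> 0 < s <= 1 ->
  exists k, [/\ (k < N)%N, cell N k s & forall F : nat -> R,
    \sum_(i < N) \1_(cell N i) s * F i = F k].
Proof.
move=> N0 /andP[s0 s1]; have N0' : 0 < N%:R :> R by rewrite ltr0n.
have exn : exists n : nat, s * N%:R <= n%:R.
  by exists N; rewrite ler_piMl// ltW.
(* The index of the cell is the predecessor of the least n with s N <= n, and this n is not 0
   because s > 0. *)
case: (ex_minnP exn) => -[|k] kP kmin; first by nra.
have ks : k%:R < s * N%:R.
  by rewrite ltNge; apply/negP => /kmin; rewrite ltnn.
have kN : (k < N)%N by apply: kmin; rewrite ler_piMl// ltW.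
have cs : cell N k s by rewrite /cell/= in_itv/= ltr_pdivrMr// ks ler_pdivlMr.
exists k; split => // F.
rewrite (bigD1 (Ordinal kN)) //= indicE mem_set// mul1r big1 ?addr0// => i ik.
rewrite indicE memNset ?mul0r// /cell/= in_itv/= ltr_pdivrMr// ler_pdivlMr//.
move=> /andP[is_ si]; move/eqP: ik; apply; apply/val_inj => /=.
have := lt_le_trans is_ kP; have := lt_le_trans ks si.
by rewrite !ltr_nat !ltnS => ki ik; apply/eqP; rewrite eqn_leq ik.
Qed.

Lemma cell_dist (N k : nat) s : (k < N)%N -> cell N k s ->
  [/\ 0 <= k%:R / N%:R :> R, k%:R / N%:R <= 1 :> R & `|k%:R / N%:R - s| <= N%:R^-1].
Proof.
move=> kN; have N0 : 0 < N%:R :> R by rewrite ltr0n (leq_trans _ kN).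
rewrite /cell/= in_itv/= => /andP[h1 h2]; split.
- by rewrite divr_ge0.
- by rewrite ler_pdivrMr// mul1r ler_nat ltnW.
- move: h2; rewrite -natr1 mulrDl mul1r => h2.
  by rewrite ler0_norm ?subr_le0 ?(ltW h1)//; lra.
Qed.

(** Only the path is frozen on each cell, not the time in [b]: no regularity of [b] in time is then
    involved, and measurability of [b] at each fixed space point will suffice. *)
Lemma step_approx_cvg (b : R -> R -> R) x s (L : R) :
  0 <= L -> (forall y z, `|b s y - b s z| <= L * `|y - z|) ->
  {within `[0, 1], continuous x} -> 0 < s <= 1 ->
  \sum_(i < n.+1) \1_(cell n.+1 i) s * b s (x (i%:R / n.+1%:R)) @[n --> \oo]
    --> b s (x s).
Proof.
move=> L0 lip cx s01; apply/cvgrPdist_le => e e0.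
have L1 : 0 < L + 1 by rewrite ltr_wpDl.
have s01' : 0 <= s <= 1 by case/andP: s01 => /ltW -> ->.
have /cont01P/(_ _ s01' _ (divr_gt0 e0 L1))[d d0 dP] := cx.
have := @cvg_harmonic R => /cvgrPdist_lt/(_ _ d0).
apply: filterS => n; rewrite sub0r normrN ger0_norm ?harmonic_ge0// => nd.
have [k [kn cks ->]] :
    exists k, [/\ (k < n.+1)%N, cell n.+1 k s &
      \sum_(i < n.+1) \1_(cell n.+1 i) s * b s (x (i%:R / n.+1%:R)) =
      b s (x (k%:R / n.+1%:R))].
  have [k [kn cks kE]] := cellP (ltn0Sn n) s01; exists k; split => //.
  exact: (kE (fun i => b s (x (i%:R / n.+1%:R)))).
have [k0 k1 ks] := cell_dist kn cks.
apply: le_trans (lip _ _) _; rewrite distrC.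
apply: (@le_trans _ _ (L * (e / (L + 1)))).
  by rewrite ler_wpM2l// dP ?k0//; exact: le_lt_trans nd.
rewrite mulrA ler_pdivrMr// mulrC; apply: ler_wpM2l; first exact: ltW.
by rewrite lerDl.
Qed.

Variables (a : R -> R -> R) (L : R).
Hypothesis L0 : 0 <= L.
Hypothesis lip : forall s, 0 <= s <= 1 -> forall y z, `|a s y - a s z| <= L * `|y - z|.
Hypothesis inta : forall y, mu.-integrable `[0, 1] (EFin \o a ^~ y).

Lemma measurable_step_approx x n (D : set R) : measurable D -> D `<=` `[0, 1] ->
  measurable_fun D (fun s => \sum_(i < n) \1_(cell n i) s * a s (x (i%:R / n%:R))).
Proof.
move=> mD D01; apply: measurable_sum => i; apply: measurable_funM.
  by apply: measurable_indic; exact: measurable_itv.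
have /integrableP[/measurable_EFinP ma _] := inta (x (i%:R / n%:R)).
by apply: measurable_funS ma.
Qed.

Lemma measurable_superpos x : {within `[0, 1], continuous x} ->
  measurable_fun (`[0, 1] : set R) (fun s => a s (x s)).
Proof.
(* The cells miss the point 0, which is treated apart. *)
move=> cx; have -> : `[0, 1]%classic = `]0, 1] `|` [set 0] :> set R.
  by rewrite setUC (@setU1itv _ _ _ _ false)// bnd_simp.
apply/measurable_funU => //; split; last exact: measurable_fun_set1.
apply: (@measurable_fun_cvg _ _ _ _
  (fun n s => \sum_(i < n.+1) \1_(cell n.+1 i) s * a s (x (i%:R / n.+1%:R)))).
  move=> n; apply: measurable_step_approx => //; exact: subset_itv_oc_cc.
move=> s /=; rewrite in_itv/= => s01.
apply: (step_approx_cvg L0 _ cx s01).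
by apply: lip; case/andP: s01 => /ltW -> ->.
Qed.

Let dom (K s : R) : R := `|a s 0| + L * K.

Let integrable_dom K : mu.-integrable `[0, 1] (EFin \o dom K).
Proof.
have i1 := integrable_norm (inta 0).
have i2 : mu.-integrable `[0, 1] (EFin \o cst (L * K)).
  apply: cont01_integrable => //.
  by apply: continuous_subspaceT => ?; exact: cvg_cst.
exact: (integrableD _ i1 i2).
Qed.

Let dom_le K s y : 0 <= s <= 1 -> `|y| <= K -> `|a s y| <= dom K s.
Proof.
move=> s01 yK; have := lip s01 y 0; rewrite subr0 => h.
rewrite -[a s y](subrK (a s 0)) addrC (le_trans (ler_normD _ _))// lerD2l.
by rewrite (le_trans h)// ler_wpM2l.
Qed.

Lemma integrable_superpos x : {within `[0, 1], continuous x} ->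
  mu.-integrable `[0, 1] (EFin \o fun s => a s (x s)).
Proof.
move=> cx; have [K K0 xK] := cont01_bounded cx.
apply: (le_integrable _ _ _ (integrable_dom K)) => //.
  by apply/measurable_EFinP; exact: measurable_superpos.
move=> s /=; rewrite in_itv/= => s01; rewrite lee_fin [leRHS]ger0_norm.
  by apply: dom_le => //; exact: xK.
by rewrite addr_ge0// mulr_ge0// ltW.
Qed.

Lemma integrable_cellM (n i : nat) y t : 0 <= t <= 1 ->
  mu.-integrable `]0, t] (EFin \o fun s => \1_(cell n i) s * a s y).
Proof.
move=> /andP[t0 t1].
have iy := integrable01_sub (lexx 0) t1 (inta y).
apply: (le_integrable _ _ _ iy) => //.
  apply/measurable_EFinP; apply: measurable_funM.
    by apply: measurable_indic; exact: measurable_itv.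
  by have /integrableP[/measurable_EFinP ? _] := iy.
move=> s _; rewrite /= lee_fin normrM ler_piMl// indicE.
by case: (_ \in _); rewrite ?normr1 ?normr0.
Qed.

(** Each summand depends on the path only through its value at one grid point, so the drift integral
    becomes a limit of functions of finitely many values of the path. *)
Lemma Rintegral_step_approx x t : 0 <= t <= 1 -> {within `[0, 1], continuous x} ->
  \sum_(i < n.+1)
     \int[mu]_(s in `]0, t]) (\1_(cell n.+1 i) s * a s (x (i%:R / n.+1%:R)))
  @[n --> \oo] --> prim (fun s => a s (x s)) t.
Proof.
move=> /[dup] t01 /andP[t0 t1] cx; have [K K0 xK] := cont01_bounded cx.
have ix := integrable01_sub (lexx 0) t1 (integrable_superpos cx).
have sub t' : `]0, t]%classic t' -> 0 < t' <= 1.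
  by rewrite /= in_itv/= => /andP[-> /le_trans ->].
rewrite /prim -Rintegral_itv_obnd_cbnd//.
pose f n s := \sum_(i < n.+1) \1_(cell n.+1 i) s * a s (x (i%:R / n.+1%:R)).
have fE n : \int[mu]_(s in `]0, t]) f n s = \sum_(i < n.+1)
     \int[mu]_(s in `]0, t]) (\1_(cell n.+1 i) s * a s (x (i%:R / n.+1%:R))).
  by apply: Rintegral_sum => // i; exact: integrable_cellM.
under eq_fun do rewrite -fE.
apply: fine_cvg; rewrite fineK; last exact: integrable_fin_num.
apply: (@dominated_cvg _ _ _ mu `]0, t]%classic _ (fun n s => (f n s)%:E)
  (fun s => (a s (x s))%:E) (fun s => (dom K s)%:E)) => //.
- move=> n; apply/measurable_EFinP; apply: measurable_step_approx => //.
  by move=> s /sub /andP[/ltW s0 s1]; rewrite /= in_itv/= s0.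
- move=> s /sub s01; apply: cvg_EFin; first exact: nearW.
  apply: (step_approx_cvg L0 _ cx s01).
  by apply: lip; case/andP: s01 => /ltW -> ->.
- exact: integrable01_sub (integrable_dom K).
- move=> n s /sub s01; rewrite /f /= lee_fin.
  have [k [kn cks kE]] := cellP (ltn0Sn n) s01.
  rewrite (kE (fun i => a s (x (i%:R / n.+1%:R)))).
  have [k0 k1 ks] := cell_dist kn cks.
  apply: dom_le; first by case/andP: s01 => /ltW -> ->.
  by apply: xK; rewrite k0.
Qed.

Lemma cont_prim_superpos x : {within `[0, 1], continuous x} ->
  {within `[0, 1], continuous (prim (fun s => a s (x s)))}.
Proof.
by move=> cx; apply: parameterized_integral_continuous => //; exact: integrable_superpos.
Qed.

(** Measurability of [X t] at each fixed t is enough, with no joint measurability: the integral is a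
    limit of sums of functions of single values X(i/n), and these functions are Lipschitz, hence
    Borel. *)
Lemma measurable_prim_superpos d (Omega : measurableType d) (X : R -> Omega -> R) :
  (forall t, 0 <= t <= 1 -> measurable_fun [set: Omega] (X t)) ->
  (forall w, {within `[0, 1], continuous (X ^~ w)}) ->
  forall t, 0 <= t <= 1 ->
  measurable_fun [set: Omega] (fun w => prim (fun s => a s (X s w)) t).
Proof.
move=> mX cX t t01; have /andP[t0 t1] := t01.
apply: (@measurable_fun_cvg _ _ _ _ (fun n w => \sum_(i < n.+1)
    \int[mu]_(s in `]0, t]) (\1_(cell n.+1 i) s * a s (X (i%:R / n.+1%:R) w)))).
  move=> n; apply: measurable_sum => i.
  pose phi y := \int[mu]_(s in `]0, t]) (\1_(cell n.+1 i) s * a s y).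
  apply: (@measurableT_comp _ _ _ _ _ _ phi).
    apply: continuous_measurable_fun => y; apply/cvgrPdist_le => e e0.
    have L1 : 0 < L + 1 by rewrite ltr_wpDl.
    near=> z; rewrite /phi -RintegralB//; try exact: integrable_cellM.
    apply: le_trans (Rintegral_le_bound (e := L * `|y - z|) t0 _ _) _.
    + have /= := integrableB _ (integrable_cellM n.+1 i y t01)
        (integrable_cellM n.+1 i z t01); exact.
    + move=> s /andP[s0 st]; rewrite -mulrBr normrM.
      apply: le_trans (_ : 1 * `|a s y - a s z| <= _).
        rewrite ler_wpM2r// indicE; case: (_ \in _); by rewrite ?normr1 ?normr0.
      by rewrite mul1r lip// (ltW s0)/= (le_trans st).
    + rewrite subr0; apply: le_trans (_ : (L + 1) * `|y - z| <= _).
        apply: (@le_trans _ _ (L * `|y - z|)); first by rewrite ler_piMr ?mulr_ge0.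
        by rewrite ler_wpM2r// lerDl.
      rewrite mulrC -ler_pdivlMr//; near: z; apply: cvgr_dist_le => //.
      by rewrite divr_gt0.
  apply: mX; apply/andP; split; first by rewrite divr_ge0.
  by rewrite ler_pdivrMr// mul1r ler_nat ltnW.
by move=> w _; apply: Rintegral_step_approx.
Unshelve. all: by end_near.
Qed.

End caratheodory.

(** * Sequences with geometric increments *)

Section geometric_limit.
Context {R : realType}.

Lemma geometric_gap (u : nat -> R) (C q : R) (n0 n k : nat) : 0 <= C -> 0 <= q < 1 ->
  (forall n, (n0 <= n)%N -> `|u n.+1 - u n| <= C * q ^+ n) -> (n0 <= n)%N ->
  `|u (n + k)%N - u n| <= C * q ^+ n / (1 - q).
Proof.
move=> C0 /andP[q0 q1] du n0n; have q1' : 0 < 1 - q by rewrite subr_gt0.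
(* The factor 1 - q^k, the exact partial geometric sum, is what makes the induction close. *)
have h : `|u (n + k)%N - u n| <= C * q ^+ n / (1 - q) * (1 - q ^+ k).
  elim: k => [|k IH]; first by rewrite addn0 subrr normr0 expr0 subrr mulr0.
  have := du (n + k)%N; rewrite (leq_trans n0n) ?leq_addr// => /(_ isT) dk.
  rewrite addnS -[u _ - u n](subrKA (u (n + k)%N)).
  apply: le_trans (ler_normD _ _) _.
  apply: le_trans (lerD dk IH) _; rewrite exprD exprS le_eqVlt; apply/orP; left.
  by apply/eqP; field; rewrite gt_eqF.
apply: (le_trans h); rewrite ler_piMr ?gerBl ?exprn_ge0//.
by apply: divr_ge0; [rewrite mulr_ge0// exprn_ge0|exact: ltW].
Qed.

(** The threshold [n0] serves the Borel-Cantelli argument, where the increments are small only from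
    a random index on. *)
Lemma geometric_lim (u : nat -> R) (C q : R) (n0 : nat) : 0 <= C -> 0 <= q < 1 ->
  (forall n, (n0 <= n)%N -> `|u n.+1 - u n| <= C * q ^+ n) ->
  u @ \oo --> limn u /\
  forall n, (n0 <= n)%N -> `|limn u - u n| <= C * q ^+ n / (1 - q).
Proof.
move=> C0 q01 du; have q1 : 0 < 1 - q by case/andP: q01; rewrite subr_gt0.
have gap := geometric_gap _ C0 q01 du.
have small (e : R) : 0 < e -> exists2 n, (n0 <= n)%N & C * q ^+ n / (1 - q) < e.
  move=> e0; have C1 : 0 < C + 1 by rewrite ltr_wpDl.
  have qn : `|q| < 1 by case/andP: q01 => q0; rewrite ger0_norm.
  have d0 : 0 < e * (1 - q) / (C + 1) by rewrite divr_gt0// mulr_gt0.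
  have [N _ NP] := (@cvgrPdist_lt _ _ _ _ _ _ _).1 (cvg_expr qn) _ d0.
  exists (maxn n0 N); rewrite ?leq_maxl// ltr_pdivrMr//.
  have := NP (maxn n0 N) (leq_maxr _ _).
  rewrite sub0r normrN ger0_norm ?exprn_ge0 ?(andP q01).1//.
  rewrite ltr_pdivlMr// => h; apply: le_lt_trans h.
  by rewrite mulrC ler_wpM2l ?lerDl// exprn_ge0// (andP q01).1.
have cu : cvgn u.
  apply: cauchy_cvg; apply: cauchy_exP => e e0.
  have [n n0n ne] := small e e0; exists (u n); exists n => // m /= nm.
  rewrite /ball/= distrC; apply: le_lt_trans ne.
  by rewrite -(subnKC nm); exact: gap.
split=> // n n0n; apply: (@cvgr_to_le _ \oo _ _ (fun m => `|u m - u n|)).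
  by apply: cvg_norm; apply: cvgB => //; exact: cvg_cst.
by exists n => // m /= nm; rewrite -(subnKC nm); exact: gap.
Qed.

End geometric_limit.

(** * The boundary value problem along one path *)

Section boundary_value_problem.
Context {R : realType}.
Variables (a : R -> R -> R) (m L : R).
Implicit Types (x y M : R -> R) (t s : R).
Local Notation mu := (@lebesgue_measure R).
Hypotheses (m0 : 0 < m) (mL : m <= L).
Hypothesis lip : forall s, 0 <= s <= 1 -> forall y z : R, `|a s y - a s z| <= L * `|y - z|.
Hypothesis mono : forall s, 0 <= s <= 1 -> forall y z : R, z <= y -> m * (y - z) <= a s y - a s z.
Hypothesis inta : forall y : R, mu.-integrable `[0, 1] (EFin \o a ^~ y).

Let L0 : 0 < L. Proof. exact: lt_le_trans mL. Qed.

(** The function g of the overview. *)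
Definition slope x M t := prim (fun s => a s (x s)) t + M t.

(** [free_value] and [free_slope] indicate whether the boundary condition leaves x(0), respectively
    x'(0), open. *)
Definition free_value (b : boundary) : R := if b is Dirichlet then 0 else 1.
Definition free_slope (b : boundary) : R := if b is Neumann then 0 else 1.

Variables (b : boundary) (e2 : R).

(* The initial value [x 0], when it is free, is corrected by a damped step
   towards the solution of [slope x M 1 = 0]; when [free_slope b = 1] the
   initial slope is chosen so that [x 1 = x 0]. *)
Definition bvp_map M x t := free_value b * (x 0 - slope x M 1 / L) +
  e2 * (prim (slope x M) t - free_slope b * t * prim (slope x M) 1).

Definition solves_bvp M x := [/\ C1_path x, satisfies_bc b x &
  forall t, 0 <= t <= 1 -> dot x t = dot x 0 + e2 * slope x M t].

Hypothesis e20 : 0 < e2.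

Lemma slope_cont x M : {within `[0, 1], continuous x} ->
  {within `[0, 1], continuous M} -> {within `[0, 1], continuous (slope x M)}.
Proof.
move=> cx cM t; apply: cvgD; last exact: cM.
exact: (cont_prim_superpos (ltW L0) lip inta cx).
Qed.

Lemma has_dot_lin3 (u v w : R -> R) t l k h (c1 c2 c3 : R) :
  has_dot u t l -> has_dot v t k -> has_dot w t h ->
  has_dot (fun s => c1 * u s + c2 * v s + c3 * w s) t (c1 * l + c2 * k + c3 * h).
Proof.
move=> hu hv hw; have := has_dot_lin 1 c3 (has_dot_lin c1 c2 hu hv) hw.
by rewrite mul1r; under [X in has_dot X]eq_fun do rewrite mul1r.
Qed.

Lemma has_dot_bvp_map x M t : {within `[0, 1], continuous x} ->
  {within `[0, 1], continuous M} -> 0 <= t <= 1 ->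
  has_dot (bvp_map M x) t (e2 * (slope x M t - free_slope b * prim (slope x M) 1)).
Proof.
move=> cx cM t01; have cs := slope_cont cx cM.
pose c := free_value b * (x 0 - slope x M 1 / L).
pose k := - e2 * free_slope b * prim (slope x M) 1.
have := has_dot_lin3 c e2 k (has_dot_cst 1 t) (has_dot_prim cs t01) (has_dot_id t).
have -> : c * 0 + e2 * slope x M t + k * 1 =
  e2 * (slope x M t - free_slope b * prim (slope x M) 1) by rewrite /k; ring.
by congr has_dot; apply/funext => s; rewrite /bvp_map -/c /k /=; ring.
Qed.

Lemma bvp_map_cont x M : {within `[0, 1], continuous x} ->
  {within `[0, 1], continuous M} -> {within `[0, 1], continuous (bvp_map M x)}.
Proof. by move=> cx cM; apply: has_dot_cont => t; exact: has_dot_bvp_map. Qed.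

Lemma bvp_map0 x M : bvp_map M x 0 = free_value b * (x 0 - slope x M 1 / L).
Proof. by rewrite /bvp_map prim0 mulr0 mul0r subrr mulr0 addr0. Qed.

Lemma slope0 x M : slope x M 0 = M 0.
Proof. by rewrite /slope prim0 add0r. Qed.

Lemma has_dot_congr (u v : R -> R) t l : 0 <= t <= 1 ->
  (forall s, 0 <= s <= 1 -> u s = v s) -> has_dot u t l -> has_dot v t l.
Proof.
move=> t01 uv hu e e0; have [d d0 dP] := hu e e0; exists d => // s s01 st.
by rewrite -!uv//; exact: dP.
Qed.

(** The fixed point equation at time 0 says x(0) = 0 or [slope x M 1 = 0], and at time 1 it gives
    x(1) = x(0) unless [free_slope b = 0]. Since [M 0 = 0], the slope vanishes at time 0, so x'(0)
    is the integral correction alone and x'(1) = x'(0) as soon as the slope vanishes at time 1. *)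
Lemma fixpoint_solves_bvp x M : {within `[0, 1], continuous x} ->
  {within `[0, 1], continuous M} -> M 0 = 0 ->
  (forall t, 0 <= t <= 1 -> bvp_map M x t = x t) -> solves_bvp M x.
Proof.
move=> cx cM M0 fx.
have i0 : 0 <= (0 : R) <= 1 by rewrite lexx ler01.
have i1 : 0 <= (1 : R) <= 1 by rewrite lexx ler01.
have hd t : 0 <= t <= 1 ->
    has_dot x t (e2 * (slope x M t - free_slope b * prim (slope x M) 1)).
  by move=> t01; apply: has_dot_congr (has_dot_bvp_map cx cM t01).
have dE t t01 := dotE t01 (hd t t01).
have x0E : x 0 = free_value b * (x 0 - slope x M 1 / L) by rewrite -bvp_map0 fx.
have x1E : x 1 = x 0 + e2 * (1 - free_slope b) * prim (slope x M) 1.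
  by rewrite -(fx 1)// {1}/bvp_map -x0E; ring.
have s1 : free_value b = 1 -> slope x M 1 = 0.
  move=> b1; move: x0E; rewrite b1 mul1r => /eqP.
  by rewrite -subr_eq0 subKr mulf_eq0 invr_eq0 (gt_eqF L0) orbF => /eqP.
split.
- apply: C1_pathI hd _.
  have cs := slope_cont cx cM; apply/cont01P => t t01 e e0.
  have /cont01P/(_ _ t01 _ (divr_gt0 e0 e20))[d d0 dP] := cs.
  exists d => // s s01 st; rewrite -mulrBr opprB addrA subrK normrM gtr0_norm//.
  by rewrite mulrC -ler_pdivlMr//; exact: dP.
- rewrite /satisfies_bc !dE//.
  move: x0E x1E s1; case: (b) => /= x0E x1E s1.
  + by rewrite x1E subrr mulr0 mul0r addr0 x0E mul0r.
  + by rewrite s1// slope0 M0 mul0r subrr mulr0.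
  + by rewrite s1// slope0 M0 x1E subrr mulr0 mul0r addr0.
- by move=> t t01; rewrite !dE// slope0 M0; ring.
Qed.

Lemma solves_bvp_cont x M : solves_bvp M x -> {within `[0, 1], continuous x}.
Proof. by move=> [C1x _ _]; apply: has_dot_cont => t; exact: C1_path_dot. Qed.

(** Integrating the equation once more expresses x through x(0), x'(0) and the slope. The boundary
    condition then supplies the missing data: the value of x'(0), and the vanishing of the slope at
    time 1 when x(0) is open. *)
Lemma solves_bvp_fixpoint x M : {within `[0, 1], continuous M} -> solves_bvp M x ->
  forall t, 0 <= t <= 1 -> bvp_map M x t = x t.
Proof.
move=> cM sx t t01; have cx := solves_bvp_cont sx; have cs := slope_cont cx cM.
have [C1x bc dx] := sx.
have i1 : 0 <= (1 : R) <= 1 by rewrite lexx ler01.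
have xE s : 0 <= s <= 1 -> x s = x 0 + dot x 0 * s + e2 * prim (slope x M) s.
  move=> s01.
  (* The difference of the two sides, up to x(0), has derivative 0 and is therefore constant. *)
  pose u r := 1 * x r + (- dot x 0) * r + (- e2) * prim (slope x M) r.
  have hu r : 0 <= r <= 1 -> has_dot u r 0.
    move=> r01; have := has_dot_lin3 1 (- dot x 0) (- e2) (C1_path_dot C1x r01)
      (has_dot_id r) (has_dot_prim cs r01).
    rewrite (dx r r01); have -> // : 1 * (dot x 0 + e2 * slope x M r) + - dot x 0 * 1 +
      - e2 * slope x M r = 0 by ring.
  by have := has_dot0_cst hu s01; rewrite /u prim0 => h; lra.
have x1 := xE 1 i1; have d1 := dx 1 i1.
rewrite /bvp_map (xE t t01).
move: bc x1 d1; rewrite /satisfies_bc; case: (b) => /= -[bc1 bc2] x1 d1.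
- have d0 : dot x 0 = - e2 * prim (slope x M) 1 by move: x1; rewrite bc1 bc2; lra.
  by rewrite d0 bc1; ring.
- have s1 : slope x M 1 = 0.
    by move: d1; rewrite bc1 bc2 add0r => /esym/eqP; rewrite mulf_eq0 (gt_eqF e20) => /eqP.
  by rewrite s1 bc1; ring.
- have d0 : dot x 0 = - e2 * prim (slope x M) 1 by move: x1; rewrite bc1; lra.
  have s1 : slope x M 1 = 0.
    have : e2 * slope x M 1 = 0 by lra.
    by move=> /eqP; rewrite mulf_eq0 (gt_eqF e20) => /eqP.
  by rewrite s1 d0; ring.
Qed.

Hypothesis e2_small : 12 * L ^+ 2 * e2 <= m.

(** Half of the gain m/L of the damped step; the other half pays for the variation of the path. *)
Definition slope_weight : R := m / (2 * L).
Definition contraction_rate : R := 1 - slope_weight.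
Local Notation mu' := slope_weight.
Local Notation q := contraction_rate.

Let mu'0 : 0 < mu'. Proof. by rewrite divr_gt0// mulr_gt0. Qed.
Let mu'1 : mu' <= 1 / 2.
Proof.
have L2 : 0 < 2 * L by rewrite mulr_gt0.
by rewrite /slope_weight ler_pdivrMr// mul1r mulrA mulVf ?mul1r.
Qed.
Let q01 : 0 <= q < 1. Proof.
by have := mu'0; have := mu'1; rewrite /contraction_rate => ? ?; apply/andP; split; lra.
Qed.

Let q1 : q <= 1. Proof. by have /andP[_ /ltW] := q01. Qed.

(** States that the weighted distance max(|x(0) - y(0)|, sup |(x - x(0)) - (y - y(0))| / mu') is at
    most D. As a relation it involves no supremum. *)
Definition close (D : R) x y := `|x 0 - y 0| <= D /\
  forall t, 0 <= t <= 1 -> `|(x t - x 0) - (y t - y 0)| <= mu' * D.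

Lemma close_dist (D : R) x y t : 0 <= t <= 1 -> close D x y ->
  `|x t - y t| <= (1 + mu') * D.
Proof.
move=> t01 [h0 /(_ t t01) ht].
have -> : x t - y t = (x 0 - y 0) + (x t - x 0 - (y t - y 0)) by ring.
by rewrite (le_trans (ler_normD _ _))// mulrDl mul1r lerD.
Qed.

Lemma close_damped D x y s : 0 <= s <= 1 -> close D x y ->
  `|(x 0 - y 0) - (a s (x s) - a s (y s)) / L| <= q * D.
Proof.
move=> s01 [h0 /(_ s s01) hs].
have D0 : 0 <= D by exact: le_trans h0.
(* Giving both paths the same variation [z] isolates the effect of the initial values, on which
   monotonicity acts. Replacing x(s) by x(0) + z costs at most mu' D, by the Lipschitz bound. *)
pose z := y s - y 0.
have -> : (x 0 - y 0) - (a s (x s) - a s (y s)) / L =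
    ((x 0 - y 0) - (a s (x 0 + z) - a s (y 0 + z)) / L)
    - (a s (x s) - a s (x 0 + z)) / L.
  by rewrite /z [y 0 + _]addrC subrK; ring.
have h1 : `|(a s (x s) - a s (x 0 + z)) / L| <= mu' * D.
  rewrite normrM normfV (gtr0_norm L0) ler_pdivrMr// mulrC.
  apply: (le_trans (lip s01 _ _)); rewrite ler_wpM2l ?(ltW L0)//.
  by rewrite /z opprD addrA.
have h2 : `|(x 0 - y 0) - (a s (x 0 + z) - a s (y 0 + z)) / L| <= (1 - 2 * mu') * D.
  (* The difference quotient lies in [m, L], so a step 1/L neither overshoots nor gains less than
     m/L = 2 mu'. *)
  have W (u v : R) : v <= u ->
      0 <= (u - v) - (a s (u + z) - a s (v + z)) / L <= (1 - 2 * mu') * (u - v).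
    move=> uv; have uvz : v + z <= u + z by rewrite lerD2r.
    have := mono s01 uvz; have := lip s01 (u + z) (v + z).
    have -> : u + z - (v + z) = u - v by ring.
    have uv0 : 0 <= u - v by rewrite subr_ge0.
    rewrite (ger0_norm uv0) => /ler_normlP[_ lu] mu_.
    have -> : 1 - 2 * mu' = 1 - m / L by rewrite /slope_weight; field; rewrite gt_eqF.
    rewrite subr_ge0 ler_pdivrMr// [X in _ <= X]mulrC lu/=.
    rewrite [X in _ <= X]mulrBl mul1r.
    by rewrite lerD2l lerN2 ler_pdivlMr// mulrAC divfK ?gt_eqF.
  have q2 : 0 <= 1 - 2 * mu' by have := mu'1; lra.
  have [yx|xy] := leP (y 0) (x 0).
    have /andP[W0 W1] := W _ _ yx.
    rewrite ger0_norm// (le_trans W1)// ler_wpM2l//.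
    by rewrite (le_trans (ler_norm _)).
  have /andP[W0 W1] := W _ _ (ltW xy).
  rewrite -normrN opprB.
  have -> : (a s (x 0 + z) - a s (y 0 + z)) / L - (x 0 - y 0) =
     y 0 - x 0 - (a s (y 0 + z) - a s (x 0 + z)) / L by ring.
  rewrite ger0_norm// (le_trans W1)// ler_wpM2l//.
  by rewrite (le_trans (ler_norm _))// distrC.
rewrite (le_trans (ler_normB _ _))// (le_trans (lerD h2 h1))//.
by rewrite -mulrDl /contraction_rate le_eqVlt; apply/orP; left; apply/eqP; congr (_ * D); ring.
Qed.

Let iprim x : {within `[0, 1], continuous x} ->
  mu.-integrable `[0, 1] (EFin \o fun s => a s (x s)).
Proof. exact: (integrable_superpos (ltW L0) lip inta). Qed.

Lemma prim_sub (g h : R -> R) t : mu.-integrable `[0, 1] (EFin \o g) ->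
  mu.-integrable `[0, 1] (EFin \o h) -> 0 <= t <= 1 ->
  prim g t - prim h t = prim (fun s => g s - h s) t.
Proof.
move=> ig ih /andP[t0 t1]; rewrite /prim RintegralB//.
  by apply: integrable_subR ig => //; apply: subset_itvl; rewrite bnd_simp.
by apply: integrable_subR ih => //; apply: subset_itvl; rewrite bnd_simp.
Qed.

Lemma integrable01B (g h : R -> R) : mu.-integrable `[0, 1] (EFin \o g) ->
  mu.-integrable `[0, 1] (EFin \o h) ->
  mu.-integrable `[0, 1] (EFin \o fun s => g s - h s).
Proof. by move=> ig ih; have := integrableB _ ig ih; exact. Qed.

Lemma slope_dist D x y M t : {within `[0, 1], continuous x} ->
  {within `[0, 1], continuous y} -> close D x y -> 0 <= t <= 1 ->
  `|slope x M t - slope y M t| <= L * ((1 + mu') * D).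
Proof.
move=> cx cy cl t01; rewrite /slope opprD addrACA subrr addr0.
have D0 : 0 <= D by case: cl => h _; exact: le_trans h.
rewrite prim_sub//; [|exact: iprim|exact: iprim].
apply: prim_le_bound => //; first by apply: integrable01B; exact: iprim.
  by rewrite !mulr_ge0// ?(ltW L0)// addr_ge0// ltW.
move=> s s01; apply: (le_trans (lip s01 _ _)).
by rewrite ler_wpM2l ?(ltW L0)//; exact: close_dist.
Qed.

Lemma bvp_map_close D x y M : {within `[0, 1], continuous x} ->
  {within `[0, 1], continuous y} -> {within `[0, 1], continuous M} ->
  close D x y -> close (q * D) (bvp_map M x) (bvp_map M y).
Proof.
move=> cx cy cM cl; have D0 : 0 <= D by case: cl => h _; exact: le_trans h.
have i1 : 0 <= (1 : R) <= 1 by rewrite lexx ler01.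
split.
  rewrite !bvp_map0 -mulrBr normrM.
  apply: le_trans (_ : 1 * `|x 0 - slope x M 1 / L - (y 0 - slope y M 1 / L)| <= _).
    by rewrite ler_wpM2r//; case: (b) => /=; rewrite ?normr0 ?normr1.
  rewrite mul1r; pose g s := (x 0 - y 0) - (a s (x s) - a s (y s)) / L.
  have ixy := integrable01B (iprim cx) (iprim cy).
  have ic : mu.-integrable `[0, 1] (EFin \o cst (x 0 - y 0)).
    apply: cont01_integrable => //.
    by apply: continuous_subspaceT => ?; exact: cvg_cst.
  have iZ : mu.-integrable `[0, 1] (EFin \o fun s => L^-1 * (a s (x s) - a s (y s))).
    by have := integrableZl _ L^-1 ixy; exact.
  (* [M] cancels and [0, 1] has length 1: what remains is the time average of the quantity bounded
     in [close_damped]. *)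
  have -> : x 0 - slope x M 1 / L - (y 0 - slope y M 1 / L) = prim g 1.
    rewrite /g; under [in RHS]eq_fun do rewrite [_ / L]mulrC.
    rewrite -(prim_sub (g := cst (x 0 - y 0)) ic iZ i1).
    have -> : prim (fun s => L^-1 * (a s (x s) - a s (y s))) 1 =
        L^-1 * (prim (fun s => a s (x s)) 1 - prim (fun s => a s (y s)) 1).
      by rewrite (prim_sub (iprim cx) (iprim cy) i1) /prim RintegralZl.
    have -> : prim (cst (x 0 - y 0)) 1 = x 0 - y 0.
      rewrite /prim Rintegral_cst//= lebesgue_measure_itv/= lte_fin ltr01/= subr0.
      by rewrite mulr1.
    by rewrite /slope; ring.
  apply: prim_le_bound => //.
  - have := integrable01B ic iZ; congr (_.-integrable _ _).
    by apply/funext => s; rewrite /g /= [_ / L]mulrC.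
  - by rewrite mulr_ge0// (andP q01).1.
  - by move=> s s01; exact: close_damped.
move=> t t01; rewrite !bvp_map0.
have ip x' : {within `[0, 1], continuous x'} ->
    mu.-integrable `[0, 1] (EFin \o slope x' M).
  by move=> cx'; apply: cont01_integrable => //; exact: slope_cont.
have pd s : 0 <= s <= 1 ->
    `|prim (slope x M) s - prim (slope y M) s| <= L * ((1 + mu') * D).
  move=> s01; rewrite prim_sub//; [|exact: ip|exact: ip].
  apply: prim_le_bound => //; first by apply: integrable01B; exact: ip.
    by rewrite !mulr_ge0// ?(ltW L0)// addr_ge0// ltW.
  by move=> r r01; exact: slope_dist.
have pt := pd t t01; have p1 := pd 1 i1.
set P := L * ((1 + mu') * D) in pt p1.
rewrite /bvp_map.
set A := prim (slope x M) t in pt *; set B := prim (slope x M) 1 in p1 *.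
set A' := prim (slope y M) t in pt *; set B' := prim (slope y M) 1 in p1 *.
have E (u v w z : R) : u + v - u - (w + z - w) = v - z by ring.
rewrite E -mulrBr normrM gtr0_norm//.
have -> : A - free_slope b * t * B - (A' - free_slope b * t * B') =
  (A - A') - free_slope b * t * (B - B') by ring.
(* One [P] for the integral up to t, one for the correction by the initial slope. *)
apply: (@le_trans _ _ (e2 * (P + P))).
  rewrite ler_wpM2l ?(ltW e20)// (le_trans (ler_normB _ _))// lerD// normrM.
  apply: le_trans p1; rewrite ler_piMl//.
  case/andP: t01 => t0 t1.
  by case: (b); rewrite /= ?mul1r ?mul0r ?normr0// ger0_norm.
have -> : e2 * (P + P) = (2 * L * e2) * (1 + mu') * D by rewrite /P; ring.
rewrite mulrA ler_wpM2r//.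
(* [e2_small] divided by 6 L, whence the constant 12: the target is 2 L e2 (1 + mu') <= q mu', and
   mu' <= 1/2 gives (1 + mu') / 3 <= 1/2 <= 1 - mu' = q. *)
have h6 : 2 * L * e2 <= mu' / 3.
  have L2 : 0 < 2 * L by rewrite mulr_gt0.
  rewrite ler_pdivlMr// /slope_weight ler_pdivlMr//.
  by apply: le_trans e2_small; rewrite le_eqVlt; apply/orP; left; apply/eqP; ring.
apply: (@le_trans _ _ (mu' / 3 * (1 + mu'))).
  by rewrite ler_wpM2r// addr_ge0// ltW.
rewrite -mulrA ler_wpM2l ?(ltW mu'0)// /contraction_rate.
by have := mu'0; have := mu'1; lra.
Qed.

Lemma close_ex x y : {within `[0, 1], continuous x} ->
  {within `[0, 1], continuous y} -> exists2 D : R, 0 <= D & close D x y.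
Proof.
move=> /cont01_bounded[K K0 xK] /cont01_bounded[K' K'0 yK].
have i0 : 0 <= (0 : R) <= 1 by rewrite lexx ler01.
have S0 : 0 <= K + K + K' + K' by lra.
(* Division by mu' <= 1 enlarges the bound, so one D serves both components of [close]. *)
have hK : K + K + K' + K' <= (K + K + K' + K') / mu'.
  by rewrite ler_pdivlMr// ler_piMr//; have := mu'1; lra.
exists ((K + K + K' + K') / mu'); first by rewrite divr_ge0// ltW.
split=> [|t t01].
  by rewrite (le_trans (ler_normB _ _))//; have := xK 0 i0; have := yK 0 i0; lra.
rewrite mulrC divfK ?gt_eqF// (le_trans (ler_normB _ _))//.
have := ler_normB (x t) (x 0); have := ler_normB (y t) (y 0).
have := xK 0 i0; have := yK 0 i0; have := xK t t01; have := yK t t01; lra.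
Qed.

Lemma q_small (C e : R) : 0 <= C -> 0 < e -> exists n, C * q ^+ n <= e.
Proof.
move=> C0 e0; have C1 : 0 < C + 1 by rewrite ltr_wpDl.
have qn : `|q| < 1 by case/andP: q01 => q0; rewrite ger0_norm.
have [N _ /(_ N (leqnn N))] :=
  (@cvgrPdist_lt _ _ _ _ _ _ _).1 (cvg_expr qn) _ (divr_gt0 e0 C1).
rewrite sub0r normrN ger0_norm ?exprn_ge0 ?(andP q01).1// ltr_pdivlMr// => h.
exists N; apply: le_trans (ltW h).
by rewrite mulrC ler_wpM2l ?lerDl// exprn_ge0// (andP q01).1.
Qed.

Lemma le_q_pow0 (C x : R) : 0 <= C -> (forall n, `|x| <= C * q ^+ n) -> x = 0.
Proof.
move=> C0 h; apply/eqP; rewrite -normr_le0.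
by apply/ler_addgt0Pl => e e0; rewrite addr0; have [n /(le_trans (h n))] := q_small C0 e0.
Qed.

Lemma bvp_unique x y M : {within `[0, 1], continuous M} -> solves_bvp M x ->
  solves_bvp M y -> forall t, 0 <= t <= 1 -> x t = y t.
Proof.
move=> cM sx sy t t01; have cx := solves_bvp_cont sx; have cy := solves_bvp_cont sy.
have fx := solves_bvp_fixpoint cM sx; have fy := solves_bvp_fixpoint cM sy.
have i0 : 0 <= (0 : R) <= 1 by rewrite lexx ler01.
have [D D0 Dxy] := close_ex cx cy.
have cl n : close (q ^+ n * D) x y.
  elim: n => [|n IH]; first by rewrite mul1r.
  have [h1 h2] := bvp_map_close cx cy cM IH; rewrite exprS -mulrA; split.
    by rewrite -fx// -fy.
  by move=> s s01; have := h2 s s01; rewrite !fx// !fy.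
apply/eqP; rewrite -subr_eq0; apply/eqP/(@le_q_pow0 ((1 + mu') * D)) => [|n].
  by rewrite mulr_ge0// addr_ge0// ltW.
by rewrite -mulrA [D * _]mulrC; exact: close_dist.
Qed.

Definition picard M n := iter n (bvp_map M) (cst 0).

Definition bvp_sol M t := limn (picard M ^~ t).

Lemma picard_cont M : {within `[0, 1], continuous M} ->
  forall n, {within `[0, 1], continuous (picard M n)}.
Proof.
move=> cM; elim => [|n IH]; last exact: bvp_map_cont.
by apply: continuous_subspaceT => ?; exact: cvg_cst.
Qed.

(** The constant does not depend on t. This uniformity yields the continuity of the limit and its
    weighted closeness to the iterates. *)
Lemma picard_lim M : {within `[0, 1], continuous M} ->
  exists2 C : R, 0 <= C & forall t, 0 <= t <= 1 -> picard M ^~ t @ \oo --> bvp_sol M t /\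
    forall n, `|bvp_sol M t - picard M n t| <= C * q ^+ n.
Proof.
move=> cM; have c0 := @picard_cont M cM 0; have c1 := @picard_cont M cM 1.
have [D D0 Dxy] := close_ex c1 c0.
have cl n : close (q ^+ n * D) (picard M n.+1) (picard M n).
  elim: n => [|n IH]; first by rewrite mul1r.
  rewrite exprS -mulrA.
  exact: (bvp_map_close (@picard_cont M cM n.+1) (@picard_cont M cM n) cM IH).
have C0 : 0 <= (1 + mu') * D by rewrite mulr_ge0// addr_ge0// ltW.
exists ((1 + mu') * D / (1 - q)).
  by rewrite divr_ge0// subr_ge0 ltW// (andP q01).2.
move=> t t01; have [|h1 h2] := geometric_lim (n0 := 0) (u := picard M ^~ t) C0 q01.
  by move=> n _; rewrite -mulrA [D * _]mulrC; exact: close_dist.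
by split => // n; rewrite mulrAC; exact: h2.
Qed.

Lemma bvp_sol_cont M : {within `[0, 1], continuous M} ->
  {within `[0, 1], continuous (bvp_sol M)}.
Proof.
move=> cM; have [C C0 hC] := picard_lim cM.
apply: (cont01_lim (w := picard M)) => [n|e e0]; first exact: picard_cont.
have [n ne] := q_small C0 e0; exists n => t t01.
by rewrite distrC (le_trans ((hC t t01).2 n)).
Qed.

Lemma bvp_sol_solves M : {within `[0, 1], continuous M} -> M 0 = 0 ->
  solves_bvp M (bvp_sol M).
Proof.
move=> cM M0; have [C C0 hC] := picard_lim cM.
have i0 : 0 <= (0 : R) <= 1 by rewrite lexx ler01.
have cs := bvp_sol_cont cM.
apply: fixpoint_solves_bvp => // t t01.
apply/eqP; rewrite -subr_eq0; apply/eqP.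
(* Chosen so that a uniform distance C q^n becomes [close (q ^+ n * E)]: the variations from time 0
   differ by at most 2 C q^n. *)
pose E := (C + C) / mu'.
have E0 : 0 <= E by rewrite divr_ge0 ?addr_ge0// ltW.
have CE : C <= E by rewrite /E ler_pdivlMr//; have := mu'0; have := mu'1; nra.
have cl n : close (q ^+ n * E) (bvp_sol M) (picard M n).
  have h s s01 := (hC s s01).2 n; have qn0 : 0 <= q ^+ n.
    by rewrite exprn_ge0// (andP q01).1.
  split; first by rewrite (le_trans (h 0 i0))// mulrC ler_wpM2l.
  move=> s s01.
  have -> : bvp_sol M s - bvp_sol M 0 - (picard M n s - picard M n 0) =
    (bvp_sol M s - picard M n s) - (bvp_sol M 0 - picard M n 0) by ring.
  rewrite (le_trans (ler_normB _ _))// (le_trans (lerD (h s s01) (h 0 i0)))//.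
  rewrite -mulrDl mulrA [mu' * _]mulrC -mulrA [mu' * _]mulrC /E divfK ?gt_eqF//.
  by rewrite mulrC.
apply: (@le_q_pow0 ((1 + mu') * E + C)) => [|n].
  by rewrite addr_ge0// mulr_ge0// addr_ge0// ltW.
have qn0 : 0 <= q ^+ n by rewrite exprn_ge0// (andP q01).1.
have h := close_dist t01 (bvp_map_close cs (@picard_cont M cM n) cM (cl n)).
have h' := (hC t t01).2 n.+1.
have -> : bvp_map M (bvp_sol M) t - bvp_sol M t =
  (bvp_map M (bvp_sol M) t - picard M n.+1 t) - (bvp_sol M t - picard M n.+1 t) by ring.
rewrite (le_trans (ler_normB _ _))// mulrDl lerD//.
  rewrite (le_trans h)// -mulrA ler_wpM2l ?addr_ge0 ?(ltW mu'0)// [E * _]mulrC.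
  by rewrite ler_piMl ?q1//; exact: mulr_ge0.
by rewrite (le_trans h')// exprS ler_wpM2l// ler_piMl// q1.
Qed.

Lemma measurable_bvp_sol d (Omega : measurableType d) (N : R -> Omega -> R) :
  (forall t, 0 <= t <= 1 -> measurable_fun [set: Omega] (N t)) ->
  (forall w, {within `[0, 1], continuous (N ^~ w)}) ->
  forall t, 0 <= t <= 1 ->
  measurable_fun [set: Omega] (fun w => bvp_sol (N ^~ w) t).
Proof.
move=> mN cN.
have i0 : 0 <= (0 : R) <= 1 by rewrite lexx ler01.
have i1 : 0 <= (1 : R) <= 1 by rewrite lexx ler01.
have mp n : forall t, 0 <= t <= 1 ->
    measurable_fun [set: Omega] (fun w => picard (N ^~ w) n t).
  elim: n => [|n IH] t t01; first exact: measurable_cst.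
  have cp w : {within `[0, 1], continuous (picard (N ^~ w) n)} by exact: picard_cont.
  have ms s : 0 <= s <= 1 ->
      measurable_fun [set: Omega] (fun w => slope (picard (N ^~ w) n) (N ^~ w) s).
    move=> s01; apply: measurable_funD; last exact: mN.
    exact: (measurable_prim_superpos (ltW L0) lip inta
      (X := fun s w => picard (N ^~ w) n s) IH cp).
  have mP s : 0 <= s <= 1 -> measurable_fun [set: Omega]
      (fun w => prim (slope (picard (N ^~ w) n) (N ^~ w)) s).
    (* The outer integral in [bvp_map] is a drift integral too, for the identity as drift and 1 as
       Lipschitz constant. *)
    have l1 (r : R) : 0 <= r <= 1 -> forall y z : R, `|id y - id z| <= 1 * `|y - z|.
      by move=> *; rewrite mul1r.
    have i1' (y : R) : mu.-integrable `[0, 1] (EFin \o cst y).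
      apply: cont01_integrable => //.
      by apply: continuous_subspaceT => ?; exact: cvg_cst.
    apply: (@measurable_prim_superpos R (fun=> id) 1 ler01 l1 i1' d Omega
      (fun s w => slope (picard (N ^~ w) n) (N ^~ w) s) ms).
    by move=> w; exact: slope_cont.
  apply: measurable_funD; apply: measurable_funM => //.
    apply: measurable_funB; first exact: IH.
    by apply: measurable_funM => //; exact: ms.
  apply: measurable_funB; first exact: mP.
  by apply: measurable_funM => //; exact: mP.
move=> t t01; apply: (@measurable_fun_cvg _ _ _ _ (fun n w => picard (N ^~ w) n t)).
  by move=> n; exact: mp.
by move=> w _; have [C _ /(_ t t01)[]] := picard_lim (cN w).
Qed.

End boundary_value_problem.

(** * Maximal inequality for Wiener integrals of step functions *)

Section density.
Import HBNNSimple.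
Local Open Scope ereal_scope.

(** By monotone convergence it is enough to treat simple functions, and on each of their level sets
    the claim is the hypothesis on [nu]. *)
Lemma ge0_integral_density d (T : measurableType d) (R : realType)
    (mu nu : {measure set T -> \bar R}) (g : T -> R) (f : T -> \bar R) :
  (forall x, 0 <= g x)%R -> measurable_fun [set: T] g ->
  (forall A, measurable A -> nu A = \int[mu]_(x in A) (g x)%:E) ->
  (forall x, 0 <= f x) -> measurable_fun [set: T] f ->
  \int[nu]_x f x = \int[mu]_x (f x * (g x)%:E).
Proof.
move=> g0 mg nuE f0 mf; pose h := nnsfun_approx measurableT mf.
have hf x : (h n x)%:E @[n --> \oo] --> f x by exact: cvg_nnsfun_approx.
have mgE : measurable_fun [set: T] (EFin \o g) by exact/measurable_EFinP.
have -> : \int[nu]_x f x = limn (fun n => \int[nu]_x (h n x)%:E).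
  rewrite -monotone_convergence//=.
  - by apply: eq_integral => x _; apply/esym/cvg_lim.
  - by move=> n; exact/measurable_EFinP/measurable_funTS.
  - by move=> n x _; rewrite lee_fin.
  - by move=> x _ a b ab; rewrite lee_fin; exact/lefP/nd_nnsfun_approx.
have -> : \int[mu]_x (f x * (g x)%:E) = limn (fun n => \int[mu]_x ((h n x)%:E * (g x)%:E)).
  rewrite -monotone_convergence//=.
  - by apply: eq_integral => x _; apply/esym/cvg_lim => //; exact: cvgeZr.
  - move=> n; apply: emeasurable_funM => //.
    exact/measurable_EFinP/measurable_funTS.
  - by move=> n x _; rewrite mule_ge0// lee_fin.
  - move=> x _ a b ab; rewrite lee_wpmul2r ?lee_fin//.
    exact/lefP/nd_nnsfun_approx.
congr (limn _); apply/funext => n.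
under eq_integral do rewrite fimfunE -fsumEFin//.
rewrite [LHS]ge0_integral_fsum//; last 2 first.
  - by move=> r; exact/measurable_EFinP/measurableT_comp.
  - by move=> y x _; rewrite EFinM nnfun_muleindic_ge0.
under [RHS]eq_integral.
  move=> x xD; rewrite fimfunE -fsumEFin// ge0_mule_fsuml; last first.
    by move=> r; rewrite EFinM nnfun_muleindic_ge0.
  over.
rewrite [RHS]ge0_integral_fsum//; last 2 first.
  - move=> r; apply: emeasurable_funM => //.
    exact/measurable_EFinP/measurableT_comp.
  - move=> y x _; rewrite mule_ge0 ?lee_fin//.
    by rewrite -lee_fin EFinM nnfun_muleindic_ge0.
apply: eq_fsbigr => r _.
have mr : measurable (h n @^-1` [set r]) by exact: measurable_funPTI.
under eq_integral do rewrite EFinM.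
rewrite integralZl_indic_nnsfun//= integral_indic// setIT nuE//.
(* A negative value is never taken by the approximating simple function: its level set is empty. *)
have [r0|r0] := leP 0%R r; last first.
  rewrite preimage_nnfun0// integral_set0 mule0 integral0_eq// => x _.
  by rewrite indic0 mulr0 mul0e.
rewrite [in LHS]integral_mkcond -ge0_integralZl//; last 2 first.
  - by apply/measurable_restrict => //; rewrite setTI; exact: measurable_funTS.
  - by move=> x _; rewrite patchE; case: ifP => // _; rewrite lee_fin.
apply: eq_integral => x _; rewrite patchE indicE EFinM -muleA.
by case: (x \in _); rewrite ?mul1e ?mul0e.
Qed.

End density.

(** * Second moments of centred Gaussian laws *)

Section gaussian_moments.
Context {R : realType}.
Local Notation mu := (@lebesgue_measure R).
Local Open Scope ereal_scope.

Lemma ge0_integral_oppr (f : R -> \bar R) : measurable_fun [set: R] f ->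
  (forall x, 0 <= f x) -> \int[mu]_x f (- x)%R = \int[mu]_x f x.
Proof.
move=> mf f0.
have mN : measurable_fun [set: measurableTypeR R] (-%R : R -> measurableTypeR R).
  exact: oppr_measurable.
rewrite -[LHS](ge0_integral_pushforward mN mu measurableT)//.
by apply: eq_measure_integral => A mA _; exact: lebesgue_measureN.
Qed.

Lemma measurable_sqr_affine (t a : R) :
  measurable_fun [set: R] (fun x => (t + a * x) ^+ 2)%R.
Proof.
by apply: measurable_funX; exact: measurable_funD.
Qed.

Lemma normal_peak_scale (s : R) : (0 < s)%R -> (normal_peak s * s = normal_peak 1)%R.
Proof.
move=> s0; rewrite /normal_peak -mulrnAr expr1n mul1r.
rewrite sqrtrM ?sqr_ge0// sqrtr_sqr gtr0_norm// invfM mulrAC mulVf ?mul1r//.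
by rewrite gt_eqF.
Qed.

Lemma normal_pdf_scale (s x : R) : (0 < s)%R ->
  (normal_pdf 0 s (s * x) * s = normal_pdf 0 1 x)%R.
Proof.
move=> s0; have sn0 : s != 0%R by rewrite gt_eqF.
rewrite !normal_pdfE// ?oner_neq0// mulrAC normal_peak_scale//; congr (_ * _)%R.
rewrite /normal_fun !subr0 exprMn expr1n; congr expR.
rewrite -mulr_natr -[in RHS]mulr_natr mul1r mulNr.
by field.
Qed.

(* Its value, 1, is irrelevant: only finiteness and scaling are used. *)
Definition normal_var : R := fine (\int[mu]_x (x ^+ 2 * normal_pdf 0 1 x)%:E).

(** From 1 + x^2/4 <= exp(x^2/4) one gets x^2 exp(-x^2/2) <= 4 exp(-x^2/4), and the right side is a
    multiple of the centred normal density of variance 2, which is integrable. *)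
Lemma normal_var_fin : \int[mu]_x (x ^+ 2 * normal_pdf 0 1 x)%:E \is a fin_num.
Proof.
have m1 : measurable_fun [set: R] (fun x : R => x ^+ 2 * normal_pdf 0 1 x)%R.
  by apply: measurable_funM; [exact: measurable_funX|exact: measurable_normal_pdf].
rewrite ge0_fin_numE; last first.
  by apply: integral_ge0 => x _; rewrite lee_fin mulr_ge0 ?sqr_ge0 ?normal_pdf_ge0.
pose r : R := Num.sqrt 2.
have r0 : (0 < r)%R by rewrite sqrtr_gt0.
have rn0 : r != 0%R by rewrite gt_eqF.
pose C := (4 * (normal_peak 1 / normal_peak r))%R.
have C0 : (0 <= C)%R by rewrite mulr_ge0// divr_ge0 ?normal_peak_ge0.
apply: (@le_lt_trans _ _ (\int[mu]_x (C * normal_pdf 0 r x)%:E)).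
  apply: ge0_le_integral => //=.
  - by move=> x _; rewrite lee_fin mulr_ge0 ?sqr_ge0 ?normal_pdf_ge0.
  - exact/measurable_EFinP.
  - apply/measurable_EFinP; apply: measurable_funM => //.
    exact: measurable_normal_pdf.
  move=> x _; rewrite lee_fin !normal_pdfE ?oner_neq0//.
  have pr0 : normal_peak r != 0%R by rewrite gt_eqF// normal_peak_gt0.
  have -> : (C * (normal_peak r * normal_fun 0 r x) =
      normal_peak 1 * (4 * normal_fun 0 r x))%R by rewrite /C; field.
  rewrite mulrCA; apply: ler_wpM2l; first exact: normal_peak_ge0.
  rewrite /normal_fun !subr0 sqr_sqrtr// expr1n.
  have -> : (- x ^+ 2 / (1 *+ 2) = - (x ^+ 2 / 4) + - x ^+ 2 / (2 *+ 2))%R by field.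
  rewrite expRD mulrA ler_wpM2r ?expR_ge0//.
  rewrite expRN -ler_pdivlMr ?invr_gt0 ?expR_gt0// invrK.
  have := expR_ge1Dx (x ^+ 2 / 4); lra.
under eq_integral do rewrite EFinM.
rewrite integralZl//; last exact: integrable_normal_pdf.
by rewrite integral_normal_pdf mule1 ltry.
Qed.

Lemma integral_normal_sqr (s : R) : (0 < s)%R ->
  \int[mu]_x (x ^+ 2 * normal_pdf 0 s x)%:E = (normal_var * s ^+ 2)%:E.
Proof.
move=> s0; pose F := (fun x : R => s * x)%R.
have F' : (F^`())%classic = cst s.
  by apply/funext => x; rewrite derive1E /F deriveM// derive_cst scaler0 derive_id addr0 scaler1.
rewrite (@increasing_ge0_integration_by_substitutionT R F)//.
- rewrite F' [(normal_var * _)%R]mulrC EFinM /normal_var fineK ?normal_var_fin// -ge0_integralZl//.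
  + apply: eq_integral => x _; rewrite /= -EFinM; congr EFin.
    by rewrite -(normal_pdf_scale x s0) /F !fctE; ring.
  + apply/measurable_EFinP.
    by apply: measurable_funM; [exact: measurable_funX|exact: measurable_normal_pdf].
  + by move=> x _; rewrite lee_fin mulr_ge0 ?sqr_ge0 ?normal_pdf_ge0.
  + by rewrite lee_fin sqr_ge0.
- by move=> x y xy; rewrite /F ltr_pM2l.
- by rewrite F' => x; exact: cvg_cst.
- by rewrite F'; exact: is_cvg_cst.
- by rewrite F'; exact: is_cvg_cst.
- by apply: gt0_cvgMrNy => //; exact: cvg_id.
- by apply: gt0_cvgMry => //; exact: cvg_id.
- move=> x; apply: cvgM; first exact: sqr_continuous.
  by apply: (@continuous_normal_pdf R); rewrite gt_eqF.
- by move=> x; rewrite mulr_ge0 ?sqr_ge0 ?normal_pdf_ge0.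
Qed.

(** The cross term 2 t a x is removed by symmetry: the integral is the half-sum of those for [a] and
    [- a]. All integrands stay nonnegative, so the first moment never has to be considered. *)
Lemma normal_prob_sqr_affine (s t a : R) : (0 < s)%R ->
  \int[normal_prob 0 s]_x ((t + a * x) ^+ 2)%:E =
  (t ^+ 2 + a ^+ 2 * (normal_var * s ^+ 2))%:E.
Proof.
move=> s0; have mpdf := measurable_normal_pdf (0 : R) s.
have sqr0 (u x : R) : 0 <= ((t + u * x) ^+ 2)%:E by rewrite lee_fin sqr_ge0.
have msqr u : measurable_fun [set: R] (fun x => ((t + u * x) ^+ 2)%:E).
  by apply/measurable_EFinP; exact: measurable_sqr_affine.
have dens u : \int[normal_prob 0 s]_x ((t + u * x) ^+ 2)%:E =
    \int[mu]_x (((t + u * x) ^+ 2) * normal_pdf 0 s x)%:E.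
  rewrite (@ge0_integral_density _ _ R mu _ (normal_pdf 0 s))//.
  - exact: normal_pdf_ge0.
  - exact: msqr.
have F0 u x : (0 <= (t + u * x) ^+ 2 * normal_pdf 0 s x)%R.
  by rewrite mulr_ge0 ?sqr_ge0 ?normal_pdf_ge0.
have mF u : measurable_fun [set: R]
    (fun x => ((t + u * x) ^+ 2 * normal_pdf 0 s x)%:E).
  by apply/measurable_EFinP/measurable_funM => //; exact: measurable_sqr_affine.
have sym : \int[mu]_x ((t + a * x) ^+ 2 * normal_pdf 0 s x)%:E =
    \int[mu]_x ((t + - a * x) ^+ 2 * normal_pdf 0 s x)%:E.
  rewrite -(ge0_integral_oppr (mF a)); last by move=> x; rewrite lee_fin.
  apply: eq_integral => x _; congr EFin; rewrite mulrN mulNr; congr (_ * _)%R.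
  by rewrite !normal_pdfE ?gt_eqF// /normal_fun !subr0 sqrrN.
have half (I : \bar R) : 0 <= I -> I = (2^-1)%:E * (I + I).
  move=> I0; rewrite ge0_muleDr// -ge0_muleDl ?lee_fin// -EFinD.
  have -> : (2^-1 + 2^-1 = 1 :> R)%R by field.
  by rewrite mul1e.
rewrite dens (half (integral _ _ _)); last by apply: integral_ge0 => x _; rewrite lee_fin.
rewrite {2}sym -ge0_integralD//; [|by move=> x _; rewrite lee_fin|exact: mF
  |by move=> x _; rewrite lee_fin|exact: mF].
have -> : \int[mu]_x (((t + a * x) ^+ 2 * normal_pdf 0 s x)%:E +
    ((t + - a * x) ^+ 2 * normal_pdf 0 s x)%:E) =
  (\int[mu]_x ((2 * t ^+ 2)%:E * (normal_pdf 0 s x)%:E +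
    (2 * a ^+ 2)%:E * (x ^+ 2 * normal_pdf 0 s x)%:E)).
  by apply: eq_integral => x _; rewrite -!EFinM -!EFinD; congr EFin; ring.
rewrite ge0_integralD//.
- rewrite ge0_integralZl//; last 3 first.
  + exact/measurable_EFinP.
  + by move=> x _; rewrite lee_fin normal_pdf_ge0.
  + by rewrite lee_fin mulr_ge0 ?sqr_ge0.
  rewrite ge0_integralZl//; last 3 first.
  + by apply/measurable_EFinP/measurable_funM => //; exact: measurable_funX.
  + by move=> x _; rewrite lee_fin mulr_ge0 ?sqr_ge0 ?normal_pdf_ge0.
  + by rewrite lee_fin mulr_ge0 ?sqr_ge0.
  rewrite integral_normal_pdf integral_normal_sqr// mule1 -!(EFinM, EFinD).
  by congr EFin; field.
- move=> x _; apply: mule_ge0; first by rewrite lee_fin mulr_ge0 ?sqr_ge0.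
  by rewrite lee_fin normal_pdf_ge0.
- by apply: emeasurable_funM => //; exact/measurable_EFinP.
- move=> x _; apply: mule_ge0; first by rewrite lee_fin mulr_ge0 ?sqr_ge0.
  by rewrite lee_fin mulr_ge0 ?sqr_ge0 ?normal_pdf_ge0.
- by apply: emeasurable_funM => //; apply/measurable_EFinP/measurable_funM.
Qed.

End gaussian_moments.

(** * Independence and Kolmogorov's maximal inequality *)

Section independent_pair.
Context d (T : measurableType d) (R : realType).
Local Open Scope ereal_scope.

(** Rectangles form a pi-system generating the product sigma-algebra. Two measures are allowed
    because [m1] will be P restricted to a future event and [m2] a multiple of P. *)
Lemma eq_pair_law d1 d2 (T1 : measurableType d1) (T2 : measurableType d2)
    (m1 m2 : {measure set T -> \bar R}) (X : T -> T1) (Y : T -> T2) :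
  measurable_fun [set: T] X -> measurable_fun [set: T] Y -> m1 [set: T] < +oo ->
  (forall A B, measurable A -> measurable B ->
    m1 (X @^-1` A `&` Y @^-1` B) = m2 (X @^-1` A `&` Y @^-1` B)) ->
  forall D : set (T1 * T2), measurable D ->
    m1 ((fun w => (X w, Y w)) @^-1` D) = m2 ((fun w => (X w, Y w)) @^-1` D).
Proof.
move=> mX mY m1oo m12 D mD.
have mXY : measurable_fun [set: T] (fun w => (X w, Y w)) by exact: measurable_fun_pair.
pose G := [set A `*` B | A in @measurable _ T1 & B in @measurable _ T2].
have GT : G setT by exists setT => //; exists setT => //; rewrite setXTT.
have cvr : \bigcup_(k : nat) (fun _ => [set: T1 * T2]) k = setT.
  by apply/seteqP; split => // x _; exists 0%N.
have GI : setI_closed G.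
  move=> _ _ [A1 mA1 [B1 mB1 <-]] [A2 mA2 [B2 mB2 <-]].
  rewrite -setXI; exists (A1 `&` A2); first exact: measurableI.
  by exists (B1 `&` B2) => //; exact: measurableI.
apply: (@measure_unique _ R (T1 * T2)%type G (fun=> setT)
  (measurable_prod_measurableType T1 T2) GI (fun=> GT) cvr
  (measure_function_pushforward__canonical__measure_function_Measure m1 mXY)
  (measure_function_pushforward__canonical__measure_function_Measure m2 mXY)) => //.
move=> _ [A mA [B mB <-]]; exact: m12.
Qed.

End independent_pair.

Section kolmogorov.
Context d (T : measurableType d) (R : realType) (P : probability T R).
Local Open Scope ereal_scope.

(** The law of an independent pair is a product measure, so by Tonelli the second variable may be
    integrated over an independent copy of the outcome. *)
Lemma indep_integral d1 d2 (T1 : measurableType d1) (T2 : measurableType d2)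
    (X : T -> T1) (Y : T -> T2) (F : T1 * T2 -> \bar R) :
  measurable_fun [set: T] X -> measurable_fun [set: T] Y ->
  (forall A B, measurable A -> measurable B ->
    P (X @^-1` A `&` Y @^-1` B) = P (X @^-1` A) * P (Y @^-1` B)) ->
  measurable_fun [set: T1 * T2] F -> (forall z, 0 <= F z) ->
  \int[P]_w F (X w, Y w) = \int[P]_w \int[P]_w' F (X w, Y w').
Proof.
move=> mX mY XY mF F0.
have mZ : measurable_fun [set: T] (fun w => (X w, Y w)) by exact: measurable_fun_pair.
pose X' : {RV P >-> T1} := HB.pack X (isMeasurableFun.Build _ _ _ _ _ mX).
pose Y' : {RV P >-> T2} := HB.pack Y (isMeasurableFun.Build _ _ _ _ _ mY).
pose Z : {RV P >-> (T1 * T2)%type} := HB.pack (fun w => (X w, Y w))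
  (isMeasurableFun.Build _ _ _ _ _ mZ).
rewrite -(ge0_integral_distribution Z mF F0).
rewrite (eq_measure_integral (distribution P X' \x distribution P Y')); last first.
  by move=> D mD _; apply/esym; apply: product_measure_unique => // A B mA mB; exact: XY.
rewrite fubini_tonelli1// ge0_integral_distribution//.
- apply: eq_integral => w _ /=; rewrite /fubini_F ge0_integral_distribution//.
  exact: measurableT_comp.
- exact: measurable_fun_fubini_tonelli_F.
- by move=> x; apply: integral_ge0.
Qed.

Variables (n : nat) (X : nat -> T -> R) (c v : nat -> R).
Hypothesis mX : forall i, (i < n)%N -> measurable_fun [set: T] (X i).
Hypothesis indepX : forall B : nat -> set R, (forall i, measurable (B i)) ->
  P (\bigcap_(i in `I_n) (X i @^-1` B i)) = \prod_(i < n) P (X i @^-1` B i).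
(** Holding for all t and a, this encodes mean 0 and variance [v i] through integrals of nonnegative
    functions only. *)
Hypothesis sqrX : forall i, (i < n)%N -> forall t a : R,
  \int[P]_w ((t + a * X i w) ^+ 2)%:E = (t ^+ 2 + a ^+ 2 * v i)%:E.

Definition partial_sum k w : R := (\sum_(i < k) c i * X i w)%R.

(* The partial sums stopped when they first leave [(-lam, lam)]; unlike the
   running maximum, each is a function of its predecessor and of the next
   increment, so that independence can be propagated along the recursion. *)
Fixpoint stopped_sum (lam : R) k w : R :=
  if k is k'.+1 then
    let t := stopped_sum lam k' w in
    (t + \1_[set z : R | (`|z| < lam)%R] t * c k' * X k' w)%R
  else 0%R.

Variable lam : R.
Hypothesis lam0 : (0 < lam)%R.

Let ind : R -> R := \1_[set z : R | (`|z| < lam)%R].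

Let mind : measurable_fun [set: R] ind.
Proof.
apply: measurable_indic.
rewrite (_ : [set z : R | (`|z| < lam)%R] = `](- lam)%R, lam[%classic)//.
by apply/seteqP; split => z /=; rewrite in_itv/= ltr_norml.
Qed.

Lemma measurable_stopped_sum k : (k <= n)%N ->
  measurable_fun [set: T] (stopped_sum lam k).
Proof.
elim: k => [|k IH] kn; first exact: measurable_cst.
have mk := IH (ltnW kn).
apply: measurable_funD => //; apply: measurable_funM; last exact: mX.
by apply: measurable_funM => //; exact: (measurableT_comp mind mk).
Qed.

(** Independence of the whole remaining family, and not of the next increment alone, is what the
    induction on k can propagate. *)
Lemma stopped_sum_indep k : (k <= n)%N -> forall (A : set R) (B : nat -> set R),
  measurable A -> (forall i, measurable (B i)) ->
  P (stopped_sum lam k @^-1` A `&`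
     \bigcap_(i in [set i | (k <= i < n)%N]) (X i @^-1` B i)) =
  P (stopped_sum lam k @^-1` A) * \prod_(k <= i < n) P (X i @^-1` B i).
Proof.
elim: k => [|k IH] kn A B mA mB.
  have -> : [set i | (0 <= i < n)%N] = `I_n by [].
  rewrite big_mkord -indepX//.
  have [A0|A0] := pselect (A 0%R).
    have -> : stopped_sum lam 0 @^-1` A = setT by apply/seteqP; split.
    by rewrite setTI probability_setT mul1e.
  have -> : stopped_sum lam 0 @^-1` A = set0 by apply/seteqP; split.
  by rewrite set0I measure0 mul0e.
have mk := measurable_stopped_sum (ltnW kn); have mXk := mX kn.
set C := \bigcap_(i in [set i | (k < i < n)%N]) (X i @^-1` B i).
have mC : measurable C.
  apply: bigcap_measurableType => i /andP[_ ni].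
  by rewrite -[X in measurable X]setTI; exact: mX.
set q := \prod_(k.+1 <= i < n) P (X i @^-1` B i).
have qfin : q \is a fin_num.
  rewrite /q big_nat_cond; apply: (big_ind (fun x => x \is a fin_num)) => //.
    by move=> x y; exact: fin_numM.
  move=> i /andP[/andP[_ ni] _]; apply: fin_num_measure.
  by rewrite -[X in measurable X]setTI; exact: mX.
have q0 : 0 <= q by apply: prode_ge0.
(* On rectangles the induction hypothesis is used twice: with the future events kept ([B1]) and with
   all of them trivial ([B0]). Comparing the two factors out [q]. *)
have rect A' B' : measurable A' -> measurable B' ->
    P (stopped_sum lam k @^-1` A' `&` X k @^-1` B' `&` C) =
    q * P (stopped_sum lam k @^-1` A' `&` X k @^-1` B').
  move=> mA' mB'.
  have h B2 : (forall i, measurable (B2 i)) -> B2 k = B' ->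
    P (stopped_sum lam k @^-1` A' `&` X k @^-1` B' `&`
       \bigcap_(i in [set i | (k < i < n)%N]) (X i @^-1` B2 i)) =
    P (stopped_sum lam k @^-1` A') * P (X k @^-1` B') *
    \prod_(k.+1 <= i < n) P (X i @^-1` B2 i).
    move=> mB2 B2k; have := IH (ltnW kn) A' B2 mA' mB2.
    rewrite big_ltn// muleA B2k => <-; rewrite -setIA; congr (P (_ `&` _)).
    apply/seteqP; split=> [w [wk wC] i /= /andP[ki ni]|w wC].
      by move: ki; rewrite leq_eqVlt => /predU1P[<-|ki]; [rewrite B2k|apply: wC; exact/andP].
    split; first by rewrite -B2k; apply: wC; rewrite /= leqnn.
    by move=> i /= /andP[ki ni]; apply: wC; rewrite /= (ltnW ki).
  pose B1 i := if i == k then B' else B i.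
  pose B0 i := if i == k then B' else setT.
  have h1 := h B1; have h0 := h B0.
  have E1 : \bigcap_(i in [set i | (k < i < n)%N]) (X i @^-1` B1 i) = C.
    by apply: eq_bigcapr => i /andP[ki _]; rewrite /B1 gtn_eqF.
  have E0 : \bigcap_(i in [set i | (k < i < n)%N]) (X i @^-1` B0 i) = setT.
    by apply/seteqP; split => // w _ i /andP[ki _]; rewrite /B0 gtn_eqF.
  have F1 : \prod_(k.+1 <= i < n) P (X i @^-1` B1 i) = q.
    by apply: eq_big_nat => i /andP[ki _]; rewrite /B1 gtn_eqF.
  have F0 : \prod_(k.+1 <= i < n) P (X i @^-1` B0 i) = 1.
    rewrite big_nat_cond; apply: big1 => i /andP[/andP[ki _] _].
    by rewrite /B0 gtn_eqF// preimage_setT probability_setT.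
  rewrite -E1 h1; last 2 first.
    by move=> i; rewrite /B1; case: ifP.
    by rewrite /B1 eqxx.
  rewrite F1 muleC; congr (_ * _); rewrite -[LHS]mule1 -F0 -h0.
  - by rewrite E0 setIT.
  - by move=> i; rewrite /B0; case: ifP.
  - by rewrite /B0 eqxx.
pose q' : {nonneg R} := NngNum (fine_ge0 q0).
(* The preimage of [A] under one step of the recursion. Its probabilities under P restricted to [C]
   and under q P agree because they agree on rectangles. *)
pose D : set (R * R) := [set z | A (z.1 + ind z.1 * c k * z.2)%R].
have mh : measurable_fun [set: R * R] (fun z => z.1 + ind z.1 * c k * z.2)%R.
  apply: measurable_funD => //; apply: measurable_funM => //.
  by apply: measurable_funM => //; exact: measurableT_comp.
have mD : measurable D by rewrite -[D]setTI; exact: mh.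
have := @eq_pair_law _ T R _ _ _ _
  (measure_function_mrestr__canonical__measure_function_Measure P mC)
  (measure_function_mscale__canonical__measure_function_Measure q' P)
  _ _ mk mXk _ _ D mD.
have q'E : (q'%:num)%:E = q by rewrite /= fineK.
move=> h; rewrite muleC -q'E; apply: h => [|A' B' mA' mB'].
  apply: le_lt_trans (probability_le1 _ _) _; last exact: ltry.
  by apply: measurableI => //; rewrite -[X in measurable X]setTI.
by have := rect A' B' mA' mB'; rewrite -q'E.
Qed.

Lemma stopped_sum_indep_next k : (k < n)%N -> forall A B : set R,
  measurable A -> measurable B ->
  P (stopped_sum lam k @^-1` A `&` X k @^-1` B) =
  P (stopped_sum lam k @^-1` A) * P (X k @^-1` B).
Proof.
move=> kn A B mA mB; pose B0 i := if i == k then B else setT.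
have mB0 i : measurable (B0 i) by rewrite /B0; case: ifP.
have := stopped_sum_indep (ltnW kn) mA mB0.
rewrite big_ltn// /B0 eqxx big_nat_cond big1 ?mule1; last first.
  by move=> i /andP[/andP[ki _] _]; rewrite gtn_eqF// preimage_setT probability_setT.
move=> <-; congr (P (_ `&` _)); apply/seteqP; split=> [w wB i /= /andP[ki ni]|w].
  by case: eqP => // ->.
by move=> /(_ k); rewrite /= leqnn kn eqxx; exact.
Qed.

Lemma sqr_variance_ge0 i : (i < n)%N -> (0 <= v i)%R.
Proof.
move=> ni; rewrite -lee_fin; have := sqrX ni 0 1.
by rewrite !expr0n expr1n mul1r add0r => <-; apply: integral_ge0 => w _; rewrite lee_fin sqr_ge0.
Qed.

(** By independence the next increment can be integrated first; [sqrX] then adds c_k^2 v_k times the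
    square of an indicator, and there is no cross term. *)
Lemma stopped_sum_sqr k : (k <= n)%N ->
  \int[P]_w ((stopped_sum lam k w) ^+ 2)%:E <= (\sum_(i < k) c i ^+ 2 * v i)%:E.
Proof.
elim: k => [|k IH] kn.
  by rewrite big_ord0 integral0_eq// => w _; rewrite expr0n.
have mk := measurable_stopped_sum (ltnW kn); have mXk := mX kn.
pose F (z : R * R) := ((z.1 + ind z.1 * c k * z.2) ^+ 2)%:E.
have mF : measurable_fun [set: R * R] F.
  apply/measurable_EFinP/measurable_funX.
  apply: measurable_funD => //; apply: measurable_funM => //.
  by apply: measurable_funM => //; exact: measurableT_comp.
have F0 z : 0 <= F z by rewrite lee_fin sqr_ge0.
rewrite -[leLHS]/(\int[P]_w F (stopped_sum lam k w, X k w)).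
rewrite (indep_integral mk mXk (stopped_sum_indep_next kn) mF F0).
have msq : measurable_fun [set: T] (fun w => (stopped_sum lam k w ^+ 2)%:E).
  exact/measurable_EFinP/measurable_funX.
have cv0 : (0 <= c k ^+ 2 * v k)%R by rewrite mulr_ge0 ?sqr_ge0 ?sqr_variance_ge0.
apply: (@le_trans _ _ (\int[P]_w ((stopped_sum lam k w ^+ 2)%:E + (c k ^+ 2 * v k)%:E))).
  apply: ge0_le_integral => //=.
  - by move=> w _; apply: integral_ge0.
  - rewrite (_ : (fun w => _) = (fun w =>
      ((stopped_sum lam k w) ^+ 2 + (ind (stopped_sum lam k w) * c k) ^+ 2 * v k)%:E)).
      apply/measurable_EFinP/measurable_funD; first exact: measurable_funX.
      apply: measurable_funM => //; apply: measurable_funX.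
      by apply: measurable_funM => //; exact: (measurableT_comp mind mk).
    by apply/funext => w; rewrite /F /= (sqrX kn).
  - by apply: emeasurable_funD.
  move=> w _; rewrite -[leLHS]/(\int[P]_w' ((stopped_sum lam k w +
    ind (stopped_sum lam k w) * c k * X k w') ^+ 2)%:E) sqrX//.
  rewrite -EFinD lee_fin lerD2l ler_wpM2r ?sqr_variance_ge0// exprMn ler_piMl ?sqr_ge0//.
  by rewrite /ind indicE; case: (_ \in _); rewrite ?expr1n ?expr0n.
rewrite ge0_integralD//; last by move=> w _; rewrite lee_fin sqr_ge0.
rewrite big_ord_recr/= EFinD; apply: leeD; first exact: IH (ltnW kn).
by rewrite integral_cst//= probability_setT mule1.
Qed.

(** Once outside (-lam, lam) the stopped sum is frozen. Any exit up to time k is therefore visible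
    in its value at k, and Chebyshev's inequality for that single value gives the maximal
    inequality. *)
Lemma stopped_sum_exit w k : (k <= n)%N ->
  (stopped_sum lam k w = partial_sum k w /\
    forall j, (j <= k)%N -> (`|partial_sum j w| < lam)%R) \/
  (lam <= `|stopped_sum lam k w|)%R.
Proof.
elim: k => [|k IH] kn.
  left; rewrite /partial_sum big_ord0; split=> // j; rewrite leqn0 => /eqP ->.
  by rewrite big_ord0 normr0.
have [[Tk Sk]|Tk] := IH (ltnW kn).
  have Tk1 : stopped_sum lam k.+1 w = partial_sum k.+1 w.
    rewrite /= indicE mem_set/=; last by rewrite Tk; exact: Sk.
    by rewrite Tk mul1r /partial_sum big_ord_recr.
  have [h|h] := leP lam `|partial_sum k.+1 w|%R; first by right; rewrite Tk1.
  left; split => // j; rewrite leq_eqVlt => /predU1P[->//|]; exact: Sk.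
by right; rewrite /= indicE memNset ?mul0r ?addr0//=; apply/negP; rewrite -leNgt.
Qed.

Lemma measurable_partial_sum k : (k <= n)%N -> measurable_fun [set: T] (partial_sum k).
Proof.
elim: k => [|k IH] kn.
  by rewrite /partial_sum; under eq_fun do rewrite big_ord0; exact: measurable_cst.
rewrite /partial_sum; under eq_fun do rewrite big_ord_recr/=.
apply: measurable_funD; first exact: IH (ltnW kn).
by apply: measurable_funM => //; exact: mX.
Qed.

Definition exit_event := [set w | exists2 k, (k <= n)%N & (lam <= `|partial_sum k w|)%R].

Lemma measurable_norm_ge (f : T -> R) : measurable_fun [set: T] f ->
  measurable [set w | (lam <= `|f w|)%R].
Proof.
move=> mf; rewrite -[X in measurable X]setTI.
have mn : measurable_fun [set: T] (fun w => `|f w|%R) by exact: measurableT_comp.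
rewrite (_ : [set w | (lam <= `|f w|)%R] = (fun w => `|f w|%R) @^-1` `[lam, +oo[%classic).
  exact: mn.
by apply/seteqP; split => w /=; rewrite in_itv/= andbT.
Qed.

Lemma measurable_exit_event : measurable exit_event.
Proof.
rewrite (_ : exit_event = \bigcup_(k in [set k | (k <= n)%N])
  [set w | (lam <= `|partial_sum k w|)%R]).
  by apply: bigcup_measurable => k /= kn; exact/measurable_norm_ge/measurable_partial_sum.
by apply/seteqP; split => [w [k kn h]|w [k kn h]]; exists k.
Qed.

Lemma kolmogorov_maximal :
  (lam ^+ 2)%:E * P exit_event <= (\sum_(i < n) c i ^+ 2 * v i)%:E.
Proof.
apply: le_trans (stopped_sum_sqr (leqnn n)).
have mn := measurable_stopped_sum (leqnn n).
apply: (@le_trans _ _ ((lam ^+ 2)%:E * P [set w | (lam <= `|stopped_sum lam n w|)%R])).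
  rewrite lee_wpmul2l ?lee_fin ?sqr_ge0//; apply: le_measure.
  - by rewrite inE; exact: measurable_exit_event.
  - by rewrite inE; exact: measurable_norm_ge.
  move=> w [k kn h] /=; have [[_ /(_ k kn)]|//] := stopped_sum_exit w (leqnn n).
  by rewrite ltNge h.
have mA := measurable_norm_ge mn.
rewrite -integral_cst//.
apply: (@le_trans _ _ (\int[P]_(w in [set w | (lam <= `|stopped_sum lam n w|)%R])
    ((stopped_sum lam n w) ^+ 2)%:E)).
  apply: ge0_le_integral => //=.
  - by move=> w _; rewrite lee_fin sqr_ge0.
  - exact/measurable_EFinP/measurable_funTS/measurable_funX.
  - move=> w h; rewrite lee_fin -[X in (_ <= X)%R](real_normK (num_real _)).
    by rewrite ler_pXn2r// ?nnegrE ?(ltW lam0).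
apply: ge0_subset_integral => //; first exact/measurable_EFinP/measurable_funX.
by move=> w _; rewrite lee_fin sqr_ge0.
Qed.

End kolmogorov.

(** * The isometry for step integrals *)

Section polarization.
Context {R : realType}.
Local Open Scope ereal_scope.
Local Notation triple := (R * R * R)%type.

(** Encodes 2 (X_b - X_a) (X_d - X_c) = (X_b - X_c)^2 + (X_a - X_d)^2 - (X_b - X_d)^2 - (X_a -
    X_c)^2 for the intervals (a, b] of [e] and (c, d] of [f]. *)
Definition polar2 (e f : triple) : seq triple :=
  let k := (e.2 * f.2 / 2)%R in
  [:: ((e.1.2, f.1.1), k); ((e.1.1, f.1.2), k);
      ((e.1.2, f.1.2), - k)%R; ((e.1.1, f.1.1), - k)%R].

Definition polar (q : seq triple) : seq triple :=
  flatten [seq polar2 e f | e <- q, f <- q].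

(** The squared L^2 norm of [step_fun q], by [integral_sqr_step_fun]. *)
Definition gram (q : seq triple) : R :=
  (\sum_(j <- polar q) j.2 * `|j.1.1 - j.1.2|)%R.

Lemma sum_polar (X : R -> R) q :
  (\sum_(j <- polar q) j.2 * (X j.1.1 - X j.1.2) ^+ 2 =
   (\sum_(e <- q) e.2 * (X e.1.2 - X e.1.1)) ^+ 2)%R.
Proof.
rewrite /polar big_flatten/= big_allpairs_dep expr2 mulr_suml; apply: eq_bigr => e _.
rewrite mulr_sumr; apply: eq_bigr => f _.
by rewrite /polar2 !big_cons big_nil /=; field.
Qed.

Lemma polar_in (t : R) q : step_in t q ->
  {in polar q, forall j, (0 <= j.1.1 <= t)%R /\ (0 <= j.1.2 <= t)%R}.
Proof.
move=> /allP qt j /flattenP[l /allpairsP[[e f] /= [eq fq ->]]].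
have /andP[/andP[ea eab] ebt] := qt _ eq; have /andP[/andP[fa fab] fbt] := qt _ fq.
have eb := le_trans ea eab; have fb := le_trans fa fab.
have eat := le_trans eab ebt; have fat := le_trans fab fbt.
by rewrite !inE => /or4P[]/eqP -> /=; split; apply/andP.
Qed.

(* Polarization: the L^2 norm of a step integral only depends on the second
   moments of the increments, hence it is the same, up to the factor [kap], for
   the increments of [W] and for those of the indicators of [(0, t]]. *)
Lemma integral_sqr_step d (T : measurableType d) (mu : {measure set T -> \bar R})
    (D : set T) (X : R -> T -> R) (kap t : R) : measurable D ->
  (forall s, (0 <= s <= t)%R -> measurable_fun D (X s)) ->
  (forall u s, (0 <= u <= t)%R -> (0 <= s <= t)%R ->
    \int[mu]_(w in D) ((X u w - X s w) ^+ 2)%:E = (kap * `|u - s|)%:E) ->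
  forall q, step_in t q ->
  \int[mu]_(w in D) ((\sum_(e <- q) e.2 * (X e.1.2 w - X e.1.1 w)) ^+ 2)%:E =
    (kap * gram q)%:E.
Proof.
move=> mD mX sX q qt.
under eq_integral do rewrite -(sum_polar (X ^~ _)) -sumEFin big_tnth.
rewrite integral_sum//; last first.
  move=> i; have /(polar_in qt)[h1 h2] : tnth (in_tuple (polar q)) i \in polar q by exact: mem_tnth.
  set j := tnth _ _ in h1 h2 *; under eq_fun do rewrite EFinM.
  apply: integrableZl => //; apply/integrableP; split.
    by apply/measurable_EFinP/measurable_funX/measurable_funB; exact: mX.
  under eq_integral do rewrite gee0_abs ?lee_fin ?sqr_ge0//.
  by rewrite sX// ltry.
rewrite /gram mulr_sumr -sumEFin [RHS]big_tnth; apply: eq_bigr => i _.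
have /(polar_in qt)[h1 h2] : tnth (in_tuple (polar q)) i \in polar q by exact: mem_tnth.
set j := tnth _ _ in h1 h2 *; under eq_integral do rewrite EFinM.
rewrite integralZl//.
  by rewrite sX// -EFinM; congr EFin; rewrite mulrCA.
apply/integrableP; split.
  by apply/measurable_EFinP/measurable_funX/measurable_funB; exact: mX.
under eq_integral do rewrite gee0_abs ?lee_fin ?sqr_ge0//.
by rewrite sX// ltry.
Qed.

(** With X_u the indicator of (0, u], a step function is itself a step integral, so
    [integral_sqr_step] covers it with kap = 1. *)
Lemma step_funE q (s : R) t : step_in t q ->
  step_fun q s = (\sum_(e <- q) e.2 * (\1_`]0, e.1.2] s - \1_`]0, e.1.1] s))%R.
Proof.
move=> /allP qt; rewrite /step_fun big_seq [RHS]big_seq; apply: eq_bigr => e eq.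
have /andP[/andP[a0 ab] _] := qt _ eq; congr (_ * _)%R.
rewrite !indicE !mem_setE !in_itv/=.
case: (ltP e.1.1 s) => sa /=.
  by rewrite (le_lt_trans a0 sa)/= subr0.
by rewrite (le_trans sa ab) subrr.
Qed.

Lemma integral_sqr_step_fun q t : (0 <= t)%R -> step_in t q ->
  \int[@lebesgue_measure R]_(s in `[0%R, t]) (step_fun q s ^+ 2)%:E = (gram q)%:E.
Proof.
move=> t0 qt; under eq_integral do rewrite (step_funE _ qt).
rewrite (@integral_sqr_step _ _ lebesgue_measure _ (fun u => \1_`]0%R, u]) 1 t) ?mul1r//.
move=> u s ut st.
wlog us : u s ut st / (u <= s)%R.
  move=> H; have [us|us] := leP u s; first exact: H.
  rewrite distrC -H// ?(ltW us)//; apply: eq_integral => r _; congr EFin.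
  by rewrite -sqrrN opprB.
transitivity (\int[@lebesgue_measure R]_(r in `[0%R, t]) (\1_`]u, s] r)%:E).
  apply: eq_integral => r _; congr EFin; rewrite !indicE !mem_setE !in_itv/=.
  have /andP[u0 _] := ut; case: (ltP u r) => ur /=.
    rewrite (le_lt_trans u0 ur)/=.
    by case: (r <= s)%R; rewrite ?subrr ?expr0n// sub0r sqrrN expr1n.
  by rewrite (le_trans ur us) !andbT subrr expr0n.
rewrite integral_indic// setIidl; last first.
  by move: ut st => /andP[u0 _] /andP[_ st]; apply: subset_itv; rewrite bnd_simp.
apply: (eq_trans (lebesgue_measure_itv `]u, s])).
rewrite mul1r distrC ger0_norm ?subr_ge0//= lte_fin.
by case: ltP => // su; have -> : u = s by [apply/eqP; rewrite eq_le us]; rewrite subrr.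
Qed.

End polarization.

Section brownian_isometry.
Context {R : realType} {d : measure_display} {Omega : measurableType d}.
Variables (P : probability Omega R) (W : R -> Omega -> R).
Hypothesis BW : brownian_motion P W.
Local Open Scope ereal_scope.

Let mW t : (0 <= t <= 1)%R -> measurable_fun [set: Omega] (W t).
Proof. by have [h _ _ _ _] := BW => t01; apply: h; rewrite in_itv. Qed.

Lemma brownian_sqr_affine (s t x a : R) : (0 <= s)%R -> (s <= t)%R -> (t <= 1)%R ->
  \int[P]_w ((x + a * (W t w - W s w)) ^+ 2)%:E =
  (x ^+ 2 + a ^+ 2 * (normal_var * (t - s)))%:E.
Proof.
(* The case s = t is apart because [normal_prob] with standard deviation 0 is not a Dirac mass. *)
move=> s0 st t1; have [E|sDt] := eqVneq s t.
  under eq_integral do rewrite E subrr mulr0 addr0.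
  by rewrite integral_cst//= probability_setT mule1 E subrr !mulr0 addr0.
have lst : (s < t)%R by rewrite lt_neqAle sDt.
have mI : measurable_fun [set: Omega] (W t \- W s)%R.
  by apply: measurable_funB; apply: mW; apply/andP; split => //;
    [exact: le_trans st|exact: le_trans t1].
have r0 : (0 < Num.sqrt (t - s))%R by rewrite sqrtr_gt0 subr_gt0.
have := normal_prob_sqr_affine x a r0; rewrite sqr_sqrtr ?subr_ge0// => <-.
have mI' : measurable_fun [set: Omega] ((W t \- W s)%R : Omega -> measurableTypeR R).
  exact: mI.
pose X : {RV P >-> measurableTypeR R} :=
  HB.pack (W t \- W s)%R (isMeasurableFun.Build _ _ _ _ _ mI').
rewrite -[LHS](@ge0_integral_distribution _ _ _ _ _ _ X
  (fun z => ((x + a * z) ^+ 2)%:E)); last 2 first.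
- by apply/measurable_EFinP; exact: measurable_sqr_affine.
- by move=> z; rewrite lee_fin sqr_ge0.
apply: eq_measure_integral => B mB _; have [_ _ _ h _] := BW; exact: h.
Qed.

Lemma brownian_isometry q t : (0 <= t <= 1)%R -> step_in t q ->
  \int[P]_w ((step_integral W q w) ^+ 2)%:E =
  (normal_var)%:E * \int[@lebesgue_measure R]_(s in `[0%R, t]) (step_fun q s ^+ 2)%:E.
Proof.
move=> /andP[t0 t1] qt; rewrite integral_sqr_step_fun// -EFinM.
apply: (@integral_sqr_step _ _ _ _ _ W normal_var t) => //.
  by move=> s /andP[s0 st]; apply: mW; rewrite s0 (le_trans st).
move=> u s; wlog us : u s / (u <= s)%R.
  move=> H ut st; have [us|us] := leP u s; first exact: H.
  rewrite distrC -H// ?(ltW us)//; apply: eq_integral => r _; congr EFin.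
  by rewrite -sqrrN opprB.
move=> /andP[u0 ut] /andP[s0 st].
have := brownian_sqr_affine 0 1 u0 us (le_trans st t1).
rewrite distrC ger0_norm ?subr_ge0// expr0n expr1n mul1r add0r => <-.
by apply: eq_integral => w _; congr EFin; rewrite add0r mul1r -sqrrN opprB.
Qed.

End brownian_isometry.

Section step_functions.
Context {R : realType}.
Local Notation triple := (R * R * R)%type.

(** Turns the step integral of [q] into a process in t. Intervals beyond t are collapsed rather than
    removed, so that sums over [q] keep their index. *)
Definition trunc_step (t : R) (q : seq triple) : seq triple :=
  [seq ((Num.min e.1.1 t, Num.min e.1.2 t), e.2) | e <- q].

Lemma trunc_step_in t u q : 0 <= t -> step_in u q -> step_in t (trunc_step t q).
Proof.
move=> t0 /allP qu; apply/allP => _ /mapP[e /qu /andP[/andP[a0 ab] _] ->] /=.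
by rewrite !le_min !ge_min a0 t0 ab !lexx !orbT.
Qed.

Lemma trunc_step_fun t q s : s <= t -> step_fun (trunc_step t q) s = step_fun q s.
Proof.
move=> st; rewrite /step_fun big_map; apply: eq_bigr => e _ /=; congr (_ * _).
rewrite !indicE !mem_setE !in_itv/= gt_min le_min st andbT.
by rewrite [t < s]ltNge st orbF.
Qed.

Lemma measurable_step_fun q (D : set R) : measurable_fun D (step_fun q).
Proof.
by apply: measurable_sum => e; apply: measurable_funM.
Qed.

Lemma measurable_sqr_step_fun q (D : set R) :
  measurable_fun D (fun s => (step_fun q s ^+ 2)%:E).
Proof.
by apply/measurable_EFinP; apply: measurable_funX; exact: measurable_step_fun.
Qed.

Lemma step_integral_trunc d (Omega : measurableType d) (W : R -> Omega -> R) t q w :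
  step_integral W (trunc_step t q) w =
  \sum_(e <- q) e.2 * (W (Num.min e.1.2 t) w - W (Num.min e.1.1 t) w).
Proof. by rewrite /step_integral big_map. Qed.

End step_functions.

(** * The maximal inequality for step integrals on a finite set of times *)

Section grid.
Context {R : realType} {d : measure_display} {Omega : measurableType d}.
Variables (P : probability Omega R) (W : R -> Omega -> R).
Hypothesis BW : brownian_motion P W.
Variables (q : seq (R * R * R)) (n : nat) (tau : nat -> R).
Hypothesis q01 : step_in 1 q.
Hypotheses (tau0 : tau 0%N = 0) (taun : tau n <= 1).
Hypothesis tau_nd : forall i, (i < n)%N -> tau i <= tau i.+1.
Hypothesis q_tau : forall i e, (i < n)%N -> e \in q ->
  (e.1.1 <= tau i \/ tau i.+1 <= e.1.1) /\ (e.1.2 <= tau i \/ tau i.+1 <= e.1.2).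

Let mW t : 0 <= t <= 1 -> measurable_fun [set: Omega] (W t).
Proof. by have [h _ _ _ _] := BW => t01; apply: h; rewrite in_itv. Qed.

Lemma grid_mono i j : (i <= j)%N -> (j <= n)%N -> tau i <= tau j.
Proof.
move=> + jn; elim: j jn => [|j IH] jn; first by rewrite leqn0 => /eqP ->.
rewrite leq_eqVlt => /predU1P[->//|]; rewrite ltnS => ij.
exact: le_trans (IH (ltnW jn) ij) (tau_nd jn).
Qed.

Lemma grid01 i : (i <= n)%N -> 0 <= tau i <= 1.
Proof.
move=> ni; rewrite -[X in X <= _]tau0 grid_mono//=.
by rewrite (le_trans _ taun)// grid_mono.
Qed.

(** No end point of [q] lies strictly inside a grid cell, so the integrand is constant on it, equal
    to its value at the right end. The integral thus becomes a weighted sum of independent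
    increments. *)
Lemma step_integral_grid_next w i : (i < n)%N ->
  step_integral W (trunc_step (tau i.+1) q) w - step_integral W (trunc_step (tau i) q) w =
  step_fun q (tau i.+1) * (W (tau i.+1) w - W (tau i) w).
Proof.
move=> ni; rewrite !step_integral_trunc -sumrB /step_fun mulr_suml.
rewrite big_seq [RHS]big_seq; apply: eq_bigr => e eq.
have := tau_nd ni; rewrite le_eqVlt => /predU1P[->|tt].
  by rewrite !subrr mulr0.
have [ha hb] := q_tau ni eq; have /andP[/andP[a0 ab] _] := allP q01 _ eq.
rewrite indicE mem_setE in_itv/= -mulrBr -mulrA; congr (_ * _).
have minl x : x <= tau i -> (Num.min x (tau i.+1) = x) * (Num.min x (tau i) = x).
  by move=> h; rewrite !min_l// (le_trans h)// ltW.
have minr x : tau i.+1 <= x ->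
    (Num.min x (tau i.+1) = tau i.+1) * (Num.min x (tau i) = tau i).
  by move=> h; rewrite !min_r// (le_trans _ h)// ltW.
case: ha => ha; case: hb => hb.
- rewrite !(minl _ ha) !(minl _ hb) subrr (leNgt (tau i.+1)).
  by rewrite (le_lt_trans hb tt) andbF mul0r.
- rewrite !(minl _ ha) !(minr _ hb) hb (le_lt_trans ha tt) mul1r; ring.
- by have := lt_le_trans tt (le_trans ha ab); rewrite ltNge hb.
- rewrite !(minr _ ha) !(minr _ hb) subrr ltNge ha/= mul0r; ring.
Qed.

Lemma step_integral_grid w k : (k <= n)%N ->
  partial_sum (fun i => W (tau i.+1) \- W (tau i)) (fun i => step_fun q (tau i.+1)) k w =
  step_integral W (trunc_step (tau k) q) w.
Proof.
elim: k => [|k IH] kn; last first.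
  rewrite /partial_sum big_ord_recr/=.
  have /= := IH (ltnW kn); rewrite /partial_sum /= => ->.
  by rewrite -step_integral_grid_next// addrC subrK.
rewrite /partial_sum big_ord0 step_integral_trunc tau0 big_seq big1// => e eq.
have /andP[/andP[a0 ab] _] := allP q01 _ eq.
by rewrite !min_r ?subrr ?mulr0// (le_trans a0).
Qed.

Lemma step_fun_grid s i : (i < n)%N -> tau i < s <= tau i.+1 ->
  step_fun q s = step_fun q (tau i.+1).
Proof.
move=> ni /andP[is_ si]; rewrite /step_fun big_seq [RHS]big_seq; apply: eq_bigr => e eq.
have [ha hb] := q_tau ni eq; congr (_ * _).
rewrite !indicE !mem_setE !in_itv/=; congr ((_ && _)%:R).
  case: ha => ha; first by rewrite (le_lt_trans ha is_) (le_lt_trans ha (lt_le_trans is_ si)).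
  by rewrite !ltNge ha (le_trans si ha).
case: hb => hb; last by rewrite hb (le_trans si hb).
by rewrite !leNgt (le_lt_trans hb is_) (le_lt_trans hb (lt_le_trans is_ si)).
Qed.

Local Open Scope ereal_scope.

Lemma integral_step_fun_grid k : (k <= n)%N ->
  \int[@lebesgue_measure R]_(s in `]0%R, tau k]) (step_fun q s ^+ 2)%:E =
  (\sum_(i < k) step_fun q (tau i.+1) ^+ 2 * (tau i.+1 - tau i))%:E.
Proof.
elim: k => [|k IH] kn; first by rewrite big_ord0 tau0 set_itv_ge ?bnd_simp// integral_set0.
have [t0 _] := andP (grid01 (ltnW kn)); have tt := tau_nd kn.
have -> : `]0%R, tau k.+1]%classic = `]0%R, tau k] `|` `]tau k, tau k.+1] :> set R.
  by rewrite -itv_bndbnd_setU ?bnd_simp.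
have msq (D : set R) : measurable_fun D (fun s => (step_fun q s ^+ 2)%:E).
  exact: measurable_sqr_step_fun.
rewrite ge0_integral_setU//; last 3 first.
- exact: msq.
- by move=> s _; rewrite lee_fin sqr_ge0.
- apply/disj_setPRL => s /=; rewrite !in_itv/= => /andP[ts _] /andP[_].
  by rewrite leNgt ts.
rewrite IH ?(ltnW kn)// big_ord_recr/= EFinD; congr (_ + _).
rewrite (eq_integral (cst ((step_fun q (tau k.+1)) ^+ 2)%:E)); last first.
  by move=> s; rewrite inE/= in_itv/= => /(step_fun_grid kn) ->.
rewrite integral_cst// [RHS]EFinM; congr (_ * _)%E.
apply: (eq_trans (lebesgue_measure_itv `]tau k, tau k.+1])).
rewrite /= lte_fin; case: ltP => // h.
by have -> : tau k.+1 = tau k by [apply/eqP; rewrite eq_le h]; rewrite subrr.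
Qed.

Lemma normal_var_ge0 : (0 <= normal_var :> R)%R.
Proof.
apply: fine_ge0; apply: integral_ge0 => x _.
by rewrite lee_fin mulr_ge0 ?sqr_ge0 ?normal_pdf_ge0.
Qed.

Lemma grid_maximal (lam : R) : (0 < lam)%R ->
  (lam ^+ 2)%:E * P [set w | exists2 k, (k <= n)%N &
      (lam <= `|step_integral W (trunc_step (tau k) q) w|)%R] <=
  normal_var%:E * \int[@lebesgue_measure R]_(s in `[0%R, 1%R]) (step_fun q s ^+ 2)%:E.
Proof.
move=> lam0; have [_ _ ind _ _] := BW.
pose X i := (W (tau i.+1) \- W (tau i))%R.
have mX i : (i < n)%N -> measurable_fun [set: Omega] (X i).
  by move=> ni; apply: measurable_funB; apply: mW; apply: grid01 => //; exact: ltnW.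
have indX (B : nat -> set R) : (forall i, measurable (B i)) ->
    P (\bigcap_(i in `I_n) (X i @^-1` B i)) = \prod_(i < n) P (X i @^-1` B i).
  by move=> mB; apply: ind => //; rewrite tau0.
have sqrX i : (i < n)%N -> forall t a : R, \int[P]_w ((t + a * X i w) ^+ 2)%:E =
    (t ^+ 2 + a ^+ 2 * (normal_var * (tau i.+1 - tau i)))%:E.
  move=> ni t a; have /andP[a0 _] := grid01 (ltnW ni); have /andP[_ b1] := grid01 ni.
  exact: (brownian_sqr_affine BW t a a0 (tau_nd ni) b1).
have := @kolmogorov_maximal _ _ _ P n X (fun i => step_fun q (tau i.+1)) _ mX indX sqrX lam lam0.
have -> : exit_event n X (fun i => step_fun q (tau i.+1)) lam =
    [set w | exists2 k, (k <= n)%N &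
      (lam <= `|step_integral W (trunc_step (tau k) q) w|)%R].
  by apply/seteqP; split => w [k kn h]; exists k => //; move: h; rewrite step_integral_grid.
move/le_trans; apply.
have -> : (\sum_(i < n) step_fun q (tau i.+1) ^+ 2 * (normal_var * (tau i.+1 - tau i)) =
    normal_var * \sum_(i < n) step_fun q (tau i.+1) ^+ 2 * (tau i.+1 - tau i))%R.
  by rewrite mulr_sumr; apply: eq_bigr => i _; rewrite mulrCA.
rewrite EFinM -integral_step_fun_grid// lee_wpmul2l ?lee_fin ?normal_var_ge0//.
apply: ge0_subset_integral => //=.
- exact: measurable_sqr_step_fun.
- by move=> s _; rewrite lee_fin sqr_ge0.
- by apply: subset_itv; rewrite bnd_simp.
Qed.

End grid.

Lemma measurable_elementary_integral {R : realType} d (Omega : measurableType d)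
    (W : R -> Omega -> R) t q :
  (forall s, 0 <= s <= 1 -> measurable_fun [set: Omega] (W s)) -> t <= 1 -> step_in t q ->
  measurable_fun [set: Omega] (step_integral W q).
Proof.
move=> mW t1 /allP qt.
rewrite /step_integral; under eq_fun do rewrite big_tnth.
apply: measurable_sum => i.
have /qt/andP[/andP[a0 ab] bt] : tnth (in_tuple q) i \in q by exact: mem_tnth.
apply: measurable_funM => //; apply: measurable_funB; apply: mW.
  by rewrite (le_trans a0 ab) (le_trans bt t1).
by rewrite a0 (le_trans ab (le_trans bt t1)).
Qed.

Section brownian_maximal.
Context {R : realType} {d : measure_display} {Omega : measurableType d}.
Variables (P : probability Omega R) (W : R -> Omega -> R).
Hypothesis BW : brownian_motion P W.
Local Open Scope ereal_scope.

Lemma measurable_step_integral q t : (t <= 1)%R -> step_in t q ->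
  measurable_fun [set: Omega] (step_integral W q).
Proof.
move=> t1 qt; have [mW _ _ _ _] := BW.
by apply: measurable_elementary_integral t1 qt => s s01; apply: mW; rewrite in_itv.
Qed.

(** The bound does not depend on the number of times in [D], which allows [D] to grow to a dense
    set. *)
Lemma brownian_maximal q (D : seq R) (lam : R) : step_in 1 q ->
  {in D, forall t, 0 <= t <= 1}%R -> (0 < lam)%R ->
  (lam ^+ 2)%:E * P [set w | exists2 t, t \in D &
      (lam <= `|step_integral W (trunc_step t q) w|)%R] <=
  normal_var%:E * \int[@lebesgue_measure R]_(s in `[0%R, 1%R]) (step_fun q s ^+ 2)%:E.
Proof.
move=> q01 D01 lam0.
(* The grid consists of 0, the given times and all end points of [q]; sorted, it satisfies the
   requirements of [grid_maximal]. *)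
pose l := (0%R :: D ++ flatten [seq [:: e.1.1; e.1.2] | e <- q]).
have l01 t : t \in l -> (0 <= t <= 1)%R.
  rewrite inE mem_cat => /or3P[/eqP ->|/D01//|]; first by rewrite lexx ler01.
  move=> /flattenP[_ /mapP[e eq ->]]; have /andP[/andP[a0 ab] b1] := allP q01 _ eq.
  by rewrite !inE => /orP[]/eqP ->; rewrite ?a0 ?b1 ?(le_trans a0)// (le_trans ab).
pose tau i := nth 1%R (sort <=%R l) i; pose n := (size l).-1.
have sl : size (sort <=%R l) = n.+1 by rewrite size_sort.
have mem_tau i : (i <= n)%N -> tau i \in l.
  by move=> ni; rewrite -(mem_sort <=%R) mem_nth// sl.
have tau_ex t : t \in l -> exists2 k, (k <= n)%N & tau k = t.
  rewrite -(mem_sort <=%R) => tl; exists (index t (sort <=%R l)).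
    by rewrite -ltnS -sl index_mem.
  by rewrite /tau nth_index.
have tau_mono i j : (i <= j)%N -> (j <= n)%N -> (tau i <= tau j)%R.
  move=> ij jn; apply: (sorted_leq_nth le_trans lexx) => //.
  - exact: sort_le_sorted.
  - by rewrite inE sl ltnS (leq_trans ij).
  - by rewrite inE sl ltnS.
have tau0 : tau 0%N = 0%R.
  have [k kn k0] := tau_ex 0%R (mem_head _ _).
  apply/eqP; rewrite eq_le -{1}k0 tau_mono//=.
  by have /andP[] := l01 _ (mem_tau _ (leq0n n)).
have taun : (tau n <= 1)%R by have /andP[] := l01 _ (mem_tau _ (leqnn n)).
have grid t : t \in l -> forall i, (i < n)%N -> (t <= tau i \/ tau i.+1 <= t)%R.
  move=> /tau_ex[k kn <-] i ni; have [ki|ik] := leqP k i.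
    by left; apply: tau_mono => //; exact: ltnW.
  by right; exact: tau_mono.
have q_tau i e : (i < n)%N -> e \in q -> (e.1.1 <= tau i \/ tau i.+1 <= e.1.1)%R /\
    (e.1.2 <= tau i \/ tau i.+1 <= e.1.2)%R.
  move=> ni eq; have lq x : x \in [:: e.1.1; e.1.2] -> x \in l.
    move=> xe; rewrite inE mem_cat; apply/or3P; apply: Or33; apply/flattenP.
    by exists [:: e.1.1; e.1.2] => //; apply/mapP; exists e.
  by split; apply: grid => //; apply: lq; rewrite !inE eqxx ?orbT.
apply: le_trans (grid_maximal BW q01 tau0 taun _ q_tau lam0); last first.
  by move=> i ni; exact: tau_mono.
rewrite lee_wpmul2l ?lee_fin ?sqr_ge0//.
have mS t : (0 <= t <= 1)%R ->
    measurable [set w | (lam <= `|step_integral W (trunc_step t q) w|)%R].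
  move=> /andP[t0 t1]; apply: measurable_norm_ge.
  by apply: (measurable_step_integral t1); exact: trunc_step_in q01.
apply: le_measure; rewrite ?inE.
- rewrite (_ : mkset _ = \bigcup_(t in [set` D])
    [set w | (lam <= `|step_integral W (trunc_step t q) w|)%R]).
    by apply: fin_bigcup_measurable => // t /= tD; apply: mS; exact: D01.
  by apply/seteqP; split => [w [t tD h]|w [t tD h]]; exists t.
- rewrite (_ : mkset _ = \bigcup_(k in [set k | (k <= n)%N])
    [set w | (lam <= `|step_integral W (trunc_step (tau k) q) w|)%R]).
    by apply: bigcup_measurable => k /= kn; apply: mS; apply: l01; exact: mem_tau.
  by apply/seteqP; split => [w [t tD h]|w [t tD h]]; exists t.
- move=> w [t tD h]; have [|k kn kt] := tau_ex t; first by rewrite inE mem_cat tD orbT.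
  by exists k => //; rewrite kt.
Qed.

End brownian_maximal.

(** * The Wiener integral as a continuous process *)

Section L2_tools.
Context d (T : measurableType d) (R : realType).
Variables (mu : {measure set T -> \bar R}) (D : set T).
Hypothesis mD : measurable D.
Local Open Scope ereal_scope.

Lemma measurable_sqrB (f g : T -> R) : measurable_fun D f -> measurable_fun D g ->
  measurable_fun D (fun x => ((f x - g x) ^+ 2)%:E).
Proof.
by move=> mf mg; apply/measurable_EFinP; apply: measurable_funX; exact: measurable_funB.
Qed.

(** From (a + b)^2 <= 2 (a^2 + b^2). The factor 2 is the price for staying with squared norms. *)
Lemma L2_triangle (f g h : T -> R) :
  measurable_fun D f -> measurable_fun D g -> measurable_fun D h ->
  \int[mu]_(x in D) ((f x - h x) ^+ 2)%:E <=
    2%:E * (\int[mu]_(x in D) ((f x - g x) ^+ 2)%:E +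
            \int[mu]_(x in D) ((g x - h x) ^+ 2)%:E).
Proof.
move=> mf mg mh; have sq0 (u : R) : 0 <= (u ^+ 2)%:E by rewrite lee_fin sqr_ge0.
rewrite -ge0_integralD//; [|exact: measurable_sqrB|exact: measurable_sqrB].
rewrite -ge0_integralZl//; last 2 first.
- by apply: emeasurable_funD; exact: measurable_sqrB.
- by move=> x _; rewrite adde_ge0.
apply: ge0_le_integral => //.
- exact: measurable_sqrB.
- by apply: emeasurable_funM => //; apply: emeasurable_funD; exact: measurable_sqrB.
move=> x _; rewrite -EFinD -EFinM lee_fin.
have := sqr_ge0 ((f x - g x) - (g x - h x))%R.
have -> : (f x - h x = (f x - g x) + (g x - h x))%R by ring.
by move: (f x - g x)%R (g x - h x)%R => a b; nra.
Qed.

Lemma ereal_cvg0_le (u : nat -> \bar R) (e : R) : u @ \oo --> 0 -> (0 < e)%R ->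
  exists N, forall n, (N <= n)%N -> u n <= e%:E.
Proof.
move=> u0 e0; have : nbhs (0 : \bar R) [set y | y < e%:E].
  by apply: open_nbhs_nbhs; split; [exact: open_ereal_lt_ereal|rewrite /= lte_fin].
by move=> /u0[N _ NP]; exists N => n /NP /ltW.
Qed.

Lemma le_ereal_cvg0 (u v : nat -> \bar R) : (forall n, 0 <= u n) ->
  (forall n, u n <= v n) -> v @ \oo --> 0 -> u @ \oo --> 0.
Proof.
move=> u0 uv v0; apply: (@squeeze_cvge _ _ _ _ (cst 0) _ v) => //.
- by apply: nearW => n; rewrite u0 uv.
- exact: cvg_cst.
Qed.

End L2_tools.

(** * Density of step functions in L^2([0, 1]) *)

Section clip.
Context {R : realType}.

Definition clip (K x : R) : R := Num.max (- K) (Num.min x K).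

Lemma clip_norm (K x : R) : 0 <= K -> `|clip K x| <= K.
Proof.
by move=> K0; rewrite ler_norml /clip le_max lexx ge_max ge_min lexx orbT andbT; lra.
Qed.

Lemma clip_id (K x : R) : `|x| <= K -> clip K x = x.
Proof. by rewrite ler_norml => /andP[h1 h2]; rewrite /clip min_l// max_r. Qed.

Lemma clip_lip (K x y : R) : 0 <= K -> `|clip K x - clip K y| <= `|x - y|.
Proof.
move=> K0; wlog xy : x y / x <= y.
  move=> H; have [xy|/ltW yx] := leP x y; first exact: H.
  by rewrite distrC [leRHS]distrC; exact: H.
rewrite distrC [leRHS]distrC (ger0_norm (_ : 0 <= y - x)) ?subr_ge0//.
rewrite ler_norml /clip !maxElt !minElt.
by case: (ltP y K) => ?; case: (ltP x K) => ?; do ![case: ltP => ?]; apply/andP; split; lra.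
Qed.

Lemma clip_continuous (K : R) : 0 <= K -> continuous (clip K).
Proof.
move=> K0 x; apply/cvgrPdist_le => e e0; near=> y.
by rewrite (le_trans (clip_lip _ _ K0))//; near: y.
Unshelve. all: by end_near.
Qed.

Lemma measurable_clip (K : R) : 0 <= K -> measurable_fun [set: R] (clip K).
Proof. by move=> K0; apply: continuous_measurable_fun; exact: clip_continuous. Qed.

End clip.

Section step_density.
Context {R : realType}.
Local Notation mu := (@lebesgue_measure R).
Local Open Scope ereal_scope.
Local Notation I01 := (`[0%R, 1%R]%classic : set R).

Lemma L2_triangle01 (f g h : R -> R) :
  measurable_fun I01 f -> measurable_fun I01 g -> measurable_fun I01 h ->
  \int[mu]_(x in I01) ((f x - h x) ^+ 2)%:E <=
    2%:E * (\int[mu]_(x in I01) ((f x - g x) ^+ 2)%:E +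
            \int[mu]_(x in I01) ((g x - h x) ^+ 2)%:E).
Proof. by move=> mf mg mh; apply: L2_triangle => //; exact: measurable_itv. Qed.

Lemma integrable01_cst (K : R) : mu.-integrable I01 (EFin \o cst K).
Proof.
apply: cont01_integrable => //.
by apply: continuous_subspaceT => ?; exact: cvg_cst.
Qed.

(** Dominated convergence with bound delta^2: at each point the clipped value is eventually exact.
    This reduces the approximation to bounded functions. *)
Lemma clip_dense (delta : R -> R) (e : R) : measurable_fun I01 delta ->
  \int[mu]_(s in I01) ((delta s) ^+ 2)%:E < +oo -> (0 < e)%R ->
  exists2 K : R, (0 < K)%R & \int[mu]_(s in I01) ((clip K (delta s) - delta s) ^+ 2)%:E <= e%:E.
Proof.
move=> md id e0.
have mc n : measurable_fun I01 (fun s => clip n%:R (delta s)).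
  exact: (measurableT_comp (measurable_clip (ler0n _ n)) md).
have sq2 : measurable_fun I01 (fun s => (delta s ^+ 2)%:E).
  by apply/measurable_EFinP; exact: measurable_funX.
have dom n s : (`|((clip n%:R (delta s) - delta s) ^+ 2)%:E| <= (delta s ^+ 2)%:E).
  rewrite gee0_abs ?lee_fin ?sqr_ge0// -sqrrN opprB.
  rewrite -[leRHS]real_normK ?num_real// -[leLHS]real_normK ?num_real//.
  rewrite ler_pXn2r ?nnegrE//.
  have c0 : clip n%:R (0 : R) = 0%R by apply: clip_id; rewrite normr0.
  have := clip_lip (delta s) 0 (ler0n R n); rewrite c0 !subr0 => h1.
  have [xn|nx] := leP `|delta s|%R n%:R; first by rewrite clip_id// subrr normr0.
  rewrite /clip; case: (ltgtP (delta s) 0%R) => d0.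
  - rewrite min_l ?max_l; last 2 first.
    + by move: nx; rewrite ltr0_norm// => nx; lra.
    + by rewrite (le_trans (ltW d0)).
    by rewrite opprK ler_norml (ltr0_norm d0); move: nx (ler0n R n); rewrite ltr0_norm// => nx n0; apply/andP; split; lra.
  - rewrite min_r ?max_r; last 2 first.
    + by move: (ler0n R n) => n0; lra.
    + by move: nx; rewrite gtr0_norm// => /ltW.
    by rewrite ler_norml (gtr0_norm d0); move: nx (ler0n R n); rewrite gtr0_norm// => nx n0; apply/andP; split; lra.
  - by move: nx; rewrite d0 normr0 ltNge ler0n.
have lim : \int[mu]_(s in I01) ((clip n%:R (delta s) - delta s) ^+ 2)%:E @[n --> \oo] -->
    \int[mu]_(s in I01) cst 0 s.
  apply: (@dominated_cvg _ _ _ mu I01 _ _ _ (fun s => (delta s ^+ 2)%:E)) => //.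
  - by move=> n; exact: measurable_sqrB (mc n) md.
  - move=> s _; apply: cvg_near_cst.
    exists (Num.truncn `|delta s|).+1 => // n /= hn.
    rewrite clip_id ?subrr ?expr0n//.
    by rewrite (le_trans (ltW (truncnS_gt _)))// ler_nat.
  - apply/integrableP; split => //.
    by under eq_integral do rewrite gee0_abs ?lee_fin ?sqr_ge0//.
rewrite integral0 in lim; have [N /(_ N.+1 (leqnSn N)) h] := ereal_cvg0_le lim e0.
by exists N.+1%:R => //; rewrite ltr0n.
Qed.

(** Continuous functions are dense in L^1. Clipping the approximation at the bound K of f moves it
    no further from f and gives (g - f)^2 <= 2 K |g - f|, so L^1 closeness implies L^2 closeness. *)
Lemma continuous_dense_L2 (f : R -> R) (K e : R) : measurable_fun I01 f -> (0 < K)%R ->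
  (forall s, `|f s| <= K)%R -> (0 < e)%R ->
  exists g : R -> R, [/\ continuous g, (forall s, `|g s| <= K)%R &
    \int[mu]_(s in I01) ((g s - f s) ^+ 2)%:E <= e%:E].
Proof.
move=> mf K0 fK e0; have K0' := ltW K0.
have intf : mu.-integrable I01 (EFin \o f).
  apply: (le_integrable _ _ _ (integrable01_cst K)) => //.
    exact/measurable_EFinP.
  by move=> s _; rewrite /= lee_fin [leRHS]ger0_norm.
have fin01 : mu I01 < +oo by rewrite /= lebesgue_measure_itv/= lte_fin ltr01 ltry.
have [g [cg ig lim]] := approximation_continuous_integrable (measurable_itv _) fin01 intf.
have e1 : (0 < e / (2 * K))%R by rewrite divr_gt0// mulr_gt0.
have [N /(_ N (leqnn N)) h] := ereal_cvg0_le lim e1.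
have mg : measurable_fun [set: R] (g N) by exact: continuous_measurable_fun.
have mB : measurable_fun I01 (fun s => (f s - g N s)%R).
  by apply: measurable_funB => //; exact: measurable_funTS.
have mBE : measurable_fun I01 (fun s => (`|f s - g N s|%R)%:E).
  by apply/measurable_EFinP; exact: measurableT_comp.
exists (clip K \o g N); split.
- by move=> x; apply: continuous_comp; [exact: cg|exact: clip_continuous].
- by move=> s; exact: clip_norm.
apply: (@le_trans _ _ (\int[mu]_(s in I01) ((2 * K)%:E * `|(f s - g N s)%:E|))).
  apply: ge0_le_integral => //=.
  - by move=> s _; rewrite lee_fin sqr_ge0.
  - apply: measurable_sqrB => //; apply: measurable_funTS.
    exact: (measurableT_comp (measurable_clip K0') mg).
  - by apply: emeasurable_funM => //; exact: mBE.
  move=> s _; rewrite -EFinM lee_fin -{1}(clip_id (fK s)).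
  rewrite -[leLHS]real_normK ?num_real// expr2; apply: ler_pM => //.
    rewrite (le_trans (ler_normB _ _))//.
    by have := clip_norm (g N s) K0'; have := clip_norm (f s) K0'; lra.
  by rewrite [leRHS]distrC clip_lip.
rewrite ge0_integralZl//; last by rewrite lee_fin mulr_ge0.
rewrite -lee_pdivlMl ?mulr_gt0//; apply: (le_trans h).
by rewrite -EFinM lee_fin mulrC.
Qed.

Definition grid_step (g : R -> R) (N : nat) : seq (R * R * R) :=
  [seq ((i%:R / N%:R, i.+1%:R / N%:R), g (i%:R / N%:R))%R | i <- iota 0 N].

Lemma grid_step_in g N : step_in 1 (grid_step g N).
Proof.
apply/allP => _ /mapP[i + ->] /=; rewrite mem_iota/= add0n => iN.
have N0 : (0 < N%:R :> R)%R by rewrite ltr0n (leq_ltn_trans _ iN).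
rewrite divr_ge0//= ler_pM2r ?invr_gt0// ler_nat leqnSn/=.
by rewrite ler_pdivrMr// mul1r ler_nat.
Qed.

Lemma grid_step_fun g N s :
  step_fun (grid_step g N) s = (\sum_(i < N) \1_(cell N i) s * g (i%:R / N%:R))%R.
Proof.
rewrite /step_fun big_map -{1}(subn0 N) -/(index_iota 0 N) big_mkord.
by apply: eq_bigr => i _; rewrite mulrC.
Qed.

Lemma step_dense_continuous (g : R -> R) (K e : R) : continuous g -> (0 < K)%R ->
  (forall s, `|g s| <= K)%R -> (0 < e)%R ->
  exists2 q, step_in 1 q &
    \int[mu]_(s in I01) ((step_fun q s - g s) ^+ 2)%:E <= e%:E.
Proof.
move=> cg K0 gK e0.
have mg (D : set R) : measurable_fun D g.
  by apply: measurable_funTS; exact: continuous_measurable_fun.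
have mq N (D : set R) : measurable_fun D
    (fun s => ((step_fun (grid_step g N) s - g s) ^+ 2)%:E).
  by apply/measurable_EFinP; apply: measurable_funX; apply: measurable_funB => //;
    exact: measurable_step_fun.
have lim : \int[mu]_(s in `]0%R, 1%R]) ((step_fun (grid_step g n.+1) s - g s) ^+ 2)%:E
    @[n --> \oo] --> \int[mu]_(s in `]0%R, 1%R]) cst 0 s.
  apply: (@dominated_cvg _ _ _ mu _ _ _ _ (EFin \o cst ((K + K) ^+ 2)%R)) => //.
  - by move=> n; exact: mq.
  - move=> s /=; rewrite in_itv/= => s01.
    have sg : step_fun (grid_step g n.+1) s @[n --> \oo] --> g s.
      under eq_fun do rewrite grid_step_fun.
      (* The approximation of drift integrands, for the identity drift and the path [g]. *)
      apply: (step_approx_cvg (b := fun=> id) ler01 _ _ s01).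
        by move=> y z; rewrite mul1r.
      exact: continuous_subspaceT.
    have sb : (step_fun (grid_step g n.+1) s - g s)%R @[n --> \oo] --> (0%R : R).
      by rewrite -(subrr (g s)); apply: cvgB => //; exact: cvg_cst.
    have s2 := cvgM sb sb; rewrite mulr0 in s2.
    apply: (@cvg_EFin _ _ _ _ _ 0%R); first exact: nearW.
    exact: (s2 _).
  - exact: integrable_cst_itv.
  - move=> n s /=; rewrite in_itv/= => s01; rewrite lee_fin ger0_norm ?sqr_ge0//.
    rewrite -[leLHS]real_normK ?num_real// ler_pXn2r ?nnegrE ?addr_ge0 ?(ltW K0)//.
    have [k [kn cks kE]] := cellP (ltn0Sn n) s01.
    rewrite grid_step_fun (kE (fun i => g (i%:R / n.+1%:R)))%R.
    by rewrite (le_trans (ler_normB _ _))// lerD.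
rewrite integral0 in lim; have [N /(_ N (leqnn N)) h] := ereal_cvg0_le lim e0.
exists (grid_step g N.+1); first exact: grid_step_in.
by rewrite -integral_itv_obnd_cbnd.
Qed.

Lemma step_dense (delta : R -> R) (e : R) : measurable_fun I01 delta ->
  \int[mu]_(s in I01) ((delta s) ^+ 2)%:E < +oo -> (0 < e)%R ->
  exists2 q, step_in 1 q &
    \int[mu]_(s in I01) ((step_fun q s - delta s) ^+ 2)%:E <= e%:E.
Proof.
(* Two triangle inequalities turn three errors e/16 into 2 (2 (e/16 + e/16) + e/16) = 10 e/16. *)
move=> md id e0; have e8 : (0 < e / 16)%R by rewrite divr_gt0.
have [K K0 hK] := clip_dense md id e8.
have mc : measurable_fun I01 (clip K \o delta).
  exact: (measurableT_comp (measurable_clip (ltW K0)) md).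
have [g [cg gK hg]] := continuous_dense_L2 mc K0 (fun s => clip_norm _ (ltW K0)) e8.
have [q q01 hq] := step_dense_continuous cg K0 gK e8.
have mg : measurable_fun I01 g by apply: measurable_funTS; exact: continuous_measurable_fun.
have mq : measurable_fun I01 (step_fun q) by exact: measurable_step_fun.
exists q => //.
apply: le_trans (L2_triangle01 mq mc md) _.
apply: (@le_trans _ _ (2%:E * (2%:E * ((e / 16)%:E + (e / 16)%:E) + (e / 16)%:E))).
  rewrite lee_wpmul2l// leeD//.
  apply: le_trans (L2_triangle01 mq mg mc) _.
  by rewrite lee_wpmul2l// leeD.
by rewrite -!(EFinD, EFinM) lee_fin; lra.
Qed.

End step_density.

Section unit_dense.
Context {R : realType}.

(* The rationals of [0, 1], with repetitions. *)
Definition dense01 (i : nat) : R :=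
  if unpickle i is Some (k, n) then Num.min 1 (k%:R / n.+1%:R) else 0.

Lemma dense01_in i : 0 <= dense01 i <= 1.
Proof.
rewrite /dense01; case: unpickle => [[k n]|]; last by rewrite lexx ler01.
by rewrite le_min ler01 divr_ge0//= ge_min lexx.
Qed.

Lemma dense01_near (t e : R) : 0 <= t <= 1 -> 0 < e -> exists i, `|dense01 i - t| < e.
Proof.
move=> /andP[t0 t1] e0; have [n _ /(_ n (leqnn n))] :=
  (@cvgrPdist_lt _ _ _ _ _ _ _).1 (@cvg_harmonic R) _ e0.
rewrite sub0r normrN ger0_norm ?harmonic_ge0// => ne.
pose k := Num.truncn (t * n.+1%:R); exists (pickle (k, n)).
have n0 : 0 < n.+1%:R :> R by rewrite ltr0n.
have /andP[kt tk] := truncn_itv (mulr_ge0 t0 (ltW n0)).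
have kt' : k%:R / n.+1%:R <= t by rewrite ler_pdivrMr.
have tk' : t < k%:R / n.+1%:R + n.+1%:R^-1.
  have -> : k%:R / n.+1%:R + n.+1%:R^-1 = k.+1%:R / n.+1%:R :> R.
    by rewrite -[k.+1%:R]natr1 mulrDl mul1r.
  by rewrite ltr_pdivlMr.
rewrite /dense01 pickleK min_r ?(le_trans kt')//.
rewrite distrC ger0_norm ?subr_ge0//; apply: lt_trans ne.
by rewrite ltrBlDl.
Qed.

Lemma dense01_le (u : R -> R) (c : R) : {within `[0, 1], continuous u} ->
  (forall i, `|u (dense01 i)| <= c) -> forall t, 0 <= t <= 1 -> `|u t| <= c.
Proof.
move=> cu uc t t01; apply/ler_addgt0Pl => e e0.
have /cont01P/(_ _ t01 _ e0)[d d0 dP] := cu.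
have [i ir] := dense01_near t01 d0.
have h := dP _ (dense01_in i) ir; rewrite -[u t](subrK (u (dense01 i))).
by rewrite (le_trans (ler_normD _ _))// lerD// distrC.
Qed.

End unit_dense.

Section step_difference.
Context {R : realType}.
Local Notation triple := (R * R * R)%type.

Definition step_sub (q q' : seq triple) : seq triple :=
  q ++ [seq (e.1, - e.2) | e <- q'].

Lemma step_sub_in t q q' : step_in t q -> step_in t q' -> step_in t (step_sub q q').
Proof.
move=> qt qt'; rewrite /step_in /step_sub all_cat; apply/andP; split; first exact: qt.
by rewrite all_map; exact: qt'.
Qed.

Lemma step_sub_fun q q' s : step_fun (step_sub q q') s = step_fun q s - step_fun q' s.
Proof.
rewrite /step_fun /step_sub big_cat big_map/= -sumrN; congr (_ + _).
by apply: eq_bigr => e _; rewrite mulNr.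
Qed.

Lemma step_sub_integral d (Omega : measurableType d) (W : R -> Omega -> R) q q' w :
  step_integral W (step_sub q q') w = step_integral W q w - step_integral W q' w.
Proof.
rewrite /step_integral /step_sub big_cat big_map/= -sumrN; congr (_ + _).
by apply: eq_bigr => e _; rewrite mulNr.
Qed.

Lemma trunc_step_sub t q q' :
  trunc_step t (step_sub q q') = step_sub (trunc_step t q) (trunc_step t q').
Proof. by rewrite /trunc_step /step_sub map_cat -!map_comp. Qed.

End step_difference.

(** * Uniqueness of the Wiener integral *)

Section wiener_uniqueness.
Context {R : realType} {d : measure_display} {Omega : measurableType d}.
Variables (P : probability Omega R) (W : R -> Omega -> R).
Hypothesis BW : brownian_motion P W.
Local Open Scope ereal_scope.
Local Notation mu := (@lebesgue_measure R).

Lemma brownian_isometry_sub q q' t : (0 <= t <= 1)%R -> step_in t q -> step_in t q' ->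
  \int[P]_w ((step_integral W q w - step_integral W q' w) ^+ 2)%:E =
  normal_var%:E * \int[mu]_(s in `[0%R, t]) ((step_fun q s - step_fun q' s) ^+ 2)%:E.
Proof.
move=> t01 qt qt'; have := brownian_isometry BW t01 (step_sub_in qt qt').
under eq_integral do rewrite step_sub_integral.
by under [X in _ = _ * X -> _]eq_integral do rewrite step_sub_fun.
Qed.

Lemma L2_triangle_itv t (f g h : R -> R) : measurable_fun (`[0%R, t] : set R) f ->
  measurable_fun (`[0%R, t] : set R) g -> measurable_fun (`[0%R, t] : set R) h ->
  \int[mu]_(x in `[0%R, t]) ((f x - h x) ^+ 2)%:E <=
    2%:E * (\int[mu]_(x in `[0%R, t]) ((f x - g x) ^+ 2)%:E +
            \int[mu]_(x in `[0%R, t]) ((g x - h x) ^+ 2)%:E).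
Proof. by move=> mf mg mh; apply: L2_triangle => //; exact: measurable_itv. Qed.

Lemma wiener_integral_unique delta t Y Y' : (0 <= t <= 1)%R ->
  measurable_fun (`[0%R, t] : set R) delta ->
  wiener_integral P W delta t Y -> wiener_integral P W delta t Y' ->
  {ae P, forall w, Y w = Y' w}.
Proof.
move=> t01 md [mY [phi [phit phid phiY]]] [mY' [psi [psit psid psiY]]].
have /andP[_ t1] := t01.
have mphi n := measurable_step_integral BW t1 (phit n).
have mpsi n := measurable_step_integral BW t1 (psit n).
(* The path from Y to Y' goes through the step integrals of [phi n] and [psi n]. Their distance is
   that of the step functions, by isometry, and those meet at delta: 2 (e + 2 (4 normal_var e + e))
   in total. *)
have small (e : R) : (0 < e)%R -> \int[P]_w ((Y w - Y' w) ^+ 2)%:E <=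
    ((6 + 16 * normal_var) * e)%:E.
  move=> e0.
  have [n1 h1] := ereal_cvg0_le phid e0; have [n2 h2] := ereal_cvg0_le phiY e0.
  have [n3 h3] := ereal_cvg0_le psid e0; have [n4 h4] := ereal_cvg0_le psiY e0.
  pose n := maxn (maxn n1 n2) (maxn n3 n4).
  have {}h1 := h1 n; have {}h2 := h2 n; have {}h3 := h3 n; have {}h4 := h4 n.
  rewrite !leq_max !leqnn ?orbT in h1 h2 h3 h4.
  have {}h1 := h1 isT; have {}h2 := h2 isT; have {}h3 := h3 isT; have {}h4 := h4 isT.
  apply: le_trans (L2_triangle P measurableT mY (mphi n) mY') _.
  have swap (f g : Omega -> R) : \int[P]_w ((f w - g w) ^+ 2)%:E =
      \int[P]_w ((g w - f w) ^+ 2)%:E.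
    by apply: eq_integral => w _; rewrite -sqrrN opprB.
  apply: (@le_trans _ _ (2%:E * (e%:E + 2%:E * (normal_var%:E * (2%:E * (e%:E + e%:E)) + e%:E)))).
    rewrite lee_wpmul2l// leeD//; first by rewrite swap.
    apply: le_trans (L2_triangle P measurableT (mphi n) (mpsi n) mY') _.
    rewrite lee_wpmul2l// leeD// (brownian_isometry_sub t01)//.
    rewrite lee_wpmul2l ?lee_fin ?normal_var_ge0//.
    apply: le_trans (L2_triangle_itv (@measurable_step_fun _ _ _) md (@measurable_step_fun _ _ _)) _.
    rewrite lee_wpmul2l// leeD//; apply: le_trans h3.
    by under eq_integral do rewrite -sqrrN opprB.
  by rewrite -!(EFinD, EFinM) lee_fin le_eqVlt; apply/orP; left; apply/eqP; ring.
have E0 : \int[P]_w ((Y w - Y' w) ^+ 2)%:E = 0.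
  apply/eqP; rewrite eq_le; apply/andP; split; last first.
    by apply: integral_ge0 => w _; rewrite lee_fin sqr_ge0.
  apply/lee_addgt0Pr => e e0; rewrite add0e.
  have C0 : (0 < 6 + 16 * normal_var :> R)%R.
    by rewrite ltr_wpDr// mulr_ge0 ?normal_var_ge0.
  have := small _ (divr_gt0 e0 C0).
  by rewrite mulrCA mulfV ?mulr1// gt_eqF.
have := (ae_eq_integral_abs P measurableT
  (measurable_sqrB mY mY')).1.
under eq_integral do rewrite gee0_abs ?lee_fin ?sqr_ge0//.
move=> /(_ E0); apply: filterS => w /(_ I) /= [] /eqP.
by rewrite sqrf_eq0 subr_eq0 => /eqP.
Qed.

End wiener_uniqueness.

(** * Almost surely uniform convergence of step integrals *)

Section wiener_approximation.
Context {R : realType} {d : measure_display} {Omega : measurableType d}.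
Variables (P : probability Omega R) (W : R -> Omega -> R) (delta : R -> R).
Hypothesis BW : brownian_motion P W.
Local Open Scope ereal_scope.
Local Notation mu := (@lebesgue_measure R).
Hypothesis md : measurable_fun (`[0%R, 1%R] : set R) delta.
Variable q : nat -> seq (R * R * R).
Hypothesis q01 : forall n, step_in 1 (q n).
Hypothesis qdelta : forall n,
  \int[mu]_(s in `[0%R, 1%R]) ((step_fun (q n) s - delta s) ^+ 2)%:E <= ((16^-1 ^+ n)%R)%:E.

Definition wiener_approx (n : nat) (t : R) (w : Omega) : R :=
  step_integral W (trunc_step t (q n)) w.
Local Notation I := wiener_approx.

Lemma step_gap n m : (n <= m)%N ->
  \int[mu]_(s in `[0%R, 1%R]) ((step_fun (q n) s - step_fun (q m) s) ^+ 2)%:E <=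
  ((4 * 16^-1 ^+ n)%R)%:E.
Proof.
move=> nm; apply: le_trans
  (L2_triangle_itv (@measurable_step_fun _ _ _) md (@measurable_step_fun _ _ _)) _.
apply: (@le_trans _ _ (2%:E * (((16^-1 ^+ n)%R)%:E + ((16^-1 ^+ n)%R)%:E))).
  rewrite lee_wpmul2l// leeD//.
  under eq_integral do rewrite -sqrrN opprB.
  apply: le_trans (qdelta m) _; rewrite lee_fin ler_wiXn2l// ?invr_ge0//.
  by rewrite invf_le1// ler1n.
by rewrite -EFinD -EFinM lee_fin le_eqVlt; apply/orP; left; apply/eqP; ring.
Qed.

Lemma wiener_approx_sub n m t w :
  step_integral W (trunc_step t (step_sub (q n) (q m))) w = (I n t w - I m t w)%R.
Proof. by rewrite trunc_step_sub step_sub_integral. Qed.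

Lemma measurable_wiener_approx n t : (0 <= t <= 1)%R ->
  measurable_fun [set: Omega] (I n t).
Proof.
move=> /andP[t0 t1]; apply: (measurable_step_integral BW t1).
exact: (trunc_step_in t0 (q01 n)).
Qed.

(** The squared distances decrease like 16^-n so that division by the squared threshold 4^-n still
    leaves a summable 4^-n. *)
Lemma jump_prob n (D : seq R) : {in D, forall t, 0 <= t <= 1}%R ->
  measurable [set w | exists2 t, t \in D & (2^-1 ^+ n <= `|I n t w - I n.+1 t w|)%R] ->
  P [set w | exists2 t, t \in D & (2^-1 ^+ n <= `|I n t w - I n.+1 t w|)%R] <=
  ((4 * normal_var) * 4^-1 ^+ n)%:E.
Proof.
move=> D01; set E := [set _ | _] => mE.
have qq : step_in 1 (step_sub (q n) (q n.+1)) by exact: step_sub_in.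
have lam0 : (0 < 2^-1 ^+ n :> R)%R by rewrite exprn_gt0// invr_gt0.
have := brownian_maximal BW qq D01 lam0.
under [X in _ <= _ * X -> _]eq_integral do rewrite step_sub_fun.
rewrite (_ : mkset _ = E); last first.
  by apply/seteqP; split => w /= [t tD h]; exists t => //; move: h; rewrite wiener_approx_sub.
move=> h; have {}h := le_trans h (lee_wpmul2l (lee_tofin normal_var_ge0) (step_gap (leqnSn n))).
have PE : P E \is a fin_num by exact: fin_num_measure.
move: h; rewrite -(fineK PE) -!EFinM !lee_fin.
have -> : (16^-1 ^+ n = 4^-1 ^+ n * 4^-1 ^+ n :> R)%R.
  by rewrite -exprMn; congr (_ ^+ _)%R; field.
have -> : ((2^-1 ^+ n) ^+ 2 = 4^-1 ^+ n :> R)%R.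
  by rewrite -exprM mulnC exprM; congr (_ ^+ _)%R; field.
have q0 : (0 < 4^-1 ^+ n :> R)%R by rewrite exprn_gt0// invr_gt0.
move=> h; rewrite -(ler_pM2l q0); apply: (le_trans h).
by rewrite le_eqVlt; apply/orP; left; apply/eqP; ring.
Qed.

(** A countable set of times keeps the event measurable; continuity of the paths extends the control
    to all of [0, 1]. *)
Definition jump (n : nat) : set Omega :=
  [set w | exists i, (2^-1 ^+ n <= `|I n (dense01 i) w - I n.+1 (dense01 i) w|)%R].

Let jump_at n i : set Omega :=
  [set w | (2^-1 ^+ n <= `|I n (dense01 i) w - I n.+1 (dense01 i) w|)%R].

Let measurable_jump_at n i : measurable (jump_at n i).
Proof.
by apply: measurable_norm_ge; apply: measurable_funB; apply: measurable_wiener_approx;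
  exact: dense01_in.
Qed.

Let jumpE n : jump n = \bigcup_i jump_at n i.
Proof. by apply/seteqP; split => w /= [i]; [exists i|move=> _; exists i]. Qed.

Lemma measurable_jump n : measurable (jump n).
Proof. by rewrite jumpE; apply: bigcup_measurable. Qed.

(** The first j points of the dense set give increasing events with a bound independent of j. The
    bound is weakened from 4^-n to a multiple of 2^-(n+1), the series used for Borel-Cantelli. *)
Lemma prob_jump n : P (jump n) <= ((8 * normal_var) / (2 ^ n.+1)%:R)%:E.
Proof.
pose F (j : nat) : set Omega := [set w | exists2 t, t \in [seq dense01 i | i <- iota 0 j] &
  (2^-1 ^+ n <= `|I n t w - I n.+1 t w|)%R].
have FE j : F j = \bigcup_(i in `I_j) jump_at n i.
  apply/seteqP; split=> w /=.
    by move=> [t /mapP[i]]; rewrite mem_iota => ij -> h; exists i.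
  move=> [i ij h]; exists (dense01 i) => //; apply/mapP; exists i => //.
  by rewrite mem_iota.
have mF j : measurable (F j) by rewrite FE; apply: bigcup_measurable.
have UF : \bigcup_j F j = jump n.
  rewrite jumpE; apply/seteqP; split=> w.
    by move=> [j _]; rewrite FE => -[i _ h]; exists i.
  by move=> [i _ h]; exists i.+1 => //; rewrite FE; exists i => /=.
have ndF : {homo F : n m / (n <= m)%N >-> (n <= m)%O}.
  move=> i j ij; apply/subsetPset => w; rewrite !FE => -[k ki h]; exists k => //.
  exact: leq_trans ki ij.
have mU : measurable (\bigcup_j F j) by rewrite UF; exact: measurable_jump.
have := nondecreasing_cvg_mu (mu := P) mF mU ndF; rewrite UF.
move=> /cvge_to_le; apply; apply: nearW => j /=.
apply: le_trans (jump_prob _ (mF j)) _.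
  by move=> t /mapP[i _ ->]; exact: dense01_in.
rewrite lee_fin natrX exprS invfM mulrA -[leRHS]mulrA -(mulrA 8%R).
have -> : (8 * (normal_var * (2^-1 / 2 ^+ n)) = 4 * normal_var * 2^-1 ^+ n :> R)%R.
  by rewrite -exprVn; field.
rewrite ler_wpM2l ?mulr_ge0 ?normal_var_ge0//.
by rewrite lerXn2r ?nnegrE ?invr_ge0// lef_pV2 ?posrE// ler_nat.
Qed.

Lemma lim_sup_jump0 : P (lim_sup_set jump) = 0.
Proof.
apply: lim_sup_set_cvg0; first exact: measurable_jump.
have C0 : (0 <= 8 * normal_var :> R)%R by rewrite mulr_ge0// normal_var_ge0.
apply: (@le_lt_trans _ _ ((8 * normal_var :> R)%R%:E)); last exact: ltry.
apply: le_trans (epsilon_trick0 xpredT C0).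
by apply: lee_nneseries => // n _; exact: prob_jump.
Qed.

Lemma wiener_approx_cont n w : {within `[0%R, 1%R], continuous (W ^~ w)} ->
  {within `[0%R, 1%R], continuous ((I n) ^~ w)}.
Proof.
move=> cW; have := q01 n; rewrite /step_in => /allP qn.
have cWm (b : R) : (0 <= b <= 1)%R ->
    {within `[0%R, 1%R], continuous (fun t => W (Num.min b t) w)}.
  move=> /andP[b0 b1]; apply/cont01P => t /andP[t0 t1] e e0.
  have mt01 s : (0 <= s <= 1 -> 0 <= Num.min b s <= 1)%R.
    by move=> /andP[s0 s1]; rewrite le_min b0 s0 ge_min b1.
  have [|r r0 rP] := (cont01P _).1 cW (Num.min b t) _ _ e0.
    by apply: mt01; rewrite t0.
  exists r => // s s01 st; apply: rP; first exact: mt01.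
  apply: le_lt_trans st; rewrite /Num.min.
  case: (ltP b s) => h1; case: (ltP b t) => h2; rewrite ?subrr ?normr0//.
    by rewrite !ger0_norm; lra.
  by rewrite distrC [leRHS]distrC !ger0_norm; lra.
rewrite /wiener_approx; under [X in {within _, continuous X}]eq_fun do rewrite step_integral_trunc.
elim: (q n) qn => [_|e l IH el].
  under [X in {within _, continuous X}]eq_fun do rewrite big_nil.
  by apply: continuous_subspaceT => ?; exact: cvg_cst.
under [X in {within _, continuous X}]eq_fun do rewrite big_cons.
have /andP[/andP[a0 ab] b1] := el e (mem_head _ _).
move=> t; apply: cvgD; last by apply: IH => e' e'l; apply: el; rewrite inE e'l orbT.
apply: cvgM; first exact: cvg_cst.
by apply: cvgB; apply: cWm; rewrite ?a0 ?b1 ?(le_trans a0 ab) ?(le_trans ab b1).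
Qed.

(** N joins the limit superior of the jumps to a null event covering the discontinuous paths of W.
    Off N only finitely many jumps occur, and the bound passes from the dense times to all times;
    the factor 1 is the constant [C] of [geometric_lim]. *)
Lemma wiener_exceptional : exists N : set Omega, [/\ measurable N, P N = 0 &
  forall w, ~ N w -> {within `[0%R, 1%R], continuous (W ^~ w)} /\
    exists n0, forall n, (n0 <= n)%N -> forall t, (0 <= t <= 1)%R ->
      (`|I n.+1 t w - I n t w| <= 1 * 2^-1 ^+ n)%R].
Proof.
have [_ _ _ _ [N0 [mN0 PN0 cN0]]] := BW.
have mL : measurable (lim_sup_set jump).
  by apply: bigcapT_measurable => n; apply: bigcup_measurable => k _; exact: measurable_jump.
exists (lim_sup_set jump `|` N0); split.
- exact: measurableU.
- by apply: null_set_setU => //; exact: lim_sup_jump0.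
- move=> w /not_orP[nL nN0].
  have cW : {within `[0%R, 1%R], continuous (W ^~ w)} by apply: contrapT => /cN0.
  split=> //; move: nL; rewrite /lim_sup_set /bigcap/= => /existsNP[n0 /not_implyP[_ h]].
  exists n0 => n n0n t t01; rewrite mul1r.
  apply: (dense01_le (u := fun t => I n.+1 t w - I n t w)%R) => // [|i].
    have c k := wiener_approx_cont (n := k) cW.
    by move=> x; apply: cvgB; apply: c.
  rewrite leNgt; apply/negP => lt; apply: h; exists n => //; exists i.
  by rewrite distrC; exact: ltW.
Qed.

Variable N : set Omega.
Hypotheses (mN : measurable N) (PN0 : P N = 0).
Hypothesis N_good : forall w, ~ N w -> {within `[0%R, 1%R], continuous (W ^~ w)} /\
    exists n0, forall n, (n0 <= n)%N -> forall t, (0 <= t <= 1)%R ->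
      (`|I n.+1 t w - I n t w| <= 1 * 2^-1 ^+ n)%R.

Definition wiener_limit (t : R) (w : Omega) : R :=
  (\1_(~` N) w * limn (fun n => I n t w))%R.
Local Notation M := wiener_limit.

Let half01 : (0 <= (2^-1 : R) < 1)%R.
Proof. by rewrite invr_ge0 ler0n invf_lt1// ltr1n. Qed.

Lemma wiener_limit_bad t w : N w -> M t w = 0%R.
Proof. by move=> Nw; rewrite /wiener_limit indicE memNset ?mul0r//; exact. Qed.

Lemma wiener_limit_good t w : ~ N w -> M t w = limn (fun n => I n t w).
Proof. by move=> Nw; rewrite /wiener_limit indicE mem_set ?mul1r. Qed.

Lemma wiener_limit_cvg t w : (0 <= t <= 1)%R -> ~ N w ->
  (fun n => I n t w) @ \oo --> M t w.
Proof.
move=> t01 Nw; rewrite wiener_limit_good//; have [_ [n0 h]] := N_good Nw.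
have q2 := half01.
by have [] := geometric_lim (@ler01 R) q2 (fun n n0n => h n n0n t t01).
Qed.

Lemma wiener_limit_cont w : {within `[0%R, 1%R], continuous (M ^~ w)}.
Proof.
have [Nw|Nw] := pselect (N w).
  have -> : M ^~ w = cst 0%R by apply/funext => t; exact: wiener_limit_bad.
  by apply: continuous_subspaceT => ?; exact: cvg_cst.
have [cW [n0 h]] := N_good Nw.
have q2 := half01.
apply: (@cont01_lim _ (fun n t => I n t w)) => [n|e e0]; first exact: wiener_approx_cont.
have q2n : (`|2^-1 : R| < 1)%R by rewrite ger0_norm; case/andP: q2.
have [n1 _ n1P] := (@cvgrPdist_lt _ _ _ _ _ _ _).1 (cvg_expr q2n) _ (divr_gt0 e0 (ltr0n R 2)).
exists (maxn n0 n1) => t t01; rewrite wiener_limit_good//.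
have [_ /(_ (maxn n0 n1) (leq_maxl _ _))] :=
  geometric_lim (@ler01 R) q2 (fun n n0n => h n n0n t t01).
rewrite distrC => /le_trans; apply.
have := n1P (maxn n0 n1) (leq_maxr _ _).
rewrite sub0r normrN ger0_norm ?exprn_ge0 ?(andP q2).1//.
have -> : (1 - 2^-1 = 2^-1 :> R)%R by field.
by rewrite mul1r invrK ltr_pdivlMr// => /ltW.
Qed.

Lemma wiener_limit0 w : M 0 w = 0%R.
Proof.
rewrite /wiener_limit; set u := (fun _ => _).
suff -> : u = cst 0%R by rewrite lim_cst// mulr0.
apply/funext => n; rewrite /u /wiener_approx step_integral_trunc.
rewrite big_seq big1// => e en; have /andP[/andP[a0 ab] b1] := allP (q01 n) _ en.
by rewrite !min_r ?subrr ?mulr0// (le_trans a0).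
Qed.

Let integral_sqr_itv_le t (u v : R -> R) : (t <= 1)%R ->
  (forall s, (s <= t)%R -> u s = v s) -> measurable_fun (`[0%R, 1%R] : set R) v ->
  \int[mu]_(s in `[0%R, t]) ((u s) ^+ 2)%:E <= \int[mu]_(s in `[0%R, 1%R]) ((v s) ^+ 2)%:E.
Proof.
move=> t1 uv mv; have -> : \int[mu]_(s in `[0%R, t]) ((u s) ^+ 2)%:E =
    \int[mu]_(s in `[0%R, t]) ((v s) ^+ 2)%:E.
  by apply: eq_integral => s; rewrite inE/= in_itv/= => /andP[_ st]; rewrite uv.
apply: ge0_subset_integral; try exact: measurable_itv.
- by apply/measurable_EFinP; exact: measurable_funX.
- by move=> s _; rewrite lee_fin sqr_ge0.
- by apply: subset_itvl; rewrite bnd_simp.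
Qed.

Let E_gap n m t : (0 <= t <= 1)%R -> (n <= m)%N ->
  \int[P]_w ((I n t w - I m t w) ^+ 2)%:E <= (normal_var * (4 * 16^-1 ^+ n))%:E.
Proof.
move=> t01 nm; have /andP[t0 t1] := t01.
rewrite (brownian_isometry_sub BW t01 (trunc_step_in t0 (q01 n)) (trunc_step_in t0 (q01 m))).
rewrite EFinM lee_wpmul2l ?lee_fin ?normal_var_ge0//.
apply: le_trans (step_gap nm).
apply: (@integral_sqr_itv_le t (fun s => step_fun _ s - step_fun _ s)%R
  (fun s => step_fun _ s - step_fun _ s)%R t1) => [s st|].
  by rewrite !trunc_step_fun.
by apply: measurable_funB; exact: measurable_step_fun.
Qed.

(** Fatou's lemma applied to [E_gap] as m tends to infinity, off the null event where convergence
    may fail. *)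
Let E_lim n t : (0 <= t <= 1)%R -> measurable_fun [set: Omega] (M t) ->
  \int[P]_w ((I n t w - M t w) ^+ 2)%:E <= (normal_var * (4 * 16^-1 ^+ n))%:E.
Proof.
move=> t01 mM; have mI k := measurable_wiener_approx k t01.
have mNC : measurable (~` N) by exact: measurableC.
(* The shift by n makes [E_gap] applicable for every k. *)
pose g k w := ((I n t w - I (k + n)%N t w) ^+ 2)%:E.
have mg k (D : set Omega) : measurable_fun D (g k).
  apply/measurable_EFinP; apply: measurable_funX; apply: measurable_funB;
  exact: measurable_funS (mI _).
rewrite (ge0_negligible_integral mN) ?setTD//; last 2 first.
- by apply/measurable_EFinP; apply: measurable_funX; exact: measurable_funB.
- by move=> w _; rewrite lee_fin sqr_ge0.
have -> : \int[P]_(w in ~` N) ((I n t w - M t w) ^+ 2)%:E =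
    \int[P]_(w in ~` N) limn_einf (g ^~ w).
  apply: eq_integral => w; rewrite inE => Nw; apply/esym.
  apply: (cvg_limn_einf_sup _).1; apply: cvg_EFin; first exact: nearW.
  have c : (fun k => I n t w - I (k + n)%N t w)%R @ \oo --> (I n t w - M t w)%R.
    apply: cvgB; first exact: cvg_cst.
    by rewrite (cvg_shiftn n (fun k => I k t w) _); exact: wiener_limit_cvg.
  exact: (cvgM c c).
apply: le_trans (fatou P mNC (fun k => mg k _) _) _.
  by move=> k w _; rewrite lee_fin sqr_ge0.
rewrite limn_einf_lim; apply: lime_le; first exact: is_cvg_einfs.
apply: nearW => k; apply: (@le_trans _ _ (\int[P]_(w in ~` N) g k w)).
  by apply: ereal_inf_lbound; exists k => /=.
apply: (@le_trans _ _ (\int[P]_w g k w)); last by apply: E_gap => //; exact: leq_addl.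
by apply: ge0_subset_integral => // w _; rewrite lee_fin sqr_ge0.
Qed.

Lemma wiener_limit_integral t : (0 <= t <= 1)%R -> measurable_fun [set: Omega] (M t) ->
  wiener_integral P W delta t (M t).
Proof.
move=> t01 mM; have /andP[t0 t1] := t01; split=> //.
have cvg16 (c : R) : (fun n => (c * 16^-1 ^+ n)%:E) @ \oo --> 0.
  have q16 : (`|16^-1 : R| < 1)%R by rewrite ger0_norm ?invr_ge0// invf_lt1// ltr1n.
  apply: cvg_EFin; first exact: nearW.
  rewrite -[X in _ --> X](mulr0 c).
  by apply: cvgM; [exact: cvg_cst|exact: cvg_expr].
exists (fun n => trunc_step t (q n)); split.
- by move=> n; exact: trunc_step_in (q01 n).
- apply: le_ereal_cvg0 (cvg16 1%R) => n.
    by apply: integral_ge0 => s _; rewrite lee_fin sqr_ge0.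
  rewrite mul1r; apply: le_trans (qdelta n).
  apply: (@integral_sqr_itv_le t (fun s => step_fun _ s - delta s)%R
    (fun s => step_fun _ s - delta s)%R t1) => [s st|].
    by rewrite !trunc_step_fun.
  by apply: measurable_funB => //; exact: measurable_step_fun.
- apply: le_ereal_cvg0 (cvg16 (normal_var * 4)%R) => n.
    by apply: integral_ge0 => s _; rewrite lee_fin sqr_ge0.
  by rewrite -mulrA; exact: E_lim.
Qed.

End wiener_approximation.

(** * Measurability with respect to the augmented Brownian sigma-algebra *)

Section brownian_measurability.
Context {R : realType} {d : measure_display} {Omega : measurableType d}.
Variables (P : probability Omega R) (W : R -> Omega -> R).

(** Naming the generator lets Omega carry the generated sigma-algebra as a measurable type [G];
    being determined by W is then measurability on [G], to which the closure properties of
    measurable functions apply. *)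
Definition brownian_generator : set (set Omega) :=
  [set E | exists t (B : set R), [/\ t \in `[0, 1], measurable B & E = W t @^-1` B]] `|`
  [set N | measurable N /\ P N = 0%E].

Local Notation G := (g_sigma_algebraType brownian_generator).

Lemma measurable_determined_by (x : R -> Omega -> R) :
  (forall t, 0 <= t <= 1 -> measurable_fun [set: G] (x t : G -> R)) -> determined_by P W x.
Proof.
move=> mx t B t01 mB; have t01' : 0 <= t <= 1 by move: t01; rewrite in_itv.
by have := mx t t01' measurableT B mB; rewrite setTI.
Qed.

Lemma measurable_generator_path t : 0 <= t <= 1 -> measurable_fun [set: G] (W t : G -> R).
Proof.
move=> t01 _ B mB; rewrite setTI; apply: sub_sigma_algebra; left.
by exists t, B; split=> //; rewrite in_itv.
Qed.

Lemma measurable_generator_null N : measurable N -> P N = 0%E -> measurable (N : set G).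
Proof. by move=> mN PN0; apply: sub_sigma_algebra; right. Qed.

Hypothesis BW : brownian_motion P W.

Lemma generator_measurable (A : set Omega) : measurable (A : set G) -> measurable A.
Proof.
apply: smallest_sub; first exact: sigma_algebra_measurable.
move=> _ [[t [B [t01 mB ->]]]|[]//].
by have [mW _ _ _ _] := BW; rewrite -[_ @^-1` _]setTI; exact: mW.
Qed.

Lemma wiener_process_exists (delta : R -> R) :
  measurable_fun (`[0, 1] : set R) delta ->
  (\int[@lebesgue_measure R]_(s in `[0%R, 1%R]) ((delta s) ^+ 2)%:E < +oo)%E ->
  exists M : R -> Omega -> R, [/\ wiener_integral_process P W delta M,
    (forall w, {within `[0, 1], continuous (M ^~ w)}),
    (forall w, M 0 w = 0) &
    forall t, 0 <= t <= 1 -> measurable_fun [set: G] (M t : G -> R)].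
Proof.
move=> md id.
have /choice[q qP] : forall n, exists q, step_in 1 q /\
    (\int[@lebesgue_measure R]_(s in `[0%R, 1%R]) ((step_fun q s - delta s) ^+ 2)%:E <=
     (16^-1 ^+ n)%:E)%E.
  move=> n; have e0 : 0 < 16^-1 ^+ n :> R by rewrite exprn_gt0// invr_gt0.
  by have [q q1 q2] := step_dense md id e0; exists q.
have q01 n := (qP n).1; have qd n := (qP n).2.
have [N [mN PN0 NP]] := wiener_exceptional BW md q01 qd.
pose M := wiener_limit W q N; exists M.
have mM t : 0 <= t <= 1 -> measurable_fun [set: G] (M t : G -> R).
  move=> t01; have /andP[t0 t1] := t01; have mNC : measurable (~` N : set G).
    by apply: measurableC; exact: measurable_generator_null.
  (* The null event N belongs to the augmented sigma-algebra, so the approximants set to 0 on N are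
     measurable for it and converge at every outcome. *)
  apply: (@measurable_fun_cvg _ G R setT
    (fun n w => \1_(~` N) w * wiener_approx W q n t w)) => [n|w _].
    apply: measurable_funM; first exact: measurable_indic.
    exact: (measurable_elementary_integral measurable_generator_path t1
      (trunc_step_in t0 (q01 n))).
  have [Nw|Nw] := pselect (N w).
    rewrite /M wiener_limit_bad//.
    rewrite indicE memNset; last by exact.
    by under eq_fun do rewrite mul0r; exact: cvg_cst.
  rewrite indicE mem_set//; under eq_fun do rewrite mul1r.
  exact: wiener_limit_cvg NP _ _ t01 Nw.
have cM w : {within `[0, 1], continuous (M ^~ w)} by exact: (wiener_limit_cont q01 NP).
split=> //; last by move=> w; exact: wiener_limit0.
split; last by apply: aeW.
move=> t t01; have {}t01 : 0 <= t <= 1 by move: t01; rewrite in_itv.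
apply: (wiener_limit_integral BW md q01 qd mN PN0 NP t01).
move=> _ B mB; rewrite setTI; apply: generator_measurable.
by have := mM t t01 measurableT B mB; rewrite setTI.
Qed.

End brownian_measurability.

(** * The stochastic equation *)

Section drift.
Context {R : realType}.

(** k is the supremum itself, finite since it lies between 0 and p, so the strict inequality
    survives; the mean value theorem does the rest. *)
Lemma cond_C2_lipschitz (p : R) (B : R -> R -> R) : cond_C2 p B ->
  exists k : R, [/\ 0 <= k, k < p & forall s, 0 <= s <= 1 -> forall y z, z <= y ->
    `|B s y - B s z| <= k * (y - z)].
Proof.
move=> [dB + _]; rewrite /sup_strip; set S := (X in ereal_sup X) => Sp.
have S_le s x : 0 <= s <= 1 -> (`|'D_1 (B s) x|%:E <= ereal_sup S)%E.
  move=> s01; apply: ereal_sup_ubound; exists s; first by rewrite /= in_itv.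
  by exists x.
have S0 : (0%:E <= ereal_sup S)%E.
  by apply: le_trans (S_le 0 0 _); rewrite ?lee_fin// lexx ler01.
have Sfin : ereal_sup S \is a fin_num by rewrite ge0_fin_numE// (lt_trans Sp)// ltry.
exists (fine (ereal_sup S)); split.
- by rewrite -lee_fin fineK.
- by rewrite -lte_fin fineK.
move=> s s01 y z; rewrite le_eqVlt => /predU1P[->|zy]; first by rewrite !subrr normr0 mulr0.
have s01' : s \in `[0, 1] by rewrite in_itv.
have [x _ ->] := MVT (f := B s) (df := fun x => 'D_1 (B s) x) zy
  (fun x _ => derivableP (dB s x s01'))
  (derivable_within_continuous (fun x _ => dB s x s01')).
rewrite normrM [`|y - z|]gtr0_norm ?subr_gt0//.
by rewrite ler_pM2r ?subr_gt0// -lee_fin fineK// S_le.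
Qed.

End drift.

Section stochastic_equation.
Context {R : realType} {d : measure_display} {Omega : measurableType d}.
Variables (P : probability Omega R) (W : R -> Omega -> R).
Hypothesis BW : brownian_motion P W.
Variables (A : R -> R -> R) (f delta : R -> R) (eps m L : R) (b : boundary).
Let a s y := A s y + f s.
Hypotheses (m0 : 0 < m) (mL : m <= L).
Hypothesis lip : forall s, 0 <= s <= 1 -> forall y z : R, `|a s y - a s z| <= L * `|y - z|.
Hypothesis mono : forall s, 0 <= s <= 1 -> forall y z : R, z <= y -> m * (y - z) <= a s y - a s z.
Hypothesis inta : forall y : R, lebesgue_measure.-integrable `[0, 1] (EFin \o a ^~ y).
Hypotheses (eps0 : 0 < eps ^+ 2) (eps_small : 12 * L ^+ 2 * eps ^+ 2 <= m).
Hypothesis md : measurable_fun (`[0, 1] : set R) delta.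
Hypothesis id : (\int[@lebesgue_measure R]_(s in `[0%R, 1%R]) ((delta s) ^+ 2)%:E < +oo)%E.

(** Almost sure equality at each single time becomes simultaneous on a countable dense set, and then
    at all times by continuity. *)
Lemma wiener_process_unique M M' : wiener_integral_process P W delta M ->
  wiener_integral_process P W delta M' ->
  {ae P, forall w, forall t, 0 <= t <= 1 -> M t w = M' t w}.
Proof.
move=> [wM cM] [wM' cM'].
have D : {ae P, forall w, forall i, M (dense01 i) w = M' (dense01 i) w}.
  apply: ae_foralln => i; have i01 := @dense01_in R i.
  have i01' : dense01 i \in `[(0 : R), 1] by rewrite in_itv.
  apply: (wiener_integral_unique BW i01 _ (wM _ i01') (wM' _ i01')).
  apply: measurable_funS md; first exact: measurable_itv.
  by apply: subset_itvl; rewrite bnd_simp; case/andP: i01.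
apply: filterS3 D cM cM' => w D cM cM' t t01.
apply/eqP; rewrite -subr_eq0 -normr_le0.
apply: (dense01_le (u := fun t => M t w - M' t w)) => // [x|i].
  by apply: cvgB; [exact: cM|exact: cM'].
by rewrite D subrr normr0.
Qed.

Lemma strong_solution_unique : exists x, strong_solution P W A f delta eps b x /\
  forall y, strong_solution P W A f delta eps b y -> indistinguishable P x y.
Proof.
have [M [wM cM M0 mM]] := wiener_process_exists BW md id.
pose x t w := bvp_sol a L b (eps ^+ 2) (M ^~ w) t.
have sx w : solves_bvp a b (eps ^+ 2) (M ^~ w) (x ^~ w).
  exact: (bvp_sol_solves m0 mL lip mono inta b eps0 eps_small (@cM w) (M0 w)).
exists x; split.
  split.
  - apply: measurable_determined_by => t t01.
    exact: (measurable_bvp_sol m0 mL lip mono inta b eps0 eps_small mM cM t01).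
  - by apply: aeW => w; have [] := sx w.
  - by apply: aeW => w; have [] := sx w.
  - exists M; split=> //; apply: aeW => w t t01; have [_ _ ->] := sx w.
      by rewrite /slope mulrDr addrA.
    by move: t01; rewrite in_itv.
move=> y [_ C1y bcy [M' [wM' eqy]]].
(* A competing solution brings its own version of the integral process; almost surely it coincides
   with [M], so both solutions belong to the same deterministic problem. *)
have MM' := wiener_process_unique wM wM'.
apply: filterS (filterI (filterI C1y bcy) (filterI eqy MM')) => w [[C1 bc] [eq MM]] t.
rewrite in_itv/= => t01.
have sy : solves_bvp a b (eps ^+ 2) (M ^~ w) (y ^~ w).
  by split=> // s s01; rewrite eq ?in_itv// /slope MM// mulrDr addrA.
exact: (bvp_unique m0 mL lip mono inta eps0 eps_small (@cM w) (sx w) sy t01).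
Qed.

End stochastic_equation.

Unset Implicit Arguments.

(* h_drift is what gives a meaning to the drift integral: by (C1)-(C2),
   A(s, x(s)) + f(s) is then integrable in s for every continuous path x. *)
Theorem theorem2p1 (R : realType) (A B : R -> R -> R) (p : R)
    (f delta : R -> R)
    (h_C1 : cond_C1 A p B)
    (h_C2 : cond_C2 p B)
    (h_drift : forall x : R, (@lebesgue_measure R).-integrable `[0%R, 1%R]
                               (fun s => (A s x + f s)%:E))
    (h_delta_meas : measurable_fun (`[0%R, 1%R] : set R) delta)
    (h_delta : (\int[@lebesgue_measure R]_(s in `[0%R, 1%R])
                  ((delta s) ^+ 2)%:E < +oo)%E) :
  exists eps0 : R, 0 < eps0 /\
    forall (eps : R), 0 < eps -> eps <= eps0 ->
    forall (b : boundary) (d : measure_display) (Omega : measurableType d)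
           (P : probability Omega R) (W : R -> Omega -> R),
      brownian_motion P W ->
      exists x : R -> Omega -> R,
        strong_solution P W A f delta eps b x /\
        forall y : R -> Omega -> R,
          strong_solution P W A f delta eps b y -> indistinguishable P x y.
Proof.
have [k [k0 kp Bk]] := cond_C2_lipschitz h_C2; have [p0 AE _] := h_C1.
(* The drift increases in x at rates between m = p - k and L = p + k; f cancels in its
   differences. *)
have m0 : 0 < p - k by rewrite subr_gt0.
have mL : p - k <= p + k by lra.
have L0 : 0 < 12 * (p + k) ^+ 2 by rewrite mulr_gt0// exprn_gt0// ltr_wpDr.
have aE s y z : 0 <= s <= 1 ->
    (A s y + f s) - (A s z + f s) = p * (y - z) + (B s y - B s z).
  by move=> /andP[s0 _]; rewrite !AE//; ring.
have mono s : 0 <= s <= 1 -> forall y z : R, z <= y ->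
    (p - k) * (y - z) <= (A s y + f s) - (A s z + f s).
  move=> s01 y z zy; rewrite aE//; have := Bk s s01 y z zy.
  by rewrite ler_norml => /andP[+ _]; rewrite mulrBl => h; lra.
have lip s : 0 <= s <= 1 -> forall y z : R,
    `|(A s y + f s) - (A s z + f s)| <= (p + k) * `|y - z|.
  move=> s01 y z; wlog zy : y z / z <= y.
    by move=> h; case: (leP z y) => [/h//|/ltW/h]; rewrite distrC [`|z - y|]distrC.
  rewrite aE// [`|y - z|]ger0_norm ?subr_ge0// mulrDl.
  rewrite (le_trans (ler_normD _ _))// lerD ?Bk//.
  by rewrite ger0_norm// mulr_ge0 ?subr_ge0// ltW.
(* For eps <= 1 one has eps^2 <= eps, so bounding eps itself by m / (12 L^2) is enough and no square
   root is needed. *)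
exists (Num.min 1 ((p - k) / (12 * (p + k) ^+ 2))).
split; first by rewrite lt_min ltr01 divr_gt0.
move=> eps eps0; rewrite le_min => /andP[eps1 eps_le] b d Omega P W BW.
apply: (strong_solution_unique BW b m0 mL lip mono h_drift _ _ h_delta_meas h_delta).
  by rewrite exprn_gt0.
rewrite mulrC -ler_pdivlMr//; apply: le_trans eps_le.
by rewrite expr2 ler_piMr// ltW.
Qed.
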